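(* Let $N\ge3$, let $A=\begin{pmatrix}\alpha&1-\alpha\\1-\alpha&\alpha\end{pmatrix}$ with $\alpha\in\mathbb{R}$, and for $n\in\mathbb{N}$ set $$\bar\alpha_n=\frac{2n^2+2Nn-2n+N^2}{N(N+2)}.$$ Consider the system associated with $A$, $$\begin{cases}-\Delta u_1=\alpha u_1^{\frac{N+2}{N-2}}+(1-\alpha)u_2^{\frac{N+2}{N-2}}&\text{in }\mathbb{R}^N,\\ -\Delta u_2=(1-\alpha)u_1^{\frac{N+2}{N-2}}+\alpha u_2^{\frac{N+2}{N-2}}&\text{in }\mathbb{R}^N,\\ u_1,u_2>0&\text{in }\mathbb{R}^N,\\ u_1,u_2\in D^{1,2}(\mathbb{R}^N).\end{cases}\qquad( * )$$ Then, for any integer $n\ge2$, the point $(\bar\alpha_n,U,U)$ is a radial bifurcation point for the curve of trivial solutions $(\alpha,U,U)$ of $( * )$. More precisely, there exist $\varepsilon_0>0$ and a continuously differentiable curve $$(-\varepsilon_0,\varepsilon_0)\to\mathbb{R}\times\bigl(D^{1,2}_{\mathrm{rad}}(\mathbb{R}^N)\bigr)^2:\ \varepsilon\mapsto\bigl(\alpha(\varepsilon),u_1(\varepsilon),u_2(\varepsilon)\bigr)$$ passing through $(\bar\alpha_n,U,U)$, i.e., $(\alpha(0),u_1(0),u_2(0))=(\bar\alpha_n,U,U)$, such that, for all $\varepsilon\in(-\varepsilon_0,\varepsilon_0)$, $(u_1(\varepsilon),u_2(\varepsilon))$ is a radial solution of $( * )$ with $\alpha=\alpha(\varepsilon)$.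 Moreover, $$u_1(\varepsilon)=U+\varepsilon W_n(|x|)+\varepsilon\phi_{1,\varepsilon}(|x|),\qquad u_2(\varepsilon)=U-\varepsilon W_n(|x|)+\varepsilon\phi_{2,\varepsilon}(|x|),$$ where $\phi_{1,\varepsilon},\phi_{2,\varepsilon}$ are functions uniformly bounded in $D^{1,2}(\mathbb{R}^N)$ and such that $\phi_{s,0}=0$ for $s=1,2$.
   Context: $2^*=\frac{2N}{N-2}$, $D^{1,2}(\mathbb{R}^N)=\{u\in L^{2^*}(\mathbb{R}^N): |\nabla u|\in L^2(\mathbb{R}^N)\}$ with norm $\|\nabla u\|_{L^2}$, and $D^{1,2}_{\mathrm{rad}}(\mathbb{R}^N)$ is its subspace of radial functions. Moreover $$U(x)=\frac{[N(N-2)]^{\frac{N-2}{4}}}{(1+|x|^2)^{\frac{N-2}{2}}},\qquad W_n(|x|)=\frac{1}{(1+|x|^2)^{\frac{N-2}{2}}}\,P_n^{\left(\frac{N-2}{2},\frac{N-2}{2}\right)}\!\left(\frac{1-|x|^2}{1+|x|^2}\right),$$ where the Jacobi polynomials are $P_m^{(\beta,\gamma)}(\xi)=\sum_{s=0}^m\binom{m+\beta}{s}\binom{m+\gamma}{m-s}\left(\frac{\xi-1}{2}\right)^{m-s}\left(\frac{\xi+1}{2}\right)^s$. The function $U$ solves $-\Delta U=U^{\frac{N+2}{N-2}}$, so $(U,U)$ solves $( * )$ for every $\alpha$. No separate definition of ''radial bifurcation point'' is used; the phrase is made precise by the sentence beginning ''More precisely''. *)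

(* Defs.v *)
From HB Require Import structures.
From mathcomp Require Import all_boot all_order all_algebra.
From mathcomp Require Import all_classical all_reals all_analysis.

Set Implicit Arguments.
Unset Strict Implicit.
Unset Printing Implicit Defensive.
Import Order.TTheory GRing.Theory Num.Theory.
Import numFieldNormedType.Exports.

Local Open Scope classical_set_scope.
Local Open Scope ring_scope.

Definition rV_display : measure_display.
Proof. exact: default_measure_display. Qed.

Section rV_measurable.
Context (R : realType) (n : nat).

Let coord (i : 'I_n) (x : 'rV[R]_n) : R := x ord0 i.

Let rV_set0 : g_sigma_preimage coord set0.
Proof. exact: sigma_algebra0. Qed.

Let rV_setC A : g_sigma_preimage coord A -> g_sigma_preimage coord (~` A).
Proof. exact: sigma_algebraC. Qed.

Let rV_bigcup (F : (set 'rV[R]_n)^nat) : (forall i, g_sigma_preimage coord (F i)) ->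
  g_sigma_preimage coord (\bigcup_i (F i)).
Proof. exact: sigma_algebra_bigcup. Qed.

(* Since R is second countable, this product sigma-algebra is the Borel
   sigma-algebra of R^n. *)
HB.instance Definition _ := @isMeasurable.Build rV_display 'rV[R]_n
  (g_sigma_preimage coord) rV_set0 rV_setC rV_bigcup.

Lemma measurable_coord (i : 'I_n) :
  measurable_fun [set: 'rV[R]_n] (fun x => x ord0 i).
Proof.
move=> _ Y mY; rewrite setTI; apply: sub_sigma_algebra => /=.
rewrite -bigcup_seq/=; exists i => /=; first by rewrite mem_index_enum.
by exists Y => //; rewrite setTI.
Qed.

Lemma measurable_fun_coordP d (T : measurableType d) (f : T -> 'rV[R]_n) :
  (forall i, measurable_fun setT (fun t => f t ord0 i)) ->
  measurable_fun setT f.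
Proof.
move=> mf _ Y; rewrite setTI.
move: Y; rewrite [X in forall Y, X Y -> _]/measurable/= => Y.
move=> /(_ [set Y | measurable (f @^-1` Y)]) /=; apply; split.
  split => /=.
  - by rewrite preimage_set0.
  - by move=> A mA; rewrite setTD -preimage_setC; exact: measurableC.
  - by move=> A mA; rewrite preimage_bigcup; exact: bigcup_measurable.
move=> A; rewrite -bigcup_seq/= => -[i _] [B mB <-] /=.
rewrite setTI.
have := mf i measurableT B mB.
by rewrite setTI.
Qed.

End rV_measurable.

Section lebesgue_rV.
Context (R : realType).

Definition cons_rV n (p : R * 'rV[R]_n) : 'rV[R]_n.+1 :=
  row_mx (const_mx p.1 : 'rV_1) p.2.

Definition uncons_rV n (x : 'rV[R]_n.+1) : R * 'rV[R]_n :=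
  (x ord0 ord0, \row_i x ord0 (lift ord0 i)).

Lemma cons_rV0 n (p : R * 'rV[R]_n) : cons_rV p ord0 ord0 = p.1.
Proof.
have -> : (ord0 : 'I_n.+1) = lshift n (ord0 : 'I_1) by exact/val_inj.
by apply: etrans (row_mxEl _ _ _ _) _; rewrite mxE.
Qed.

Lemma cons_rVS n (p : R * 'rV[R]_n) i :
  cons_rV p ord0 (lift ord0 i) = p.2 ord0 i.
Proof.
have -> : lift (ord0 : 'I_n.+1) i = rshift 1 i by exact/val_inj.
exact: row_mxEr.
Qed.

Lemma cons_rVK n : cancel (@cons_rV n) (@uncons_rV n).
Proof.
move=> p; rewrite /uncons_rV cons_rV0 [RHS]surjective_pairing; congr pair.
by apply/rowP => i; rewrite mxE cons_rVS.
Qed.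

Lemma measurable_cons_rV n : measurable_fun setT (@cons_rV n).
Proof.
apply: measurable_fun_coordP => i; case: (unliftP ord0 i) => [j|] ->.
- under eq_fun do rewrite cons_rVS.
  exact: (measurableT_comp (measurable_coord j) measurable_snd).
- under eq_fun do rewrite cons_rV0.
  exact: measurable_fst.
Qed.

Lemma measurable_uncons_rV n : measurable_fun setT (@uncons_rV n).
Proof.
apply/measurable_fun_pairP; split; first  exact: measurable_coord.
apply: measurable_fun_coordP => i /=.
under eq_fun do rewrite mxE.
exact: measurable_coord.
Qed.

Section succ.
Context (n : nat) (mu : {sigma_finite_measure set 'rV[R]_n -> \bar R}).
Local Open Scope ereal_scope.

Definition lebesgue_rV_succ : set 'rV[R]_n.+1 -> \bar R :=
  pushforward (@lebesgue_measure R \x mu) (@cons_rV n).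

Let mpre A : measurable A -> measurable (@cons_rV n @^-1` A).
Proof. by move=> mA; rewrite -[X in measurable X]setTI; exact: measurable_cons_rV. Qed.

Let succ0 : lebesgue_rV_succ set0 = 0.
Proof. by rewrite /lebesgue_rV_succ /pushforward preimage_set0 measure0. Qed.

Let succ_ge0 A : 0 <= lebesgue_rV_succ A.
Proof. exact: (measure_ge0 (@lebesgue_measure R \x mu)). Qed.

Let succ_sigma_additive : semi_sigma_additive lebesgue_rV_succ.
Proof.
move=> F mF tF mUF; rewrite /lebesgue_rV_succ /pushforward preimage_bigcup.
apply: measure_semi_sigma_additive.
- by move=> k; exact: mpre.
- apply/trivIsetP => i j _ _ ij; rewrite -preimage_setI.
  by move/trivIsetP : tF => /(_ _ _ _ _ ij) ->//; rewrite preimage_set0.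
- by rewrite -preimage_bigcup; exact: mpre.
Qed.

HB.instance Definition _ := isMeasure.Build _ _ _ lebesgue_rV_succ
  succ0 succ_ge0 succ_sigma_additive.

Let succ_sigma_finite : sigma_finite setT lebesgue_rV_succ.
Proof.
have /sigma_finiteP[G [GT ndG mG]] := sigma_finiteT (@lebesgue_measure R).
have /sigma_finiteP[H [HT ndH mH]] := sigma_finiteT mu.
pose F k := G k `*` H k.
have FT : setT = \bigcup_k F k.
  rewrite -setXTT GT HT predeqE => -[x y]; split.
    move=> [/= [k _ Gkx] [l _ Hly]]; exists (maxn k l) => //; split.
    - by move: x Gkx; exact/subsetPset/ndG/leq_maxl.
    - by move: y Hly; exact/subsetPset/ndH/leq_maxr.
  by move=> [k _ []/= ? ?]; split; exists k.
have mF k : measurable (F k) /\ (@lebesgue_measure R \x mu) (F k) < +oo.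
  have [mGk Gkoo] := mG k; have [mHk Hkoo] := mH k.
  split; first exact: measurableX.
  by rewrite product_measure1E// lte_mul_pinfty// ge0_fin_numE.
exists (fun k => @uncons_rV n @^-1` F k).
  by rewrite -preimage_bigcup -FT preimage_setT.
move=> k; have [mFk Fkoo] := mF k; split.
  by rewrite -[X in measurable X]setTI; exact: measurable_uncons_rV.
rewrite /lebesgue_rV_succ /pushforward -comp_preimage.
suff -> : @uncons_rV n \o @cons_rV n = id by [].
by apply/funext => p /=; rewrite cons_rVK.
Qed.

HB.instance Definition _ := Measure_isSigmaFinite.Build _ _ _ lebesgue_rV_succ
  succ_sigma_finite.

End succ.

(* Lebesgue measure on R^n: the n-fold product of the Lebesgue measure on R. *)
Fixpoint lebesgue_rV (n : nat) : {sigma_finite_measure set 'rV[R]_n -> \bar R} :=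
  match n with
  | 0%N => \d_(0 : 'rV[R]_0)
  | m.+1 => lebesgue_rV_succ (lebesgue_rV m)
  end.

End lebesgue_rV.

Section calculus.
Context (R : realType) (N : nat).
Implicit Types (x : 'rV[R]_N) (f : 'rV[R]_N -> R).

(* The norm `|x| of the normed module 'rV[R]_N is the sup norm. *)
Definition enorm x : R := Num.sqrt (\sum_(i < N) x ord0 i ^+ 2).

Definition evec (i : 'I_N) : 'rV[R]_N := delta_mx ord0 i.

Definition partial (i : 'I_N) f : 'rV[R]_N -> R := fun x => 'D_(evec i) f x.

Fixpoint Cn (k : nat) f : Prop :=
  continuous f /\
  match k with
  | 0%N => True
  | m.+1 => forall i, (forall x, derivable f x (evec i)) /\ Cn m (partial i f)
  end.

Definition laplacian f x : R := \sum_(i < N) partial i (partial i f) x.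

Definition test_function f : Prop :=
  (forall k, Cn k f) /\ exists r : R, forall x, r < enorm x -> f x = 0.

Definition radial f : Prop := forall x y, enorm x = enorm y -> f x = f y.

End calculus.

Section D12.
Context (R : realType) (N : nat).
Implicit Types (u : 'rV[R]_N -> R) (g : 'rV[R]_N -> 'rV[R]_N).
Local Notation mu := (lebesgue_rV R N).

Definition critical_exponent : R := 2 * N%:R / (N%:R - 2).

Definition is_weak_gradient u g : Prop :=
  forall (f : 'rV[R]_N -> R) (i : 'I_N), test_function f ->
    \int[mu]_x (u x * partial i f x) = - \int[mu]_x (g x ord0 i * f x).

Definition is_L2_gradient u g : Prop :=
  [/\ measurable_fun setT g,
      (fun x => enorm (g x)) \in Lfun mu 2%:E
    & is_weak_gradient u g].

(* Elements are functions rather than classes modulo a.e. equality. *)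
Definition D12 : set ('rV[R]_N -> R) :=
  [set u | u \in Lfun mu critical_exponent%:E /\ exists g, is_L2_gradient u g].

Definition D12_rad : set ('rV[R]_N -> R) := D12 `&` [set u | radial u].

(* The L2 norm of |grad u|.  The weak gradient is unique up to a null set, so
   for u in D12 the set below has exactly one element. *)
Definition D12_norm u : \bar R :=
  ereal_inf [set Lnorm mu 2%:E (fun x => (enorm (g x))%:E) | g in is_L2_gradient u].

(* Continuously differentiable curves ]-e0, e0[ -> D12_rad; the quantification
   over the derivative du is unfolded because D12_norm is only a seminorm on
   functions. *)
Definition C1_curve_D12_rad (e0 : R) (u : R -> 'rV[R]_N -> R) : Prop :=
  exists du : R -> 'rV[R]_N -> R, forall e, - e0 < e < e0 ->
    [/\ D12_rad (u e), D12_rad (du e),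
        D12_norm (h^-1 *: (u (e + h) - u e) - du e) @[h --> 0^'] --> 0%E
      & D12_norm (du (e + h) - du e) @[h --> 0] --> 0%E].

End D12.

Definition C1_curve_R (R : realType) (e0 : R) (a : R -> R) : Prop :=
  forall e, - e0 < e < e0 ->
    derivable a e 1 /\ {for e, continuous (derive1 a)}.

Section critical_system.
Context (R : realType) (N : nat).
Implicit Types (u : 'rV[R]_N -> R).

Definition critical_power (t : R) : R := t `^ ((N%:R + 2) / (N%:R - 2)).

Definition is_solution (alpha : R) u1 u2 : Prop :=
  [/\ Cn 2 u1 /\ Cn 2 u2,
      forall x, - laplacian u1 x =
        alpha * critical_power (u1 x) + (1 - alpha) * critical_power (u2 x),
      forall x, - laplacian u2 x =
        (1 - alpha) * critical_power (u1 x) + alpha * critical_power (u2 x),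
      forall x, 0 < u1 x /\ 0 < u2 x
    & D12 u1 /\ D12 u2].

Definition bubble (x : 'rV[R]_N) : R :=
  (N%:R * (N%:R - 2)) `^ ((N%:R - 2) / 4)
    / (1 + enorm x ^+ 2) `^ ((N%:R - 2) / 2).

End critical_system.

(* Binomial coefficient with real upper entry. *)
Definition gbinom (R : realType) (a : R) (k : nat) : R :=
  (\prod_(i < k) (a - i%:R)) / k`!%:R.

Definition jacobi (R : realType) (m : nat) (beta gamma xi : R) : R :=
  \sum_(s < m.+1) gbinom (m%:R + beta) s * gbinom (m%:R + gamma) (m - s)
    * ((xi - 1) / 2) ^+ (m - s) * ((xi + 1) / 2) ^+ s.

Definition W (R : realType) (N n : nat) (r : R) : R :=
  ((1 + r ^+ 2) `^ ((N%:R - 2) / 2))^-1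
    * jacobi n ((N%:R - 2) / 2) ((N%:R - 2) / 2) ((1 - r ^+ 2) / (1 + r ^+ 2)).

Definition alpha_bar (R : realType) (N n : nat) : R :=
  (2 * n%:R ^+ 2 + 2 * N%:R * n%:R - 2 * n%:R + N%:R ^+ 2)
    / (N%:R * (N%:R + 2)).

(* Main.v *)
(* In the variables u_i = c (1 + |x|^2)^(-(N-2)/2) v_i(xi), xi = (1 - |x|^2) / (1 + |x|^2),
   the system becomes (L + k) v_1 = k (alpha v_1^p + (1 - alpha) v_2^p), and symmetrically, on
   [-1, 1], with k = N (N - 2) / 4, p = (N + 2) / (N - 2) and
   L = - (1 - xi^2) d^2 + N xi d.  The bubble becomes the constant 1.  The Jacobi
   polynomial of degree n is an eigenfunction of L for n (n + N - 1), and alpha_bar n is the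
   value of alpha at which it solves the antisymmetric linearised problem.

   No Sobolev theory is needed, because L preserves polynomials.  Write L = D - d^2, where D is
   diagonal on the monomials.  After the rescaling x = tau xi, the perturbation becomes
   tau^2 d_x^2, and D^-1 gains the two derivatives.  The Lyapunov-Schmidt equations, with the
   p-th power defined through w^(N-2) = v^(N+2), thus become a fixed point problem for a
   contraction on polynomials in x and in the bifurcation parameter t, for the l^1 norm of the
   coefficients.  The symmetric part of the linearisation has the dilations as kernel, which
   corresponds to x^1; it is avoided by parity.

   The Picard iterates converge geometrically.  Their limits in x and t are taken pointwise;
   bounds on derivatives and quadratic Taylor estimates, uniform on balls of the l^1 norm, pass
   to the limit and make the limits C^2 in x and C^1 in t.  The energy norm of a lifted profile
   is bounded by the sup norms of the profile and of its derivative, so that the l^1 estimates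
   turn into estimates in D^{1,2}. *)

Require Import Defs.
From HB Require Import structures.
From mathcomp Require Import all_boot all_order all_algebra.
From mathcomp Require Import all_classical all_reals all_analysis.
From mathcomp Require Import measurable_realfun ring lra.

Set Implicit Arguments.
Unset Strict Implicit.
Unset Printing Implicit Defensive.
Import Order.TTheory GRing.Theory Num.Theory.
Import numFieldNormedType.Exports.

Local Open Scope classical_set_scope.
Local Open Scope ring_scope.

(** * Polynomials with the l^1 norm *)

(** The bivariate polynomials are not complete for the l^1 norm, and no completion is formed:
    parity, vanishing coefficients and vanishing at t = 0 are proved for each iterate, and only
    identities between values and estimates pass to the limit. The scale tau is essential because
    the inverse of D - mu k followed by d^2 is bounded but not small; its bound rests on the gaps of
    the quadratic spectrum j (j + N - 1). The same scale moves [-1, 1] to |x| <= tau <= 1/4, inside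
    the disc of radius 1/2. The l^1 norm belongs to the unit disc, and on the smaller disc it
    controls every derivative with a constant independent of the degree. There are two resonances.
    Degree 1 carries no free parameter. Degree n is the bifurcation itself: its solvability
    condition is met by the choice of alpha, the coefficient of x^n in the antisymmetric part being
    normalised to 1. *)

Record is_rnorm (R : realType) (A : comNzRingType) (nr : A -> R) : Prop := IsRnorm {
  rnorm0 : nr 0 = 0;
  rnorm_ge0 : forall x, 0 <= nr x;
  rnormD : forall x y, nr (x + y) <= nr x + nr y;
  rnormN : forall x, nr (- x) = nr x;
  rnormM : forall x y, nr (x * y) <= nr x * nr y }.

Section poly_norm.
Context (R : realType) (A : comNzRingType) (nr : A -> R).

(** Generic in the coefficient ring so that it can be iterated: from [R] to polynomials in t, and
    from these to polynomials in x. *)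
Definition pnorm (p : {poly A}) : R := \sum_(i < size p) nr p`_i.

Hypothesis hnr : is_rnorm nr.

Lemma pnormE m (p : {poly A}) : (size p <= m)%N ->
  pnorm p = \sum_(i < m) nr p`_i.
Proof.
move=> pm; rewrite /pnorm (big_ord_widen_cond _ xpredT (fun i => nr p`_i) pm).
rewrite [RHS](bigID (fun i : 'I_m => (i < size p)%N))/=.
rewrite [X in _ + X]big1 ?addr0// => i.
by rewrite -leqNgt => pi; rewrite nth_default// (rnorm0 hnr).
Qed.

Lemma pnorm_coef (p : {poly A}) i : nr p`_i <= pnorm p.
Proof.
have [ip|pi] := ltnP i (size p); last first.
  by rewrite nth_default// (rnorm0 hnr) sumr_ge0// => j _; exact: rnorm_ge0.
rewrite /pnorm (bigD1 (Ordinal ip))//= lerDl sumr_ge0// => j _.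
exact: rnorm_ge0.
Qed.

Lemma pnorm0 : pnorm 0 = 0.
Proof. by rewrite /pnorm size_poly0 big_ord0. Qed.

Lemma pnormMXaddC (p : {poly A}) c : pnorm (p * 'X + c%:P) = pnorm p + nr c.
Proof.
rewrite (@pnormE (size p).+1); last by rewrite size_MXaddC; case: ifP.
rewrite big_ord_recl/= addrC coefD coefMX coefC eqxx add0r; congr (_ + _).
by apply: eq_bigr => i _; rewrite coefD coefMX coefC/= addr0.
Qed.

Lemma pnormC c : pnorm c%:P = nr c.
Proof. by rewrite -[c%:P]add0r -(mul0r 'X) pnormMXaddC pnorm0 add0r. Qed.

Lemma pnormD p q : pnorm (p + q) <= pnorm p + pnorm q.
Proof.
have sm := size_polyD p q.
rewrite (pnormE (leq_maxl (size p) (size q))) (pnormE (leq_maxr (size p) (size q))).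
rewrite (pnormE sm) -big_split/=; apply: ler_sum => i _.
by rewrite coefD; exact: rnormD.
Qed.

Lemma pnormN p : pnorm (- p) = pnorm p.
Proof.
by rewrite /pnorm size_polyN; apply: eq_bigr => i _; rewrite coefN (rnormN hnr).
Qed.

Lemma pnorm_ge0 p : 0 <= pnorm p.
Proof. by apply: sumr_ge0 => i _; exact: rnorm_ge0. Qed.

Lemma pnormCM c p : pnorm (c%:P * p) <= nr c * pnorm p.
Proof.
rewrite (@pnormE (size p)) ?mul_polyC ?size_scale_leq// mulr_sumr.
by apply: ler_sum => i _; rewrite coefZ; exact: rnormM.
Qed.

(** Horner's scheme reduces the product to multiplication by a constant and by ['X]; the latter
    preserves the norm. *)
Lemma pnormM p q : pnorm (p * q) <= pnorm p * pnorm q.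
Proof.
elim/poly_ind: p => [|p c IH]; first by rewrite !mul0r pnorm0 mul0r.
rewrite mulrDl; apply: le_trans (pnormD _ _) _.
rewrite pnormMXaddC mulrDl lerD ?pnormCM//.
by rewrite -mulrA ['X * q]mulrC mulrA -[X in pnorm X]addr0 -[0]polyC0 pnormMXaddC
  (rnorm0 hnr) addr0.
Qed.

Lemma pnorm_rnorm : is_rnorm pnorm.
Proof.
split; [exact: pnorm0|exact: pnorm_ge0|exact: pnormD|exact: pnormN|exact: pnormM].
Qed.

Lemma pnormMX p : pnorm (p * 'X) = pnorm p.
Proof. by rewrite -[_ * _]addr0 -[0]polyC0 pnormMXaddC (rnorm0 hnr) addr0. Qed.

End poly_norm.

(** The linear operators below act coefficient by coefficient, if necessary after a shift, so a
    bound uniform over the coefficients is a bound on the operator. *)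
Lemma pnorm_coef_le (R : realType) (A A' : comNzRingType) (nr : A -> R) (nr' : A' -> R)
    (hnr : is_rnorm nr) (hnr' : is_rnorm nr') C (p : {poly A}) (q : {poly A'}) :
  0 <= C -> (forall i, nr' q`_i <= C * nr p`_i) -> pnorm nr' q <= C * pnorm nr p.
Proof.
move=> C0 qp; rewrite (pnormE hnr' (leq_maxl (size q) (size p))).
rewrite (pnormE hnr (leq_maxr (size q) (size p))) mulr_sumr.
by apply: ler_sum => i _; exact: qp.
Qed.

(** * Bounded Lipschitz maps, uniformly in the scale *)

Section tame.
Context (R : realType) (V : zmodType) (nV : V -> R).

(* Uniformly bounded and Lipschitz on the unit ball, for all values in [0, 1]
   of the parameter. *)
Definition tame (Z : comNzRingType) (nr : Z -> R) (F : R -> V -> Z) :=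
  exists2 C, 0 <= C & forall tau X Y, 0 <= tau <= 1 -> nV X <= 1 -> nV Y <= 1 ->
    nr (F tau X) <= C /\ nr (F tau X - F tau Y) <= C * nV (X - Y).

Hypothesis nV_ge0 : forall X, 0 <= nV X.

Section one.
Context (Z : comNzRingType) (nr : Z -> R) (hnr : is_rnorm nr).

Lemma tame_cst (c : R -> Z) C : (forall tau, 0 <= tau <= 1 -> nr (c tau) <= C) ->
  tame nr (fun tau _ => c tau).
Proof.
move=> cC; have C0 : 0 <= C.
  by apply: le_trans (cC 0 _); rewrite ?(rnorm_ge0 hnr)// lexx ler01.
exists C => // tau X Y tau01 _ _; rewrite cC// subrr (rnorm0 hnr); split => //.
by rewrite mulr_ge0.
Qed.

Lemma tameD F G : tame nr F -> tame nr G -> tame nr (fun tau X => F tau X + G tau X).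
Proof.
move=> [C C0 hC] [D D0 hD]; exists (C + D); first exact: addr_ge0.
move=> tau X Y t01 X1 Y1.
have [F1 F2] := hC _ _ _ t01 X1 Y1; have [G1 G2] := hD _ _ _ t01 X1 Y1.
split; first by apply: le_trans (rnormD hnr _ _) _; exact: lerD.
rewrite opprD addrACA mulrDl; apply: le_trans (rnormD hnr _ _) _; exact: lerD.
Qed.

Lemma tameN F : tame nr F -> tame nr (fun tau X => - F tau X).
Proof.
move=> [C C0 hC]; exists C => // tau X Y t01 X1 Y1.
have [F1 F2] := hC _ _ _ t01 X1 Y1.
by rewrite (rnormN hnr) -opprD (rnormN hnr).
Qed.

Lemma tameB F G : tame nr F -> tame nr G -> tame nr (fun tau X => F tau X - G tau X).
Proof. by move=> hF hG; apply: tameD => //; exact: tameN. Qed.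

Lemma tameM F G : tame nr F -> tame nr G -> tame nr (fun tau X => F tau X * G tau X).
Proof.
move=> [C C0 hC] [D D0 hD]; exists (C * D + C * D).
  by rewrite addr_ge0 ?mulr_ge0.
move=> tau X Y t01 X1 Y1.
have [F1 F2] := hC _ _ _ t01 X1 Y1; have [G1 G2] := hD _ _ _ t01 X1 Y1.
have [FY _] := hC _ _ _ t01 Y1 X1.
have nge := rnorm_ge0 hnr.
split.
  apply: le_trans (rnormM hnr _ _) _.
  by rewrite (le_trans (ler_pM _ _ F1 G1))// lerDl mulr_ge0.
have -> : F tau X * G tau X - F tau Y * G tau Y =
  (F tau X - F tau Y) * G tau X + F tau Y * (G tau X - G tau Y) by ring.
apply: le_trans (rnormD hnr _ _) _; rewrite [leRHS]mulrDl; apply: lerD.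
  apply: le_trans (rnormM hnr _ _) _; rewrite [leRHS]mulrAC.
  exact: ler_pM.
by apply: le_trans (rnormM hnr _ _) _; rewrite -mulrA; exact: ler_pM.
Qed.

Lemma tame_mulrn k F : tame nr F -> tame nr (fun tau X => F tau X *+ k).
Proof.
move=> hF; elim: k => [|k IH].
  by apply: (@tame_cst (fun=> 0) 0) => tau _; rewrite (rnorm0 hnr).
have -> : (fun tau X => F tau X *+ k.+1) = fun tau X => F tau X *+ k + F tau X.
  by apply/funext => tau; apply/funext => X; rewrite mulrSr.
exact: tameD.
Qed.

End one.

Lemma tame_lin (Z Z' : comNzRingType) (nr : Z -> R) (nr' : Z' -> R) (f : Z -> Z') K F :
  0 <= K -> (forall x, nr' (f x) <= K * nr x) -> {morph f : x y / x - y} ->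
  tame nr F -> tame nr' (fun tau X => f (F tau X)).
Proof.
move=> K0 fK fB [C C0 hC]; exists (K * C); first exact: mulr_ge0.
move=> tau X Y t01 X1 Y1; have [F1 F2] := hC _ _ _ t01 X1 Y1; split.
  by apply: le_trans (fK _) _; exact: ler_wpM2l.
by rewrite -fB -mulrA; apply: le_trans (fK _) _; exact: ler_wpM2l.
Qed.

Lemma tame_proj (Z : comNzRingType) (nr : Z -> R) (f : V -> Z) :
  (forall x, nr (f x) <= nV x) -> {morph f : x y / x - y} ->
  tame nr (fun _ X => f X).
Proof.
move=> fV fB; exists 1 => // tau X Y _ X1 _; rewrite mul1r -fB; split => //.
exact: le_trans X1.
Qed.

End tame.

Section taylor_remainder.
Context (Z : comNzRingType).

(* (1 + th y)^k = 1 + k th y + th^2 Rk th y k. *)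
Fixpoint Rk (th y : Z) (k : nat) : Z :=
  if k is j.+1 then Rk th y j * (1 + th * y) + (y * y) *+ j else 0.

Lemma RkE th y k :
  (1 + th * y) ^+ k = 1 + (th * y) *+ k + th ^+ 2 * Rk th y k.
Proof.
elim: k => [|k IH]/=; first by rewrite expr0 mulr0n mulr0 !addr0.
by rewrite exprSr IH mulrSr -[(th * y) *+ k]mulr_natr -[(y * y) *+ k]mulr_natr; ring.
Qed.

End taylor_remainder.

(** Used for three morphisms: evaluation in t, evaluation in x, and the reflection of x. *)
Lemma Rk_rmorph (Z Z' : comNzRingType) (f : {rmorphism Z -> Z'}) th y k :
  f (Rk th y k) = Rk (f th) (f y) k.
Proof.
elim: k => [|k IH]/=; first exact: rmorph0.
by rewrite !(rmorphD, rmorphM, rmorph1, rmorphMn, IH).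
Qed.

Lemma tame_Rk (R : realType) (V : zmodType) (nV : V -> R) (nV_ge0 : forall X, 0 <= nV X)
    (Z : comNzRingType) (nr : Z -> R) (hnr : is_rnorm nr) k F G :
  tame nV nr F -> tame nV nr G ->
  tame nV nr (fun tau X => Rk (F tau X) (G tau X) k).
Proof.
move=> hF hG; elim: k => [|k IH]/=.
  by apply: (tame_cst nV_ge0 hnr (c := fun=> 0) (C := 0)) => tau _; rewrite (rnorm0 hnr).
apply: (tameD hnr); last by apply: (tame_mulrn nV_ge0 hnr); exact: (tameM hnr).
apply: (tameM hnr) => //; apply: (tameD hnr); last exact: (tameM hnr).
exact: (tame_cst nV_ge0 hnr (c := fun=> 1) (C := nr 1)).
Qed.

Section picard.
Context (R : realType) (V : zmodType) (nV : V -> R).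
Hypothesis nV0 : nV 0 = 0.
Hypothesis nVD : forall X Y, nV (X + Y) <= nV X + nV Y.
Variable Phi : V -> V.
Hypothesis Phi_ball : forall X, nV X <= 1 -> nV (Phi X) <= 1.
Hypothesis Phi_half : forall X Y, nV X <= 1 -> nV Y <= 1 ->
  nV (Phi X - Phi Y) <= 2^-1 * nV (X - Y).

Lemma picard_ball k : nV (iter k Phi 0) <= 1.
Proof. by elim: k => [|k IH]/=; rewrite ?nV0 ?ler01//; exact: Phi_ball. Qed.

Lemma picard_cauchy k : nV (iter k.+1 Phi 0 - iter k Phi 0) <= 2^-1 ^+ k.
Proof.
elim: k => [|k IH]; first by rewrite /= subr0 expr0 (picard_ball 1).
rewrite exprS; apply: le_trans (Phi_half (picard_ball k.+1) (picard_ball k)) _.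
exact: ler_wpM2l.
Qed.

End picard.

(** * The fixed point problem *)

Section norms.
Context (R : realType).

Lemma normr_rnorm : is_rnorm (fun x : R => `|x|).
Proof.
split; [exact: normr0|by []|exact: ler_normD|exact: normrN|].
by move=> x y; rewrite normrM.
Qed.

Definition norm1 : {poly R} -> R := pnorm (fun x : R => `|x|).
Definition norm2 : {poly {poly R}} -> R := pnorm norm1.

Lemma norm1_rnorm : is_rnorm norm1. Proof. exact/pnorm_rnorm/normr_rnorm. Qed.
Lemma norm2_rnorm : is_rnorm norm2. Proof. exact/pnorm_rnorm/norm1_rnorm. Qed.

Lemma norm1Z c (p : {poly R}) : norm1 (c *: p) <= `|c| * norm1 p.
Proof.
by apply: (pnorm_coef_le normr_rnorm normr_rnorm) => // i; rewrite coefZ normrM.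
Qed.

Lemma rnorm_mulrn (Z : comNzRingType) (nr : Z -> R) k x : is_rnorm nr ->
  nr (x *+ k) <= k%:R * nr x.
Proof.
move=> hnr; elim: k => [|k IH]; first by rewrite mulr0n mul0r (rnorm0 hnr).
rewrite mulrSr mulrSr mulrDl mul1r; apply: le_trans (rnormD hnr _ _) _.
exact: lerD.
Qed.

Definition bicst (c : R) : {poly {poly R}} := c%:P%:P.

Lemma norm2_bicst c : norm2 (bicst c) = `|c|.
Proof. by rewrite /norm2 (pnormC norm1_rnorm) /norm1 (pnormC normr_rnorm). Qed.

Lemma norm2C (a : {poly R}) : norm2 a%:P = norm1 a.
Proof. exact: (pnormC norm1_rnorm). Qed.

Lemma norm1MXaddC (p : {poly R}) c : norm1 (p * 'X + c%:P) = norm1 p + `|c|.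
Proof. exact: (pnormMXaddC normr_rnorm). Qed.

End norms.

Section bifurcation_map.
Context (R : realType) (N n : nat).
Local Notation B := {poly {poly R}}.

Definition mu (j : nat) : R := j%:R * (j%:R + N%:R - 1).

Lemma mu_diff (j k : nat) : mu j - mu k = (j%:R - k%:R) * (j%:R + k%:R + N%:R - 1).
Proof. by rewrite /mu; ring. Qed.

Hypothesis N3 : (3 <= N)%N.

Lemma ge3N : 3 <= N%:R :> R. Proof. by rewrite ler_nat. Qed.

(** By [mu_diff] the gap is |j - k| times a factor larger than j. As j and k differ by at least 1, j
    is at most (k + 1) |j - k|; this yields the quadratic lower bound that pays for two
    derivatives. *)
Lemma norm_mu_diff (j k : nat) : j != k ->
  j%:R * (j%:R - 1) <= (k%:R + 1) * `|mu j - mu k| /\ 1 <= `|mu j - mu k|.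
Proof.
move=> jk; rewrite mu_diff normrM.
have N3' := ge3N.
have j0 : 0 <= j%:R :> R by []. have k0 : 0 <= k%:R :> R by [].
rewrite (@ger0_norm _ (_ - 1)); last by lra.
have [jk1|jk1] : 1 <= j%:R - k%:R :> R \/ j%:R - k%:R <= -1 :> R.
- case: (ltngtP k j) (jk) => [| |->]; rewrite ?eqxx// => + _.
    by rewrite -(ler_nat R) -natr1; left; lra.
  by rewrite -(ler_nat R) -natr1; right; lra.
- rewrite ger0_norm; last by lra.
  have h : j%:R <= (k%:R + 1) * (j%:R - k%:R) :> R by nra.
  by rewrite mulrA; split; nra.
- rewrite ler0_norm; last by lra.
  have h : j%:R <= (k%:R + 1) * - (j%:R - k%:R) :> R by nra.
  by rewrite mulrA; split; nra.
Qed.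

(** The value 0 at the resonance makes [resolvent] total and its image free of x^k. Hence [psi] does
    not disturb the coefficient of x^n in [yy]. *)
Definition resolvent_coef (k j : nat) : R :=
  if j == k then 0 else (mu j - mu k)^-1.

(* A right inverse of D - mu k, where D x^j = mu j x^j, on polynomials without x^k term. *)
Definition resolvent (k : nat) (h : B) : B :=
  \poly_(j < size h) (resolvent_coef k j *: h`_j).

Lemma coef_resolvent k h j : (resolvent k h)`_j = resolvent_coef k j *: h`_j.
Proof.
by rewrite coef_poly; case: ltnP => // hj; rewrite nth_default ?scaler0.
Qed.

Lemma resolventB k : {morph resolvent k : x y / x - y}.
Proof.
move=> x y; apply/polyP => j.
by rewrite coefB !coef_resolvent coefB scalerBr.
Qed.

Lemma resolvent_coef_le k j : `|resolvent_coef k j| <= 1 /\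
  j%:R * (j%:R - 1) * `|resolvent_coef k j| <= k%:R + 1.
Proof.
rewrite /resolvent_coef; case: ifPn => [_|/norm_mu_diff[h1 h2]].
  by rewrite normr0 mulr0 ler01 addr_ge0.
have d0 : 0 < `|mu j - mu k| by apply: lt_le_trans h2.
rewrite normfV; split; first by rewrite invf_le1.
by rewrite ler_pdivrMr.
Qed.

Lemma norm2_resolvent k h : norm2 (resolvent k h) <= 1 * norm2 h.
Proof.
apply: (pnorm_coef_le (norm1_rnorm R) (norm1_rnorm R)) => // j; rewrite coef_resolvent mul1r.
apply: le_trans (norm1Z _ _) _; rewrite ler_piMl ?(rnorm_ge0 (norm1_rnorm R))//.
by have [] := resolvent_coef_le k j.
Qed.

Lemma norm2_d2_resolvent k h : norm2 (resolvent k h)^`()^`() <= (k%:R + 1) * norm2 h.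
Proof.
(* Two multiplications by ['X] keep the norm and bring the coefficient j (j - 1) h_j back to index
   j, so that coefficients can be compared at equal indices. *)
rewrite /norm2 -(pnormMX (norm1_rnorm R)) -(pnormMX (norm1_rnorm R)).
apply: (pnorm_coef_le (norm1_rnorm R) (norm1_rnorm R)) => [|j]; first by rewrite addr_ge0.
have nge := rnorm_ge0 (norm1_rnorm R).
have k1 : 0 <= k%:R + 1 :> R by rewrite addr_ge0.
case: j => [|[|j]]; rewrite !coefMX/= ?(rnorm0 (norm1_rnorm R)) ?mulr_ge0//.
rewrite !coef_deriv coef_resolvent -mulrnA.
apply: le_trans (rnorm_mulrn _ _ (norm1_rnorm R)) _.
apply: le_trans (ler_wpM2l (ler0n _ _) (norm1Z _ _)) _.
rewrite mulrA ler_wpM2r//.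
have [_] := resolvent_coef_le k j.+2; congr (_ * _ <= _).
by rewrite natrM; congr (_ * _); rewrite -natr1 addrK.
Qed.

Variable a : nat -> R.

(* The five components: D sigma - mu 1 sigma, D psi - mu n psi, the two remainders of the
   nonlinearity, and the shift of the eigenvalue parameter. *)
Local Notation V := (B * B * B * B * {poly R})%type.
Implicit Types (tau : R) (X : V).

Definition hs X := X.1.1.1.1.
Definition hp X := X.1.1.1.2.
Definition q1 X := X.1.1.2.
Definition q2 X := X.1.2.
Definition ell X := X.2.

Definition normV X : R :=
  norm2 (hs X) + norm2 (hp X) + norm2 (q1 X) + norm2 (q2 X) + norm1 (ell X).

Let n1 := norm1_rnorm R.
Let n2 := norm2_rnorm R.

Lemma normV_ge0 X : 0 <= normV X.
Proof. by rewrite !addr_ge0 ?(rnorm_ge0 n2) ?(rnorm_ge0 n1). Qed.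

Lemma normV0 : normV 0 = 0.
Proof. by rewrite /normV !(rnorm0 n2) (rnorm0 n1) !addr0. Qed.

Lemma norm_comp_le X : [/\ norm2 (hs X) <= normV X, norm2 (hp X) <= normV X,
  norm2 (q1 X) <= normV X, norm2 (q2 X) <= normV X & norm1 (ell X) <= normV X].
Proof.
rewrite /normV; have := rnorm_ge0 n2 (hs X); have := rnorm_ge0 n2 (hp X).
have := rnorm_ge0 n2 (q1 X); have := rnorm_ge0 n2 (q2 X).
have := rnorm_ge0 n1 (ell X).
by split; lra.
Qed.

Definition kappa : R := N%:R * (N%:R - 2) / 4.
Definition pexp : R := (N%:R + 2) / (N%:R - 2).
(** The value of 2 alpha - 1 at the bifurcation: the antisymmetric linearisation (L + kappa) y =
    kappa (2 alpha - 1) pexp y has a solution of degree n exactly for this value. *)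
Definition lambda_n : R := (mu n / kappa + 1) / pexp.

Definition sigma X := resolvent 1 (hs X).
Definition psi X := resolvent n (hp X).
(* When a j are the coefficients of a polynomial of degree n, normalised by a n = 1, this is
   tau ^+ n times its value at x / tau. *)
Definition Phat tau : B := \poly_(j < n.+1) (a j * tau ^+ (n - j))%:P.
(** Half the difference of the two perturbations [z1] and [z2], while [tau ^+ 2 * sigma] is half
    their sum; in these unknowns the linear parts decouple. The eigenfunction enters as the part of
    order 0 in tau. *)
Definition yy tau X := Phat tau + bicst (tau ^+ 2) * psi X.
Definition z1 tau X := bicst (tau ^+ 2) * sigma X + yy tau X.
Definition z2 tau X := bicst (tau ^+ 2) * sigma X - yy tau X.
(* The profiles are 1 + theta z1 and 1 + theta z2: with x = tau xi and the amplitude rescaled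
   to tau ^+ 6 * t, every unknown comes with a positive power of tau, hence a contraction. *)
Definition theta tau : B := bicst (tau ^+ 6) * 'X%:P.

(* For q = tau ^+ 2 * Fq tau z q, the expression 1 + theta (pexp z + tau ^+ 4 q) is the pexp-th
   power of 1 + theta z: expand (1 + theta (pexp z + tau ^+ 4 q)) ^+ (N - 2) =
   (1 + theta z) ^+ (N + 2) with RkE. *)
Definition Fq tau (z q : B) : B :=
  'X%:P * bicst (N%:R - 2)^-1 *
  (Rk (theta tau) z (N + 2) -
   Rk (theta tau) (bicst pexp * z + bicst (tau ^+ 4) * q) (N - 2)).

(** Half the sum of the two equations. The rows of the matrix add up to 1, so alpha drops out, and
    the linear term kappa (pexp - 1) = mu 1 has been moved into the resolvent. *)
Definition Fs X : B := (sigma X)^`()^`() + bicst (kappa / 2) * (q1 X + q2 X).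

(** Half the difference of the two equations, without its resonant linear term. Here 2 alpha - 1 is
    written as [lambda_n] + tau^2 [ell]. *)
Definition Qp tau X : B := (psi X)^`()^`() +
  bicst (kappa / 2) * (bicst lambda_n + bicst (tau ^+ 2) * (ell X)%:P) * (q1 X - q2 X).

(* The multiple of yy removes the coefficient of x ^+ n, as the coefficient of x ^+ n in yy
   is 1: this solvability condition determines the eigenvalue correction ell. *)
Definition Fp tau X : B := Qp tau X - ((Qp tau X)`_n)%:P * yy tau X.

Definition Fl tau X : {poly R} := - ((kappa * pexp)^-1%:P * (Qp tau X)`_n).

Definition Phi tau X : V :=
  (bicst (tau ^+ 2) * Fs X, bicst (tau ^+ 2) * Fp tau X,
   bicst (tau ^+ 2) * Fq tau (z1 tau X) (q1 X),
   bicst (tau ^+ 2) * Fq tau (z2 tau X) (q2 X), (tau ^+ 2)%:P * Fl tau X).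

Let tm2 := tame normV (@norm2 R).
Let tm1 := tame normV (@norm1 R).

Lemma tame_bicst (c : R -> R) C : (forall tau, 0 <= tau <= 1 -> `|c tau| <= C) ->
  tm2 (fun tau _ => bicst (c tau)).
Proof.
by move=> cC; apply: (tame_cst normV_ge0 n2) => tau /cC; rewrite norm2_bicst; exact.
Qed.

Lemma norm_expr01 k tau : 0 <= tau <= 1 -> `|tau ^+ k| <= 1.
Proof. by move=> /andP[t0 t1]; rewrite ger0_norm ?exprn_ge0 ?exprn_ile1. Qed.

Lemma tame_tauX k : tm2 (fun tau _ => bicst (tau ^+ k)).
Proof. by apply: tame_bicst => tau; exact: norm_expr01. Qed.

Lemma tame_real c : tm2 (fun _ _ => bicst c).
Proof. exact: (tame_bicst (c := fun=> c) (C := `|c|)). Qed.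

Lemma tame_t : tm2 (fun _ _ => 'X%:P).
Proof. exact: (tame_cst normV_ge0 n2 (c := fun=> 'X%:P) (C := norm2 'X%:P)). Qed.

Lemma tame_proj2 (f : V -> B) : (forall X, norm2 (f X) <= normV X) ->
  {morph f : x y / x - y} -> tm2 (fun _ X => f X).
Proof. exact: tame_proj. Qed.

Lemma tame_hs : tm2 (fun _ => hs).
Proof. by apply: tame_proj2 => [X|//]; have [] := norm_comp_le X. Qed.
Lemma tame_hp : tm2 (fun _ => hp).
Proof. by apply: tame_proj2 => [X|//]; have [] := norm_comp_le X. Qed.
Lemma tame_q1 : tm2 (fun _ => q1).
Proof. by apply: tame_proj2 => [X|//]; have [] := norm_comp_le X. Qed.
Lemma tame_q2 : tm2 (fun _ => q2).
Proof. by apply: tame_proj2 => [X|//]; have [] := norm_comp_le X. Qed.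
Lemma tame_ell : tm2 (fun _ X => (ell X)%:P).
Proof.
apply: tame_proj2 => [X|X Y]; last by rewrite /ell -polyCB.
by rewrite norm2C; have [] := norm_comp_le X.
Qed.

Lemma tame_resolvent k F : tm2 F -> tm2 (fun tau X => resolvent k (F tau X)).
Proof.
by apply: (tame_lin _ (norm2_resolvent k)) => //; exact: resolventB.
Qed.

Lemma tame_d2_resolvent k F : tm2 F ->
  tm2 (fun tau X => (resolvent k (F tau X))^`()^`()).
Proof.
apply: (tame_lin _ (norm2_d2_resolvent k)); first by rewrite addr_ge0.
by move=> x y; rewrite resolventB !derivB.
Qed.

Lemma norm2_Phat tau : 0 <= tau <= 1 -> norm2 (Phat tau) <= \sum_(j < n.+1) `|a j|.
Proof.
move=> t01; rewrite /norm2 (pnormE n1 (size_poly _ _)).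
apply: ler_sum => j _; rewrite coef_poly ltn_ord /norm1 (pnormC (normr_rnorm R)).
by rewrite normrM ler_piMr// norm_expr01.
Qed.

Lemma tame_Phat : tm2 (fun tau _ => Phat tau).
Proof. exact: (tame_cst normV_ge0 n2 norm2_Phat). Qed.

Lemma tame_yy : tm2 yy.
Proof.
apply: (tameD n2); first exact: tame_Phat.
apply: (tameM n2); first exact: tame_tauX.
by apply: tame_resolvent; exact: tame_hp.
Qed.

Lemma tame_tsigma : tm2 (fun tau X => bicst (tau ^+ 2) * sigma X).
Proof.
apply: (tameM n2); first exact: tame_tauX.
by apply: tame_resolvent; exact: tame_hs.
Qed.

Lemma tame_theta : tm2 (fun tau _ => theta tau).
Proof. by apply: (tameM n2); [exact: tame_tauX|exact: tame_t]. Qed.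

Lemma tame_Fq z q : tm2 z -> tm2 q -> tm2 (fun tau X => Fq tau (z tau X) (q tau X)).
Proof.
move=> hz hq; apply: (tameM n2).
  by apply: (tameM n2); [exact: tame_t|exact: tame_real].
apply: (tameB n2); first by apply: (tame_Rk normV_ge0 n2) => //; exact: tame_theta.
apply: (tame_Rk normV_ge0 n2); first exact: tame_theta.
apply: (tameD n2); apply: (tameM n2) => //; [exact: tame_real|exact: tame_tauX].
Qed.

Lemma tame_Fs : tm2 (fun _ => Fs).
Proof.
apply: (tameD n2); first by apply: tame_d2_resolvent; exact: tame_hs.
apply: (tameM n2); first exact: tame_real.
by apply: (tameD n2); [exact: tame_q1|exact: tame_q2].
Qed.

Lemma tame_Qp : tm2 Qp.
Proof.
apply: (tameD n2); first by apply: tame_d2_resolvent; exact: tame_hp.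
apply: (tameM n2); last by apply: (tameB n2); [exact: tame_q1|exact: tame_q2].
apply: (tameM n2); first exact: tame_real.
apply: (tameD n2); first exact: tame_real.
by apply: (tameM n2); [exact: tame_tauX|exact: tame_ell].
Qed.

Lemma tame_Qpn : tm1 (fun tau X => (Qp tau X)`_n).
Proof.
apply: (tame_lin (f := fun h : B => h`_n) ler01 _ _ tame_Qp).
  by move=> x; rewrite mul1r; exact: (pnorm_coef n1).
by move=> x y; rewrite coefB.
Qed.

Lemma tame_Fp : tm2 Fp.
Proof.
apply: (tameB n2); first exact: tame_Qp.
apply: (tameM n2); last exact: tame_yy.
apply: (tame_lin (f := fun h : {poly R} => h%:P) ler01 _ _ tame_Qpn).
  by move=> x; rewrite mul1r norm2C.
by move=> x y; rewrite polyCB.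
Qed.

Lemma tame_Fl : tm1 Fl.
Proof.
apply: (tameN n1); apply: (tameM n1); last exact: tame_Qpn.
exact: (tame_cst normV_ge0 n1 (c := fun=> (kappa * pexp)^-1%:P)
  (C := norm1 (kappa * pexp)^-1%:P)).
Qed.

Lemma contraction_exists : exists2 tau, 0 < tau <= 4^-1 &
  (forall X, normV X <= 1 -> normV (Phi tau X) <= 1) /\
  (forall X Y, normV X <= 1 -> normV Y <= 1 ->
     normV (Phi tau X - Phi tau Y) <= 2^-1 * normV (X - Y)).
Proof.
have t1 : tm2 z1 by apply: (tameD n2); [exact: tame_tsigma|exact: tame_yy].
have t2 : tm2 z2 by apply: (tameB n2); [exact: tame_tsigma|exact: tame_yy].
have [Ca Ca0 ha] := tame_Fs; have [Cb Cb0 hb] := tame_Fp.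
have [Cc Cc0 hc] := tame_Fq t1 tame_q1; have [Cd Cd0 hd] := tame_Fq t2 tame_q2.
have [Ce Ce0 he] := tame_Fl.
pose C := Ca + Cb + Cc + Cd + Ce.
have C0 : 0 <= C by rewrite /C !addr_ge0.
(* Since tau^2 <= tau, the total constant C is reduced below 1/2. The factor 4 also gives tau <=
   1/4, which later keeps the arguments of the profiles inside the disc of radius 1/2. *)
pose tau := (4 * (C + 1))^-1.
have tau0 : 0 < tau by rewrite invr_gt0; lra.
have tau1 : tau <= 4^-1 by rewrite lef_pV2 ?posrE; lra.
have tauC : tau * C <= 2^-1.
  by rewrite /tau mulrC ler_pdivrMr; lra.
have t01 : 0 <= tau <= 1 by apply/andP; split; lra.
have tt : tau ^+ 2 <= tau by rewrite expr2; nra.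
have tt0 : 0 <= tau ^+ 2 by rewrite exprn_ge0 ?ltW.
exists tau; first by rewrite tau0.
have tM F x : norm2 F <= x -> norm2 (bicst (tau ^+ 2) * F) <= tau ^+ 2 * x.
  move=> Fx; apply: le_trans (rnormM n2 _ _) _.
  by rewrite norm2_bicst ger0_norm// ler_wpM2l.
have tM1 F x : norm1 F <= x -> norm1 ((tau ^+ 2)%:P * F) <= tau ^+ 2 * x.
  move=> Fx; apply: le_trans (rnormM n1 _ _) _.
  by rewrite /norm1 (pnormC (normr_rnorm R)) ger0_norm// ler_wpM2l.
have sumC x : 0 <= x -> tau ^+ 2 * (Ca * x) + tau ^+ 2 * (Cb * x) + tau ^+ 2 * (Cc * x) +
    tau ^+ 2 * (Cd * x) + tau ^+ 2 * (Ce * x) <= 2^-1 * x.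
  move=> x0; have -> : tau ^+ 2 * (Ca * x) + tau ^+ 2 * (Cb * x) + tau ^+ 2 * (Cc * x) +
    tau ^+ 2 * (Cd * x) + tau ^+ 2 * (Ce * x) = tau ^+ 2 * C * x by rewrite /C; ring.
  rewrite ler_wpM2r//; apply: le_trans tauC; exact: ler_wpM2r.
split=> [X X1|X Y X1 Y1].
  have [a1 _] := ha _ _ _ t01 X1 X1; have [b1 _] := hb _ _ _ t01 X1 X1.
  have [c1 _] := hc _ _ _ t01 X1 X1; have [d1 _] := hd _ _ _ t01 X1 X1.
  have [e1 _] := he _ _ _ t01 X1 X1.
  have := sumC 1 ler01; rewrite !mulr1 => s1.
  rewrite /normV /hs /hp /q1 /q2 /ell /=; apply: (@le_trans _ _ 2^-1); last by lra.
  apply: le_trans s1; apply: lerD; last exact: tM1.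
  by do 3 (apply: lerD; last exact: tM); exact: tM.
have [_ a1] := ha _ _ _ t01 X1 Y1; have [_ b1] := hb _ _ _ t01 X1 Y1.
have [_ c1] := hc _ _ _ t01 X1 Y1; have [_ d1] := hd _ _ _ t01 X1 Y1.
have [_ e1] := he _ _ _ t01 X1 Y1.
have := sumC _ (normV_ge0 (X - Y)).
set r := normV (X - Y) in a1 b1 c1 d1 e1 *; apply: le_trans.
rewrite /normV /hs /hp /q1 /q2 /ell /=.
apply: lerD; last by rewrite -mulrBr; exact: tM1.
have tMB F G x : norm2 (F - G) <= x ->
  norm2 (bicst (tau ^+ 2) * F - bicst (tau ^+ 2) * G) <= tau ^+ 2 * x.
  by rewrite -mulrBr; exact: tM.
by do 3 (apply: lerD; last exact: tMB); exact: tMB.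
Qed.

End bifurcation_map.

(** * Limits of polynomials *)

Section poly_bounds.
Context (R : realType).
Implicit Types (p : {poly R}) (x y : R).

Lemma horner_derivnMXaddC p c a x :
  (p * 'X + c%:P)^`(a.+1).[x] = a.+1%:R * p^`(a).[x] + p^`(a.+1).[x] * x.
Proof. by rewrite derivnMXaddC hornerD hornerMX hornerMn mulr_natl. Qed.

Lemma horner_norm1 p x : `|x| <= 1 -> `|p.[x]| <= norm1 p.
Proof.
move=> x1; elim/poly_ind: p => [|p c IH].
  by rewrite horner0 normr0 (rnorm_ge0 (norm1_rnorm R)).
rewrite hornerMXaddC norm1MXaddC.
apply: le_trans (ler_normD _ _) _; rewrite lerD2r normrM.
by apply: le_trans IH; rewrite ler_piMr.
Qed.

(** Induction along Horner's scheme: the derivative of order a + 1 of p X + c is (a + 1) p^(a) + x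
    p^(a+1). With |x| <= 1/2 the second term costs half of the constant, and the constant 2 (a + 1)
    C leaves the other half for the first term. *)
Lemma derivn_bound a : exists2 C, 0 <= C &
  forall p x, `|x| <= 2^-1 -> `|p^`(a).[x]| <= C * norm1 p.
Proof.
elim: a => [|a [C C0 IH]].
  exists 1 => // p x xh; rewrite derivn0 mul1r horner_norm1//.
  by apply: le_trans xh _; rewrite invf_le1 ?ler1n.
exists (2 * a.+1%:R * C) => [|p x xh]; first by rewrite !mulr_ge0.
elim/poly_ind: p => [|p c IHp].
  by rewrite (derivnC 0) horner0 normr0 mulr_ge0 ?(rnorm_ge0 (norm1_rnorm R))// !mulr_ge0.
rewrite derivnMXaddC hornerD hornerMX hornerMn norm1MXaddC.
apply: le_trans (ler_normD _ _) _.
rewrite -mulr_natl !normrM normr_nat.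
have h := IH p x xh.
have := normr_ge0 x; have := normr_ge0 (p^`(a.+1)).[x]; have := normr_ge0 c.
set A := a.+1%:R in IHp *; have A0 : 0 <= A by rewrite /A.
set u := `|_.[x]| in h *; set v := `|_.[x]| in IHp *; set w := norm1 p in h IHp *.
move=> c0 v0 x0.
have : A * u <= A * (C * w) by exact: ler_wpM2l.
have : v * `|x| <= 2 * A * C * w * 2^-1 by apply: ler_pM.
have : 0 <= 2 * A * C * `|c| by rewrite !mulr_ge0.
lra.
Qed.

(** The same Horner induction: the remainder of p X + c is y times that of p, up to terms already
    estimated, and |y| <= 1/2 lets the induction close with a constant independent of the degree. *)
Lemma taylor_bound a : exists2 C, 0 <= C &
  forall p x y, `|x| <= 2^-1 -> `|y| <= 2^-1 ->
    `|p^`(a).[y] - p^`(a).[x] - (y - x) * p^`(a.+1).[x]| <= C * (y - x) ^+ 2 * norm1 p.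
Proof.
elim: a => [|a [C C0 IH]].
  have [D D0 hD] := derivn_bound 1.
  exists (2 * D) => [|p x y xh yh]; first by rewrite mulr_ge0.
  rewrite derivn0; elim/poly_ind: p => [|p c IH].
    by rewrite (derivnC 0) !horner0 subrr mulr0 subrr normr0 mulr_ge0
      ?(rnorm_ge0 (norm1_rnorm R))// mulr_ge0 ?sqr_ge0// mulr_ge0.
  rewrite derivnMXaddC derivn0 !hornerMXaddC hornerD hornerMX hornerMn.
  have -> : p.[y] * y + c - (p.[x] * x + c) - (y - x) * (p.[x] *+ 1 + (p^`(1)).[x] * x) =
    y * (p.[y] - p.[x] - (y - x) * (p^`(1)).[x]) + (y - x) ^+ 2 * (p^`(1)).[x].
    by rewrite mulr1n; ring.
  apply: le_trans (ler_normD _ _) _; rewrite 2!normrM (ger0_norm (sqr_ge0 _)).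
  rewrite norm1MXaddC.
  have := hD p x xh; have := normr_ge0 y; have := normr_ge0 c.
  have := sqr_ge0 (y - x); set s := (y - x) ^+ 2 in IH *.
  set e := `|_ - _| in IH *; set d := `|_.[x]|; set w := norm1 p in IH * => s0 c0 y0 dw.
  have : s * d <= s * (D * w) by exact: ler_wpM2l.
  have : `|y| * e <= 2^-1 * (2 * D * s * w) by apply: ler_pM => //; exact: normr_ge0.
  have : 0 <= 2 * D * s * `|c| by do 3 apply: mulr_ge0 => //.
  lra.
have [D D0 hD] := derivn_bound a.+2.
exists (2 * (D + a.+1%:R * C)) => [|p x y xh yh].
  by rewrite mulr_ge0// addr_ge0// mulr_ge0.
elim/poly_ind: p => [|p c IHp].
  by rewrite !(derivnC 0)/= !horner0 subrr mulr0 subrr normr0 mulr_ge0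
    ?(rnorm_ge0 (norm1_rnorm R))// mulr_ge0 ?sqr_ge0// mulr_ge0// addr_ge0// mulr_ge0.
rewrite !horner_derivnMXaddC -(natr1 a.+1).
set A := a.+1%:R in IHp *; have A0 : 0 <= A by rewrite /A.
have -> : A * p^`(a).[y] + p^`(a.+1).[y] * y - (A * p^`(a).[x] + p^`(a.+1).[x] * x) -
    (y - x) * ((A + 1) * p^`(a.+1).[x] + p^`(a.+2).[x] * x) =
  A * (p^`(a).[y] - p^`(a).[x] - (y - x) * p^`(a.+1).[x]) +
  (y * (p^`(a.+1).[y] - p^`(a.+1).[x] - (y - x) * p^`(a.+2).[x]) +
   (y - x) ^+ 2 * p^`(a.+2).[x]) by ring.
apply: le_trans (ler_normD _ _) _; apply: le_trans (lerD (lexx _) (ler_normD _ _)) _.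
rewrite 3!normrM (ger0_norm (sqr_ge0 _)) (ger0_norm A0).
rewrite norm1MXaddC.
have := IH p x y xh yh; have := hD p x xh; have := normr_ge0 y; have := normr_ge0 c.
have := sqr_ge0 (y - x); set s := (y - x) ^+ 2 in IHp *.
set e := `|_ - _|; set e' := `|_ - _| in IHp *.
set d := `|_.[x]|; set w := norm1 p in IHp * => s0 c0 y0 dw ew.
have : s * d <= s * (D * w) by exact: ler_wpM2l.
have : A * e <= A * (C * s * w) by exact: ler_wpM2l.
have : `|y| * e' <= 2^-1 * (2 * (D + A * C) * s * w).
  by apply: ler_pM => //; exact: normr_ge0.
have : 0 <= 2 * (D + A * C) * s * `|c|.
  by do 3 apply: mulr_ge0 => //; rewrite addr_ge0// mulr_ge0.
lra.
Qed.

End poly_bounds.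

Section geometric_cauchy.
Context (R : realType).

(** The rate is the contraction factor of the Picard iteration. An explicit rate is inherited
    through bounded linear maps with only a change of [C]. *)
Definition gcauchy (Z : zmodType) (nr : Z -> R) (u : nat -> Z) :=
  exists2 C, 0 <= C & forall k, nr (u k.+1 - u k) <= C * 2^-1 ^+ k.

Lemma gcauchy_cvg (u : R^nat) : gcauchy (fun x : R => `|x|) u -> cvgn u.
Proof.
move=> [C C0 uC].
have -> : u = (fun n => u 0%N + series (telescope u) n).
  by apply/funext => n; rewrite -eq_sum_telescope.
apply: is_cvgD; first exact: is_cvg_cst.
apply: normed_cvg; apply: (@series_le_cvg _ _ (geometric C 2^-1)).
- by move=> k /=.
- by move=> k /=; rewrite mulr_ge0// exprn_ge0.
- by move=> k; exact: uC.
- by apply: is_cvg_geometric_series; rewrite ger0_norm ?invr_ge0// invf_lt1 ?ltr1n.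
Qed.

Implicit Types (p : nat -> {poly R}).

(** The limit of the derivatives of order a, defined separately for each a; [plim_is_derive] shows
    that consecutive ones are derivatives of each other. *)
Definition plim p (a : nat) (x : R) : R := limn (fun k => (p k)^`(a).[x]).

Lemma plim_cvg p a x : gcauchy (@norm1 R) p -> `|x| <= 2^-1 ->
  (p k)^`(a).[x] @[k --> \oo] --> plim p a x.
Proof.
move=> [C C0 pC] xh; apply: gcauchy_cvg.
have [D D0 hD] := derivn_bound R a.
exists (D * C); first exact: mulr_ge0.
move=> k; rewrite -hornerN -hornerD -derivnB -mulrA.
by apply: le_trans (hD _ _ xh) _; exact: ler_wpM2l.
Qed.

Lemma plim_lim_le p a x K (f : R -> R) : gcauchy (@norm1 R) p -> `|x| <= 2^-1 ->
  continuous f -> (forall k, f (p k)^`(a).[x] <= K) -> f (plim p a x) <= K.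
Proof.
move=> pc xh fc pK; apply: (cvgr_to_le (F := \oo) (f := fun k => f (p k)^`(a).[x])).
  by apply: (cvg_comp _ _ (plim_cvg (a := a) pc xh)); exact: fc.
by near=> k; exact: pK.
Unshelve. all: by end_near. Qed.

Lemma plim_bound a : exists2 C, 0 <= C & forall p K x, gcauchy (@norm1 R) p ->
  (forall k, norm1 (p k) <= K) -> `|x| <= 2^-1 -> `|plim p a x| <= C * K.
Proof.
have [C C0 hC] := derivn_bound R a; exists C => // p K x pc pK xh.
apply: (plim_lim_le pc xh (f := fun y => `|y|)); first exact: norm_continuous.
by move=> k; apply: le_trans (hC _ _ xh) _; exact: ler_wpM2l.
Qed.

(** The quadratic Taylor estimate is a closed condition whose constant depends on the polynomials
    only through an l^1 bound, so it survives the pointwise limit; it is the source of all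
    differentiability in x. *)
Lemma plim_taylor a : exists2 C, 0 <= C & forall p K x y, gcauchy (@norm1 R) p ->
  (forall k, norm1 (p k) <= K) -> `|x| <= 2^-1 -> `|y| <= 2^-1 ->
  `|plim p a y - plim p a x - (y - x) * plim p a.+1 x| <= C * K * (y - x) ^+ 2.
Proof.
have [C C0 hC] := taylor_bound R a; exists C => // p K x y pc pK xh yh.
apply: (cvgr_to_le (F := \oo) (f := fun k => `|(p k)^`(a).[y] - (p k)^`(a).[x] -
    (y - x) * (p k)^`(a.+1).[x]|)).
  apply: cvg_norm; apply: cvgB; first by apply: cvgB; exact: plim_cvg.
  by apply: cvgMr; exact: plim_cvg.
near=> k; apply: le_trans (hC _ _ _ xh yh) _.
by rewrite mulrAC ler_wpM2r ?sqr_ge0// ler_wpM2l.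
Unshelve. all: by end_near. Qed.

Lemma gcauchy_bounded (Z : comNzRingType) (nr : Z -> R) (hnr : is_rnorm nr) (u : nat -> Z) :
  gcauchy nr u -> exists2 K, 0 <= K & forall k, nr (u k) <= K.
Proof.
move=> [C C0 uC].
(* The induction carries the exact partial sum 2 C - 2 C 2^-k of the geometric series. *)
have le k : nr (u k) <= nr (u 0%N) + 2 * C - 2 * C * 2^-1 ^+ k.
  elim: k => [|k IH]; first by rewrite expr0; lra.
  rewrite -[u k.+1](subrK (u k)); apply: le_trans (rnormD hnr _ _) _.
  have := uC k; rewrite exprS; lra.
exists (nr (u 0%N) + 2 * C) => [|k].
  by rewrite addr_ge0 ?(rnorm_ge0 hnr)// mulr_ge0.
by apply: le_trans (le k) _; rewrite gerBl !mulr_ge0// exprn_ge0.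
Qed.

Lemma is_derive_quadratic (f : R -> R) (x d C r : R) : 0 < r ->
  (forall y, `|y - x| <= r -> `|f y - f x - (y - x) * d| <= C * (y - x) ^+ 2) ->
  is_derive x 1 f d.
Proof.
move=> r0 fC.
suff H : h^-1 *: ((f \o shift x) (h *: 1) - f x) @[h --> 0^'] --> d.
  by split; [apply/cvg_ex; exists d|exact: cvg_lim].
have C0 : 0 <= C.
  have := fC (x + r); rewrite addrC addKr gtr0_norm// => /(_ (lexx _)) h.
  by rewrite -(pmulr_lge0 _ (exprn_gt0 2 r0)); exact: le_trans h.
apply/cvgrPdist_le => e e0; near=> h.
have h0 : h != 0 by near: h; exact: nbhs_dnbhs_neq.
have hr : `|h| <= r.
  by near: h; exact: dnbhs0_le.
have he : C * `|h| <= e.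
  have : `|h| <= e / (C + 1).
    by near: h; apply: dnbhs0_le; rewrite divr_gt0// ltr_wpDl.
  rewrite ler_pdivlMr ?ltr_wpDl// => hh.
  by apply: le_trans hh; rewrite mulrC ler_wpM2l// lerDl.
rewrite /= /shift/= [h *: 1]mulr1 -[_ *: _]/(_ * _).
have -> : d - h^-1 * (f (h + x) - f x) = - (h^-1 * (f (h + x) - f x - h * d)).
  by field.
rewrite normrN normrM normfV.
have := fC (h + x); rewrite addrK => /(_ hr) H.
rewrite -(ler_pM2l (x := `|h|)) ?normr_gt0// mulVKf ?normr_eq0//.
apply: le_trans H _; rewrite -real_normK ?num_real// expr2 mulrCA.
by rewrite ler_wpM2l// mulrC.
Unshelve. all: by end_near. Qed.

Lemma plim_is_derive p a (x : R) : gcauchy (@norm1 R) p -> `|x| < 2^-1 ->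
  is_derive x 1 (plim p a) (plim p a.+1 x).
Proof.
move=> pc xh; have [K _ pK] := gcauchy_bounded (norm1_rnorm R) pc.
have [C C0 hC] := plim_taylor a.
apply: (@is_derive_quadratic _ _ _ (C * K) (2^-1 - `|x|)); first by rewrite subr_gt0.
move=> y yx; apply: hC => //; first exact: ltW.
by rewrite -[y](subrK x); apply: le_trans (ler_normD _ _) _; rewrite -lerBrDr.
Qed.

Lemma plim_continuous p a (x : R) : gcauchy (@norm1 R) p -> `|x| < 2^-1 ->
  {for x, continuous (plim p a)}.
Proof.
move=> pc xh; apply: differentiable_continuous; apply/derivable1_diffP.
by have [] := plim_is_derive a pc xh.
Qed.

End geometric_cauchy.

(** * Parity of the iterates *)

Section reflection.
Context (A : comNzRingType).
Implicit Types f : {poly A}.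

(** On profiles this is the Kelvin transform: the inversion takes |x| to 1/|x|, hence xi to -xi. *)
Definition refl f := f \Po (- 'X).

Lemma coef_refl f i : (refl f)`_i = (-1) ^+ i * f`_i.
Proof.
rewrite /refl; elim/poly_ind: f i => [|f c IH] i; first by rewrite comp_poly0 coef0 mulr0.
rewrite comp_poly_MXaddC coefD mulrN coefN coefC coefD coefMX coefMX coefC.
case: i => [|i]/=; first by rewrite oppr0 !add0r expr0 mul1r.
by rewrite !addr0 IH exprS; ring.
Qed.

End reflection.

Section symmetry.
Context (R : realType) (N n : nat).
Hypothesis N3 : (3 <= N)%N.
Variable a : nat -> R.
Hypothesis a_sym : forall j, (j <= n)%N -> (-1) ^+ j * a j = (-1) ^+ n * a j.
Hypothesis an1 : a n = 1.
Local Notation B := {poly {poly R}}.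
Local Notation V := (B * B * B * B * {poly R})%type.
Implicit Types (tau : R) (X : V).
Local Notation resolvent := (@resolvent R N).
Local Notation J := (@refl {poly R}).

Lemma refl_bicst c : J (bicst c) = bicst c. Proof. exact: comp_polyC. Qed.

Lemma refl_theta tau : J (theta tau) = theta tau.
Proof. by rewrite /theta [J _]comp_polyM [_ \Po _]refl_bicst comp_polyC. Qed.

Lemma refl_resolvent k h : J (resolvent k h) = resolvent k (J h).
Proof.
apply/polyP => j; rewrite coef_resolvent !coef_refl coef_resolvent.
by rewrite -scalerAr.
Qed.

Lemma refl_d2 (f : B) : J f^`()^`() = (J f)^`()^`().
Proof.
apply/polyP => j; rewrite !coef_deriv !coef_refl !coef_deriv !exprS.
by rewrite -!mulrnAr; ring.
Qed.

Lemma refl_Phat tau : J (Phat n a tau) = (-1) ^+ n * Phat n a tau.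
Proof.
apply/polyP => j; rewrite coef_refl /Phat -[(-1) ^+ n]/(((-1) : B) ^+ n).
have -> : ((-1) ^+ n : B) = ((-1) ^+ n : {poly R})%:P.
  by rewrite rmorphXn/= polyCN polyC1.
rewrite coefCM coef_poly; case: ltnP => [|_]; last by rewrite !mulr0.
rewrite ltnS => jn; have /(congr1 (fun x => (x * tau ^+ (n - j))%:P)) := a_sym jn.
by rewrite -!mulrA ![(_ ^+ _ * _)%:P]polyCM !polyC_exp !polyCN !polyC1.
Qed.

(* The kernel of D - mu 1, i.e. the dilations, is excluded by parity: the reflection fixes
   sigma, and for odd n it exchanges the two profiles. *)
Definition sym X := [/\ J (hs X) = hs X, J (hp X) = (-1) ^+ n * hp X,
  J (q1 X) = (if odd n then q2 X else q1 X) &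
  J (q2 X) = (if odd n then q1 X else q2 X)].

Lemma reflD (f g : B) : J (f + g) = J f + J g. Proof. exact: comp_polyD. Qed.
Lemma reflB (f g : B) : J (f - g) = J f - J g. Proof. exact: comp_polyB. Qed.
Lemma reflM (f g : B) : J (f * g) = J f * J g. Proof. exact: comp_polyM. Qed.
Lemma reflC (c : {poly R}) : J c%:P = c%:P. Proof. exact: comp_polyC. Qed.

Lemma refl_Rk (th z : B) k : J (Rk th z k) = Rk (J th) (J z) k.
Proof. exact: (Rk_rmorph (comp_poly (- 'X))). Qed.

Lemma refl_Fq tau z q : J (Fq N tau z q) = Fq N tau (J z) (J q).
Proof.
rewrite /Fq !reflM reflC refl_bicst reflB !refl_Rk refl_theta.
by rewrite reflD !reflM !refl_bicst.
Qed.

Lemma resolventN k h : resolvent k (- h) = - resolvent k h.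
Proof. by apply/polyP => j; rewrite coefN !coef_resolvent coefN scalerN. Qed.

Lemma resolvent_sign k m h : resolvent k ((-1) ^+ m * h) = (-1) ^+ m * resolvent k h.
Proof.
rewrite -signr_odd; case: (odd m); rewrite ?expr1 ?expr0 ?mul1r//.
by rewrite !mulN1r resolventN.
Qed.

Lemma sym_yy tau X : sym X -> J (yy N n a tau X) = (-1) ^+ n * yy N n a tau X.
Proof.
move=> [_ hpX _ _]; rewrite /yy reflD reflM refl_bicst refl_Phat /psi.
by rewrite refl_resolvent hpX resolvent_sign mulrDr mulrCA.
Qed.

Lemma sym_z tau X : sym X ->
  J (z1 N n a tau X) = (if odd n then z2 N n a tau X else z1 N n a tau X) /\
  J (z2 N n a tau X) = (if odd n then z1 N n a tau X else z2 N n a tau X).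
Proof.
move=> sX; have [hsX _ _ _] := sX.
rewrite /z1 /z2 reflD reflB reflM refl_bicst /sigma refl_resolvent hsX sym_yy//.
by rewrite -signr_odd; case: (odd n); rewrite ?expr1 ?expr0 ?mul1r// mulN1r opprK.
Qed.

Lemma sym_Qp tau X : sym X -> J (Qp N n tau X) = (-1) ^+ n * Qp N n tau X.
Proof.
move=> [_ hpX Jq1 Jq2]; rewrite /Qp reflD reflM reflM reflB !reflD reflM !refl_bicst reflC.
rewrite refl_d2 /psi refl_resolvent hpX resolvent_sign Jq1 Jq2.
rewrite -signr_odd; case: (odd n); rewrite ?expr1 ?expr0 ?mul1r//.
by rewrite !mulN1r !derivN; ring.
Qed.

Lemma sym_Phi tau X : sym X -> sym (Phi N n a tau X).
Proof.
move=> sX; have [hsX hpX Jq1 Jq2] := sX; have [Jz1 Jz2] := sym_z tau sX.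
rewrite /sym /Phi /hs /hp /q1 /q2 /=; split.
- rewrite reflM refl_bicst /Fs reflD reflM reflD refl_bicst Jq1 Jq2 refl_d2 /sigma.
  rewrite refl_resolvent hsX; congr (_ * (_ + _ * _)).
  by case: (odd n) => //; rewrite addrC.
- rewrite reflM refl_bicst /Fp reflB reflM reflC sym_yy// sym_Qp//.
  by ring.
- by rewrite reflM refl_bicst refl_Fq Jz1 Jq1; case: (odd n).
- by rewrite reflM refl_bicst refl_Fq Jz2 Jq2; case: (odd n).
Qed.

Lemma sym0 : sym 0.
Proof.
by rewrite /sym /hs /hp /q1 /q2 /= /refl !comp_poly0 mulr0; case: (odd n).
Qed.

Definition iterate tau k : V := iter k (Phi N n a tau) 0.

Lemma sym_iterate tau k : sym (iterate tau k).
Proof. by elim: k => [|k IH]; [exact: sym0|exact: sym_Phi]. Qed.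

(** An even polynomial has no x^1 term, so the symmetric equation is solvable at its resonance. *)
Lemma iterate_hs1 tau k : (hs (iterate tau k))`_1 = 0.
Proof.
have [h _ _ _] := sym_iterate tau k.
have : (J (hs (iterate tau k)))`_1 = (hs (iterate tau k))`_1 by rewrite h.
rewrite coef_refl expr1 mulN1r => /eqP; rewrite eq_sym -addr_eq0 -mulr2n => /eqP h2.
apply/polyP => i; have /(congr1 (fun p : {poly R} => p`_i)) := h2.
by rewrite coefMn coef0 => /eqP; rewrite mulrn_eq0/= => /eqP.
Qed.

Lemma coef_yy_n tau X : (yy N n a tau X)`_n = 1.
Proof.
rewrite /yy coefD coefCM coef_resolvent /resolvent_coef eqxx scale0r mulr0 addr0.
by rewrite coef_poly ltnSn subnn expr0 mulr1 an1.
Qed.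

Lemma iterate_hpn tau k : (hp (iterate tau k))`_n = 0.
Proof.
case: k => [|k]; first by rewrite coef0.
by rewrite /hp/= coefCM coefB coefCM coef_yy_n mulr1 subrr mulr0.
Qed.

End symmetry.

(** * The limit profiles *)

Lemma cvgn_unique (R : realType) (u : nat -> R) (l l' : R) :
  u k @[k --> \oo] --> l -> u k @[k --> \oo] --> l' -> l = l'.
Proof. by move=> h h'; rewrite -(cvg_lim (@Rhausdorff R) h) (cvg_lim (@Rhausdorff R) h'). Qed.

Section evaluation.
Context (R : realType).
Implicit Types (t : R) (f g : {poly {poly R}}).

(* Bivariate polynomials are polynomials in x whose coefficients are polynomials in the
   bifurcation parameter t. *)
Definition evt t f : {poly R} := map_poly (horner_eval t) f.

Lemma coef_evt t f i : (evt t f)`_i = (f`_i).[t]. Proof. exact: coef_map. Qed.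
Lemma evtD t f g : evt t (f + g) = evt t f + evt t g. Proof. exact: rmorphD. Qed.
Lemma evtB t f g : evt t (f - g) = evt t f - evt t g. Proof. exact: rmorphB. Qed.
Lemma evtM t f g : evt t (f * g) = evt t f * evt t g. Proof. exact: rmorphM. Qed.
Lemma evt1 t : evt t 1 = 1. Proof. exact: rmorph1. Qed.
Lemma evt0 t : evt t 0 = 0. Proof. exact: rmorph0. Qed.
Lemma evtC t p : evt t p%:P = p.[t]%:P. Proof. exact: map_polyC. Qed.
Lemma evt_bicst t c : evt t (bicst c) = c%:P. Proof. by rewrite evtC hornerC. Qed.
Lemma evt_deriv t f : evt t f^`() = (evt t f)^`().
Proof. by rewrite /evt deriv_map. Qed.
Lemma evt_Rk t th y k : evt t (Rk th y k) = Rk (evt t th) (evt t y) k.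
Proof. exact: (Rk_rmorph (map_poly (horner_eval t))). Qed.

Lemma norm1_evt t f : `|t| <= 1 -> norm1 (evt t f) <= norm2 f.
Proof.
move=> t1; rewrite -[leRHS]mul1r.
apply: (pnorm_coef_le (norm1_rnorm R) (normr_rnorm R)) => // i.
by rewrite coef_evt mul1r horner_norm1.
Qed.

Lemma gcauchy_evt t (u : nat -> {poly {poly R}}) : `|t| <= 1 ->
  gcauchy (@norm2 R) u -> gcauchy (@norm1 R) (fun k => evt t (u k)).
Proof.
move=> t1 [C C0 uC]; exists C => // k; rewrite -evtB.
by apply: le_trans (uC k); exact: norm1_evt.
Qed.

Lemma half_le1 (x : R) : `|x| <= 2^-1 -> `|x| <= 1.
Proof. by move=> h; apply: le_trans h _; rewrite invf_le1 ?ler1n. Qed.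

(* The limit of the a-th derivatives in the outer variable x, at inner variable t. *)
Definition plim2 (u : nat -> {poly {poly R}}) (t : R) a x :=
  plim (fun k => evt t (u k)) a x.

Lemma plim2_cvg u t a x : gcauchy (@norm2 R) u -> `|t| <= 2^-1 -> `|x| <= 2^-1 ->
  (evt t (u k))^`(a).[x] @[k --> \oo] --> plim2 u t a x.
Proof.
by move=> uc th xh; apply: plim_cvg => //; apply: gcauchy_evt => //; exact: half_le1.
Qed.

(** Turns vanishing at t = 0 into smallness of order t; applied to [corr], it makes the remainders
    phi of order epsilon. *)
Lemma evt_lip0 : exists2 C, 0 <= C & forall t f, `|t| <= 2^-1 -> evt 0 f = 0 ->
  norm1 (evt t f) <= C * `|t| * norm2 f.
Proof.
have [C C0 hC] := taylor_bound R 0; have [D D0 hD] := derivn_bound R 1.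
exists (C + D) => [|t f th f0]; first exact: addr_ge0.
apply: (pnorm_coef_le (norm1_rnorm R) (normr_rnorm R)) => [|i].
  by rewrite mulr_ge0// addr_ge0.
rewrite coef_evt; have f00 : (f`_i).[0] = 0 by rewrite -coef_evt f0 coef0.
have h0 : `|0 : R| <= 2^-1 by rewrite normr0 invr_ge0.
have := hC (f`_i) 0 t h0 th; rewrite derivn0 f00 !subr0.
have := hD (f`_i) 0 h0; set d := (f`_i)^`(1).[0]; set w := norm1 f`_i => dw ew.
have -> : (f`_i).[t] = ((f`_i).[t] - t * d) + t * d by rewrite subrK.
apply: le_trans (ler_normD _ _) _; rewrite (mulrDl C) mulrDl; apply: lerD.
  apply: le_trans ew _; rewrite ler_wpM2r ?(rnorm_ge0 (norm1_rnorm R))// ler_wpM2l//.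
  by rewrite -real_normK ?num_real// expr2 ler_piMr// half_le1.
by rewrite normrM (mulrC D) -mulrA ler_wpM2l.
Qed.

(** The diagonal operator D. Being of Euler type it is unchanged by x = tau xi, so that tau enters
    the differential operator only in front of the second derivative. *)
Definition dopl (N : nat) (f : {poly R}) : {poly R} :=
  'X^2 * f^`()^`() + N%:R *: ('X * f^`()).

Lemma coef_dopl N (f : {poly R}) i : (dopl N f)`_i = mu R N i * f`_i.
Proof.
rewrite /dopl coefD coefZ coefXM coefXnM !coef_deriv /mu.
case: i => [|[|i]]/=; rewrite ?mulr0 ?addr0 ?add0r ?mul0r//.
  by rewrite mulr1n; congr (_ * _); ring.
rewrite subn2/= -[f`_i.+2 *+ i.+2]mulr_natr -[_ *+ i.+1]mulr_natr -[i.+2%:R]natr1.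
by ring.
Qed.

Lemma dopl_resolvent N k t (h : {poly {poly R}}) : h`_k = 0 -> (3 <= N)%N ->
  dopl N (evt t (resolvent N k h)) - mu R N k *: evt t (resolvent N k h) = evt t h.
Proof.
move=> hk N3; apply/polyP => j.
rewrite coefB coefZ coef_dopl -mulrBl !coef_evt coef_resolvent hornerZ /resolvent_coef.
case: eqVneq => [->|/(norm_mu_diff R N3)[_ h1]].
  by rewrite hk horner0 !(mul0r,mulr0).
by rewrite mulrA divff ?mul1r// -normr_gt0 (lt_le_trans ltr01).
Qed.

End evaluation.

Section iterate_limits.
Context (R : realType) (N n : nat).
Hypothesis N3 : (3 <= N)%N.
Variable a : nat -> R.
Hypothesis a_sym : forall j, (j <= n)%N -> (-1) ^+ j * a j = (-1) ^+ n * a j.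
Hypothesis an1 : a n = 1.
Hypothesis a_out : forall j, (n < j)%N -> a j = 0.
Hypothesis a_rec : forall j, (j <= n)%N ->
  (mu R N j - mu R N n) * a j = (j.+2 * j.+1)%:R * a j.+2.
Variable tau : R.
Hypothesis tau0 : 0 < tau.
Local Notation It := (iterate N n a tau).
Local Notation kappa := (kappa R N).
Local Notation pexp := (pexp R N).
Local Notation lambda_n := (lambda_n R N n).

Lemma kappa_gt0 : 0 < kappa.
Proof. have h := ge3N R N3; rewrite /kappa divr_gt0// mulr_gt0//; lra. Qed.

Lemma pexp_gt0 : 0 < pexp.
Proof. have h := ge3N R N3; rewrite /pexp divr_gt0//; lra. Qed.

(** As N is [mu 1], this is the resonance of the symmetric linearisation at degree 1. *)
Lemma kappa_pexp : kappa * pexp = kappa + N%:R.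
Proof. by have h := ge3N R N3; rewrite /kappa /pexp; field; rewrite gt_eqF//; lra. Qed.

Lemma kappa_lambda : kappa * lambda_n * pexp = mu R N n + kappa.
Proof.
by rewrite /lambda_n; field; rewrite !gt_eqF ?kappa_gt0 ?pexp_gt0.
Qed.

(** The eigenvalue equation of the Jacobi polynomial in the variable x; on coefficients it is the
    recurrence [a_rec] multiplied by a power of tau. *)
Lemma dopl_Phat t : dopl N (evt t (Phat n a tau)) - tau ^+ 2 *: (evt t (Phat n a tau))^`()^`() =
  mu R N n *: evt t (Phat n a tau).
Proof.
have cP j : (evt t (Phat n a tau))`_j = a j * tau ^+ (n - j).
  rewrite coef_evt coef_poly; case: ltnP; first by rewrite hornerC.
  by move=> nj; rewrite horner0 a_out ?mul0r.
apply/polyP => j; rewrite coefB !coefZ coef_dopl !coef_deriv !cP.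
have [jn|nj] := leqP j n; last first.
  by rewrite (a_out nj) (a_out (leqW (leqW nj))) !(mul0r,mulr0,mul0rn,subr0).
(* In degrees n - 1 and n the exponent n - (j + 2) is truncated to 0, but there the coefficient
   [a j.+2] vanishes. *)
have [jn2|jn2] := leqP j.+2 n; last first.
  have := a_rec jn; rewrite (a_out jn2) mulr0 mul0r !mul0rn mulr0 subr0.
  by move=> h; apply/eqP; rewrite -subr_eq0 -mulrBl mulrA h mul0r.
have := a_rec jn; rewrite natrM -[a _ * _ *+ j.+2]mulr_natr -[_ * _ *+ j.+1]mulr_natr => h.
have -> : (n - j = (n - j.+2) + 2)%N by rewrite addn2 -subSn// -subSn ?(leqW jn2)// !subSS.
rewrite exprD; apply/eqP; rewrite -subr_eq0.
have -> : mu R N j * (a j * (tau ^+ (n - j.+2) * tau ^+ 2)) -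
  tau ^+ 2 * (a j.+2 * tau ^+ (n - j.+2) * j.+2%:R * j.+1%:R) -
  mu R N n * (a j * (tau ^+ (n - j.+2) * tau ^+ 2)) =
  tau ^+ 2 * tau ^+ (n - j.+2) *
    ((mu R N j - mu R N n) * a j - j.+2%:R * j.+1%:R * a j.+2) by ring.
by rewrite h subrr mulr0.
Qed.

Hypothesis Phi_ball : forall X, normV X <= 1 -> normV (Phi N n a tau X) <= 1.
Hypothesis Phi_half : forall X Y, normV X <= 1 -> normV Y <= 1 ->
  normV (Phi N n a tau X - Phi N n a tau Y) <= 2^-1 * normV (X - Y).

Lemma iterate_ball k : normV (It k) <= 1.
Proof. exact: (picard_ball (normV0 R) Phi_ball). Qed.

Lemma iterate_cauchy k : normV (It k.+1 - It k) <= 2^-1 ^+ k.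
Proof. exact: (picard_cauchy (normV0 R) Phi_ball Phi_half). Qed.

Lemma gcauchy_tame (F : R -> _ -> {poly {poly R}}) :
  0 <= tau <= 1 -> tame (@normV R) (@norm2 R) F -> gcauchy (@norm2 R) (fun k => F tau (It k)).
Proof.
move=> t01 [C C0 hC]; exists C => // k.
have [_ h] := hC _ _ _ t01 (iterate_ball k.+1) (iterate_ball k).
by apply: le_trans h _; rewrite ler_wpM2l// iterate_cauchy.
Qed.

Lemma gcauchy_ell : gcauchy (@norm1 R) (fun k => ell (It k)).
Proof.
exists 1 => // k; rewrite mul1r; apply: le_trans (iterate_cauchy k).
by have [_ _ _ _] := norm_comp_le (It k.+1 - It k).
Qed.

(** In the limit, 1 + theta [ww] is the [pexp]-th power of 1 + theta z; for the iterates it is only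
    an approximation. *)
Definition ww (z q : {poly {poly R}}) : {poly {poly R}} :=
  bicst pexp * z + bicst (tau ^+ 4) * q.

Lemma evt_deriv2 t (f : {poly {poly R}}) : evt t f^`()^`() = (evt t f)^`()^`().
Proof. by rewrite !evt_deriv. Qed.

Lemma evt_sigma k t : let S j := evt t (sigma N (It j)) in
  dopl N (S k.+1) = N%:R *: S k.+1 +
    (tau ^+ 2)%:P * ((S k)^`()^`() + (kappa / 2)%:P * (evt t (q1 (It k)) + evt t (q2 (It k)))).
Proof.
move=> S; have := dopl_resolvent t (iterate_hs1 N a_sym tau k.+1) N3.
have -> : mu R N 1 = N%:R by rewrite /mu; ring.
move/eqP; rewrite subr_eq addrC => /eqP ->; congr (_ + _).
by rewrite /hs/= evtM evt_bicst /Fs evtD evt_deriv2 evtM evt_bicst evtD.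
Qed.

(** The multiple of [yy] subtracted in [Fp] reappears as the eigenvalue correction: [Fl] is scaled
    so that kappa pexp [ell], taken at step k + 1, is its coefficient. *)
Lemma evt_psi k t : let P j := evt t (psi N n (It j)) in
  dopl N (P k.+1) = mu R N n *: P k.+1 +
    (tau ^+ 2)%:P * ((P k)^`()^`() +
      (kappa / 2 * (lambda_n + tau ^+ 2 * (ell (It k)).[t]))%:P *
        (evt t (q1 (It k)) - evt t (q2 (It k)))) +
    (kappa * pexp * (ell (It k.+1)).[t])%:P * evt t (yy N n a tau (It k)).
Proof.
move=> P; have := dopl_resolvent t (iterate_hpn N an1 tau k.+1) N3.
move/eqP; rewrite subr_eq addrC => /eqP ->; rewrite -addrA; congr (_ + _).
rewrite /hp/= evtM evt_bicst /Fp evtB evtM evtC.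
have -> : (ell (It k.+1)).[t] = - (tau ^+ 2 * (kappa * pexp)^-1 * ((Qp N n tau (It k))`_n).[t]).
  by rewrite /ell/= /Fl hornerM hornerC hornerN hornerM hornerC mulrN mulrA.
rewrite {1}/Qp evtD evt_deriv2 !evtM evtB evtD !evtM !evtC !hornerC -!polyCM -!polyCD -polyCM.
have kp : kappa * pexp != 0 by rewrite gt_eqF// mulr_gt0// ?kappa_gt0 ?pexp_gt0.
have -> : kappa * pexp * - (tau ^+ 2 * (kappa * pexp)^-1 * ((Qp N n tau (It k))`_n).[t]) =
  - (tau ^+ 2 * ((Qp N n tau (It k))`_n).[t]) by field; rewrite !gt_eqF ?kappa_gt0 ?pexp_gt0.
by rewrite -/(P k) polyCN [X in - X * _]polyCM; ring.
Qed.

Lemma evt_Fq k t : let th := (tau ^+ 6 * t)%:P : {poly R} in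
  let Z i := evt t ((if i then z1 N n a tau else z2 N n a tau) (It k)) in
  let Q i j := evt t ((if i then @q1 R else @q2 R) (It j)) in
  let w i := evt t (ww ((if i then z1 N n a tau else z2 N n a tau) (It k))
    ((if i then @q1 R else @q2 R) (It k))) in
  forall i, (N%:R - 2) *: ((tau ^+ 4) *: Q i k.+1) =
    th * (Rk th (Z i) (N + 2) - Rk th (w i) (N - 2)).
Proof.
move=> th Z Q w i.
have E z q : evt t (Fq N tau z q) = (t * (N%:R - 2)^-1)%:P *
    (Rk th (evt t z) (N + 2) - Rk th (evt t (ww z q)) (N - 2)).
  rewrite /Fq !evtM evtB !evt_Rk evtC evt_bicst hornerX -polyCM.
  by rewrite /theta evtM evt_bicst evtC hornerX -polyCM.
have {}E : Q i k.+1 = (tau ^+ 2 * (t * (N%:R - 2)^-1))%:P *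
    (Rk th (Z i) (N + 2) - Rk th (w i) (N - 2)).
  rewrite /Q /Z /w polyCM -mulrA; case: (i); rewrite -E.
    by rewrite /q1/= evtM evt_bicst.
  by rewrite /q2/= evtM evt_bicst.
rewrite E scalerA scalerAl -mul_polyC -polyCM; congr (_%:P * _).
by have h := ge3N R N3; field; rewrite gt_eqF//; lra.
Qed.


(** The sign e = 1 or -1 selects [z1] or [z2], so that one computation serves both equations. *)
Definition zz e X := bicst (tau ^+ 2) * sigma N X + bicst e * yy N n a tau X.

Lemma z1_zz X : z1 N n a tau X = zz 1 X.
Proof. by rewrite /z1 /zz /bicst !polyC1 mul1r. Qed.

Lemma z2_zz X : z2 N n a tau X = zz (-1) X.
Proof. by rewrite /z2 /zz /bicst !polyCN !polyC1 mulN1r. Qed.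

Lemma horner_dopl (f : {poly R}) x : (dopl N f).[x] = x ^+ 2 * f^`()^`().[x] + N%:R * (x * f^`().[x]).
Proof. by rewrite /dopl hornerD hornerZ !hornerM !hornerX expr2. Qed.

Lemma evt_zz e k t : evt t (zz e (It k)) = tau ^+ 2 *: evt t (sigma N (It k)) +
  e *: (evt t (Phat n a tau) + tau ^+ 2 *: evt t (psi N n (It k))).
Proof. by rewrite /zz /yy !(evtD, evtM, evt_bicst) !mul_polyC. Qed.

(** Not yet the differential equation: quantities of steps k and k + 1 are mixed as in the
    iteration. They are identified by the limit in [ode_limit]. *)
Lemma step_zz e k t x :
  let z j := evt t (zz e (It j)) in let y j := (evt t (yy N n a tau (It j))).[x] in
  let q j := (evt t (q1 (It k))).[x] in let r j := (evt t (q2 (It k))).[x] in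
  x ^+ 2 * (z k.+1)^`(2).[x] + N%:R * (x * (z k.+1)^`(1).[x]) =
  tau ^+ 2 * (z k)^`(2).[x] + N%:R * tau ^+ 2 * (evt t (sigma N (It k.+1))).[x] +
  e * mu R N n * y k.+1 + tau ^+ 4 * (kappa / 2) * (q k + r k) +
  e * tau ^+ 4 * (kappa / 2) * (lambda_n + tau ^+ 2 * (ell (It k)).[t]) * (q k - r k) +
  e * tau ^+ 2 * (kappa * pexp) * (ell (It k.+1)).[t] * y k.
Proof.
move=> z y q r; rewrite /derivn/= /z !evt_zz !derivD !derivZ !derivD !derivZ.
have eS : x ^+ 2 * (evt t (sigma N (It k.+1)))^`()^`().[x] +
    N%:R * (x * (evt t (sigma N (It k.+1)))^`().[x]) =
    N%:R * (evt t (sigma N (It k.+1))).[x] + tau ^+ 2 *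
      ((evt t (sigma N (It k)))^`()^`().[x] + kappa / 2 * (q k + r k)).
  by rewrite -horner_dopl evt_sigma /= hornerD hornerZ hornerM hornerD hornerM hornerD !hornerC.
have eP : x ^+ 2 * (evt t (psi N n (It k.+1)))^`()^`().[x] +
    N%:R * (x * (evt t (psi N n (It k.+1)))^`().[x]) =
    mu R N n * (evt t (psi N n (It k.+1))).[x] + tau ^+ 2 *
      ((evt t (psi N n (It k)))^`()^`().[x] +
        kappa / 2 * (lambda_n + tau ^+ 2 * (ell (It k)).[t]) * (q k - r k)) +
    kappa * pexp * (ell (It k.+1)).[t] * y k.
  rewrite -horner_dopl evt_psi /= hornerD hornerD hornerZ !(hornerM (_%:P)) !hornerC.
  by rewrite hornerD !(hornerM (_%:P)) !hornerC hornerD hornerN.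
have eh : x ^+ 2 * (evt t (Phat n a tau))^`()^`().[x] +
    N%:R * (x * (evt t (Phat n a tau))^`().[x]) =
    tau ^+ 2 * (evt t (Phat n a tau))^`()^`().[x] + mu R N n * (evt t (Phat n a tau)).[x].
  rewrite -horner_dopl -!hornerZ -hornerD -dopl_Phat addrC subrK.
  by [].
have yE j : y j = (evt t (Phat n a tau)).[x] + tau ^+ 2 * (evt t (psi N n (It j))).[x].
  by rewrite /y /yy evtD evtM evt_bicst hornerD hornerM hornerC.
rewrite !hornerD !hornerZ !hornerD !hornerZ !yE.
have H (a1 a2 b1 b2 c1 c2 : R) :
  x ^+ 2 * (tau ^+ 2 * a2 + e * (b2 + tau ^+ 2 * c2)) +
  N%:R * (x * (tau ^+ 2 * a1 + e * (b1 + tau ^+ 2 * c1))) =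
  tau ^+ 2 * (x ^+ 2 * a2 + N%:R * (x * a1)) +
  e * ((x ^+ 2 * b2 + N%:R * (x * b1)) +
  tau ^+ 2 * (x ^+ 2 * c2 + N%:R * (x * c1))) by ring.
by rewrite H eS eP eh yE; ring.
Qed.

Hypothesis tau_half : tau <= 2^-1.

Let t01 : 0 <= tau <= 1.
Proof. by rewrite ltW//= (le_trans tau_half)// invf_le1 ?ler1n. Qed.

Let n2 := norm2_rnorm R.

Lemma tame_zz e : tame (@normV R) (@norm2 R) (fun tau X =>
  bicst (tau ^+ 2) * sigma N X + bicst e * yy N n a tau X).
Proof.
apply: (tameD n2); first exact: (tame_tsigma R N3).
by apply: (tameM n2); [exact: tame_real|exact: (tame_yy n N3 a)].
Qed.

Lemma gcauchy_zz e : gcauchy (@norm2 R) (fun k => zz e (It k)).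
Proof. exact: (gcauchy_tame t01 (tame_zz e)). Qed.

Lemma gcauchy_sigma : gcauchy (@norm2 R) (fun k => sigma N (It k)).
Proof. exact: (gcauchy_tame t01 (tame_resolvent N3 1 (tame_hs R))). Qed.

Lemma gcauchy_yy : gcauchy (@norm2 R) (fun k => yy N n a tau (It k)).
Proof. exact: (gcauchy_tame t01 (tame_yy n N3 a)). Qed.

Lemma gcauchy_q1 : gcauchy (@norm2 R) (fun k => q1 (It k)).
Proof. exact: (gcauchy_tame t01 (tame_q1 R)). Qed.

Lemma gcauchy_q2 : gcauchy (@norm2 R) (fun k => q2 (It k)).
Proof. exact: (gcauchy_tame t01 (tame_q2 R)). Qed.

Section at_point.
Variables t x : R.
Hypotheses (th_half : `|t| <= 2^-1) (xh : `|x| <= 2^-1).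

Let s := plim2 (fun k => sigma N (It k)) t 0 x.
Let y := plim2 (fun k => yy N n a tau (It k)) t 0 x.
Let q := plim2 (fun k => q1 (It k)) t 0 x.
Let r := plim2 (fun k => q2 (It k)) t 0 x.
Let l := plim (fun k => ell (It k)) 0 t.
Let z e i := plim2 (fun k => zz e (It k)) t i x.

Lemma zz_limE e : z e 0 = tau ^+ 2 * s + e * y.
Proof.
apply: cvgn_unique (plim2_cvg (a := 0%N) (gcauchy_zz e) th_half xh) _.
have -> : (fun k => (evt t (zz e (It k)))^`(0).[x]) = (fun k =>
  tau ^+ 2 * (evt t (sigma N (It k)))^`(0).[x] + e * (evt t (yy N n a tau (It k)))^`(0).[x]).
  by apply/funext => k; rewrite /zz evtD !evtM !evt_bicst hornerD !hornerM !hornerC.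
apply: cvgD; apply: cvgMr; apply: plim2_cvg => //; [exact: gcauchy_sigma|exact: gcauchy_yy].
Qed.

Lemma ode_limit e : x ^+ 2 * z e 2 + N%:R * (x * z e 1) =
  tau ^+ 2 * z e 2 + N%:R * tau ^+ 2 * s + e * mu R N n * y +
  tau ^+ 4 * (kappa / 2) * (q + r) +
  e * tau ^+ 4 * (kappa / 2) * (lambda_n + tau ^+ 2 * l) * (q - r) +
  e * tau ^+ 2 * (kappa * pexp) * l * y.
Proof.
have cz i := plim2_cvg (a := i) (gcauchy_zz e) th_half xh.
have cs := plim2_cvg (a := 0%N) gcauchy_sigma th_half xh.
have cy := plim2_cvg (a := 0%N) gcauchy_yy th_half xh.
have cq := plim2_cvg (a := 0%N) gcauchy_q1 th_half xh.
have cr := plim2_cvg (a := 0%N) gcauchy_q2 th_half xh.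
have cl := plim_cvg (a := 0%N) gcauchy_ell th_half.
have cS (u : nat -> R) (c : R) : u k @[k --> \oo] --> c -> u k.+1 @[k --> \oo] --> c.
  by move=> uc; rewrite (cvg_shiftS u).
apply: (@cvgn_unique _ (fun k => x ^+ 2 * (evt t (zz e (It k.+1)))^`(2).[x] +
   N%:R * (x * (evt t (zz e (It k.+1)))^`(1).[x]))).
  apply: cvgD; apply: cvgMr; last apply: cvgMr.
      by apply: (cS (fun k => (evt t (zz e (It k)))^`(2).[x])); exact: cz.
    by apply: (cS (fun k => (evt t (zz e (It k)))^`(1).[x])); exact: cz.
under eq_fun do rewrite step_zz.
apply: cvgD; last first.
  by apply: cvgM; last exact: cy; apply: cvgMr; apply: (cS (fun k => (ell (It k)).[t])); exact: cl.
apply: cvgD; last first.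
  apply: cvgM; last exact: cvgB.
  by apply: cvgMr; apply: cvgD; [exact: cvg_cst|apply: cvgMr].
apply: cvgD; last by apply: cvgMr; exact: cvgD.
apply: cvgD; last by apply: cvgMr; apply: (cS (fun k => (evt t (yy N n a tau (It k))).[x])); exact: cy.
apply: cvgD; first by apply: cvgMr; exact: cz.
by apply: cvgMr; apply: (cS (fun k => (evt t (sigma N (It k))).[x])); exact: cs.
Qed.

Lemma Rk_cvg (th0 : R) (u : nat -> R) (c : R) m : u k @[k --> \oo] --> c ->
  Rk th0 (u k) m @[k --> \oo] --> Rk th0 c m.
Proof.
move=> uc; elim: m => [|m IH]/=; first exact: cvg_cst.
apply: cvgD; first by apply: cvgM => //; apply: cvgD; [exact: cvg_cst|exact: cvgMr].
by apply: cvgMn; exact: cvgM.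
Qed.

Let th := tau ^+ 6 * t.

(** Both sides are expanded by [RkE]. As (N - 2) pexp = N + 2, the terms linear in z agree; what
    remains is (N - 2) tau^4 q against the difference of the two remainders, and this is the limit
    of the fixed point equation for q. *)
Lemma power_limit (b : bool) :
  (1 + th * (pexp * z ((-1) ^+ b) 0 + tau ^+ 4 * (if b then r else q))) ^+ (N - 2) =
  (1 + th * z ((-1) ^+ b) 0) ^+ (N + 2).
Proof.
set e : R := (-1) ^+ b; set qq := if b then r else q.
have cz := plim2_cvg (a := 0%N) (gcauchy_zz e) th_half xh.
pose u k := (evt t ((if b then @q2 R else @q1 R) (It k))).[x].
have cq : u k @[k --> \oo] --> qq.
  rewrite /u /qq; case: (b); first exact: (plim2_cvg (a := 0%N) gcauchy_q2).
  exact: (plim2_cvg (a := 0%N) gcauchy_q1).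
have E : (N%:R - 2) * (tau ^+ 4 * qq) =
    th * (Rk th (z e 0) (N + 2) - Rk th (pexp * z e 0 + tau ^+ 4 * qq) (N - 2)).
  apply: (@cvgn_unique _ (fun k => (N%:R - 2) * (tau ^+ 4 * u k.+1))).
    by do 2 apply: cvgMr; rewrite (cvg_shiftS u).
  have -> : (fun k => (N%:R - 2) * (tau ^+ 4 * u k.+1)) = fun k =>
      th * (Rk th (evt t (zz e (It k))).[x] (N + 2) -
            Rk th (pexp * (evt t (zz e (It k))).[x] + tau ^+ 4 * u k) (N - 2)).
    apply/funext => k.
    have := congr1 (fun p : {poly R} => p.[x]) (evt_Fq k t (~~ b)).
    rewrite /= !hornerZ hornerM hornerC hornerD hornerN => E.
    have hR (y0 : {poly R}) m : (Rk (th%:P) y0 m).[x] = Rk th y0.[x] m.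
      by have := Rk_rmorph (horner_eval x) th%:P y0 m; rewrite /= /horner_eval hornerC.
    have hw y0 q0 : (evt t (ww y0 q0)).[x] = pexp * (evt t y0).[x] + tau ^+ 4 * (evt t q0).[x].
      by rewrite /ww !(evtD, evtM, evt_bicst) hornerD !hornerM !hornerC.
    move: E; rewrite !hR hw.
    by rewrite /u /e; case: (b) => /=; rewrite ?z1_zz ?z2_zz ?expr0 ?expr1; exact.
  apply: cvgMr; apply: cvgB; apply: Rk_cvg; first exact: cz.
  by apply: cvgD; apply: cvgMr; [exact: cz|exact: cq].
rewrite !RkE -[_ *+ (N + 2)]mulr_natl -[_ *+ (N - 2)]mulr_natl natrD natrB ?(ltnW N3)//.
have N2 : N%:R - 2 != 0 :> R by have h := ge3N R N3; rewrite gt_eqF//; lra.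
have pN : (N%:R - 2) * pexp = N%:R + 2 by rewrite /pexp; field.
move: E pN; set Q := tau ^+ 4 * qq; set Z := z e 0; set A := Rk _ _ _; set A' := Rk _ _ _.
move=> E pN; have -> : 1 + (N%:R - 2) * (th * (pexp * Z + Q)) + th ^+ 2 * A' =
  1 + th * ((N%:R - 2) * pexp * Z) + th * ((N%:R - 2) * Q) + th ^+ 2 * A' by ring.
by rewrite E pN; ring.
Qed.

End at_point.

Lemma evt0_resolvent k (h : {poly {poly R}}) : evt 0 h = 0 -> evt 0 (resolvent N k h) = 0.
Proof.
move=> h0; apply/polyP => j; rewrite coef_evt coef_resolvent hornerZ -coef_evt h0.
by rewrite coef0 mulr0.
Qed.

(** At t = 0 the factor t of [Fq] removes the nonlinearity, and the remaining iteration, started at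
    0, stays at 0. *)
Lemma iterate_t0 k : [/\ evt 0 (hs (It k)) = 0, evt 0 (hp (It k)) = 0,
  evt 0 (q1 (It k)) = 0, evt 0 (q2 (It k)) = 0 & (ell (It k)).[0] = 0].
Proof.
elim: k => [|k [hs0 hp0 q10 q20 l0]].
  by rewrite /hs /hp /q1 /q2 /ell/= !evt0 horner0.
have Q0 : evt 0 (Qp N n tau (It k)) = 0.
  rewrite /Qp evtD evt_deriv2 /psi evt0_resolvent// evtM evtB q10 q20 subrr mulr0.
  by rewrite !deriv0 addr0.
have Qn0 : ((Qp N n tau (It k))`_n).[0] = 0 by rewrite -coef_evt Q0 coef0.
have F0 z q : evt 0 (Fq N tau z q) = 0.
  by rewrite /Fq !evtM evtC hornerX polyC0 !mul0r.
rewrite /hs /hp /q1 /q2 /ell/= !(evtM 0 (bicst (tau ^+ 2))) !F0 !mulr0; split => //.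
- rewrite /Fs evtD evt_deriv2 /sigma evt0_resolvent// evtM evtD q10 q20 addr0 mulr0.
  by rewrite !deriv0 addr0 mulr0.
- by rewrite /Fp evtB evtM evtC Q0 Qn0 polyC0 mul0r subr0 mulr0.
- by rewrite /Fl hornerM hornerN hornerM Qn0 mulr0 oppr0 mulr0.
Qed.

(** What the profile contains beyond the Jacobi term; its lift becomes the remainder phi. *)
Definition corr (b : bool) k : {poly {poly R}} :=
  bicst (tau ^+ 2) * sigma N (It k) + bicst ((-1) ^+ b) * (bicst (tau ^+ 2) * psi N n (It k)).

Definition profile (b : bool) k : {poly {poly R}} :=
  1 + theta tau * (bicst ((-1) ^+ b) * Phat n a tau + corr b k).

(** Solves 2 alpha - 1 = [lambda_n] + tau^2 [ell] for alpha. *)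
Definition alphas k : {poly R} := ((1 + lambda_n) / 2)%:P + (tau ^+ 2 / 2) *: ell (It k).

Lemma profileE b k : profile b k = 1 + theta tau * zz ((-1) ^+ b) (It k).
Proof.
rewrite /profile /corr /zz /yy; congr (_ + _ * _).
by ring.
Qed.

Lemma gcauchy_corr b : gcauchy (@norm2 R) (corr b).
Proof.
apply: (gcauchy_tame t01 (F := fun tau X => bicst (tau ^+ 2) * sigma N X +
  bicst ((-1) ^+ b) * (bicst (tau ^+ 2) * psi N n X))).
apply: (tameD n2); first exact: (tame_tsigma R N3).
apply: (tameM n2); first exact: tame_real.
apply: (tameM n2); first exact: tame_tauX.
by apply: (tame_resolvent N3); exact: tame_hp.
Qed.

Lemma gcauchy_profile b : gcauchy (@norm2 R) (profile b).
Proof.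
have -> : profile b = fun k => 1 + theta tau * zz ((-1) ^+ b) (It k).
  by apply/funext => k; rewrite profileE.
apply: (gcauchy_tame t01 (F := fun tau X => 1 + theta tau *
  (bicst (tau ^+ 2) * sigma N X + bicst ((-1) ^+ b) * yy N n a tau X))).
apply: (tameD n2); first exact: (tame_real 1).
by apply: (tameM n2); [exact: tame_theta|exact: tame_zz].
Qed.

Lemma gcauchy_alphas : gcauchy (@norm1 R) alphas.
Proof.
have [C C0 hC] := gcauchy_ell; exists (`|tau ^+ 2 / 2| * C); first exact: mulr_ge0.
move=> k; rewrite /alphas opprD addrACA subrr add0r -scalerBr.
by apply: le_trans (norm1Z _ _) _; rewrite -[leRHS]mulrA; apply: ler_wpM2l.
Qed.

Lemma evt0_corr b k : evt 0 (corr b k) = 0.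
Proof.
have [hs0 hp0 _ _ _] := iterate_t0 k.
by rewrite /corr evtD !evtM /sigma /psi !evt0_resolvent// !mulr0 addr0.
Qed.

Lemma alphas0 k : (alphas k).[0] = (1 + lambda_n) / 2.
Proof.
have [_ _ _ _ l0] := iterate_t0 k.
by rewrite /alphas hornerD hornerC hornerZ l0 mulr0 addr0.
Qed.

Lemma profile_limE b t x i : `|t| <= 2^-1 -> `|x| <= 2^-1 ->
  plim2 (profile b) t i x = (i == 0%N)%:R +
    tau ^+ 6 * t * plim2 (fun k => zz ((-1) ^+ b) (It k)) t i x.
Proof.
move=> th xh; apply: cvgn_unique (plim2_cvg (gcauchy_profile b) th xh) _.
have -> : (fun k => (evt t (profile b k))^`(i).[x]) = fun k => (i == 0%N)%:R +
    tau ^+ 6 * t * (evt t (zz ((-1) ^+ b) (It k)))^`(i).[x].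
  apply/funext => k; rewrite profileE evtD evtM evt1 /theta evtM evt_bicst evtC hornerX.
  rewrite -polyCM mul_polyC derivnD derivnZ hornerD hornerZ -polyC1 derivnC.
  by case: eqP => _; rewrite ?hornerC// horner0.
by apply: cvgD; [exact: cvg_cst|apply: cvgMr; exact: plim2_cvg (gcauchy_zz _) th xh].
Qed.

Lemma alphas_limE t : `|t| <= 2^-1 ->
  plim alphas 0 t = (1 + lambda_n) / 2 + tau ^+ 2 / 2 * plim (fun k => ell (It k)) 0 t.
Proof.
move=> th; apply: cvgn_unique (plim_cvg (a := 0%N) gcauchy_alphas th) _.
under eq_fun do rewrite derivn0 /alphas hornerD hornerC hornerZ.
by apply: cvgD; [exact: cvg_cst|apply: cvgMr; exact: (plim_cvg (a := 0%N) gcauchy_ell th)].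
Qed.

Lemma norm2_tame F : tame (@normV R) (@norm2 R) F ->
  exists K, forall k, norm2 (F tau (It k)) <= K.
Proof.
move=> [C C0 hC]; exists C => k.
by have [] := hC _ _ _ t01 (iterate_ball k) (iterate_ball k).
Qed.

Lemma plim2_bounded (u : nat -> {poly {poly R}}) : gcauchy (@norm2 R) u ->
  (exists K, forall k, norm2 (u k) <= K) ->
  exists2 K, 0 <= K & forall t x, `|t| <= 2^-1 -> `|x| <= 2^-1 -> `|plim2 u t 0 x| <= K.
Proof.
move=> uc [K uK]; have [C C0 hC] := plim_bound R 0.
have K0 : 0 <= K by apply: le_trans (uK 0%N); exact: (rnorm_ge0 n2).
exists (C * K); first exact: mulr_ge0.
move=> t x th xh; have t1 := half_le1 th; apply: hC => // [|k]; first exact: gcauchy_evt.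
by apply: le_trans (uK k); exact: norm1_evt.
Qed.

(** The function [f] stands for the [pexp]-th power and is tied to the profile by integer powers
    only. The bounds by K |t| keep both positive for small t, and positivity later identifies [f]
    with the real power. *)
Lemma profile_solution : exists (f : bool -> R -> R -> R) (K : R), 0 <= K /\
  forall t x, `|t| <= 2^-1 -> `|x| <= 2^-1 -> forall b,
  [/\ `|plim2 (profile b) t 0 x - 1| <= K * `|t|, `|f b t x - 1| <= K * `|t|,
      (f b t x) ^+ (N - 2) = (plim2 (profile b) t 0 x) ^+ (N + 2) &
      (x ^+ 2 - tau ^+ 2) * plim2 (profile b) t 2 x + N%:R * x * plim2 (profile b) t 1 x +
        kappa * plim2 (profile b) t 0 x =
      kappa * (plim alphas 0 t * f b t x + (1 - plim alphas 0 t) * f (~~ b) t x)].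
Proof.
pose z (b : bool) t x := plim2 (fun k => zz ((-1) ^+ b) (It k)) t 0 x.
pose q b t x := plim2 (fun k => (if b then @q2 R else @q1 R) (It k)) t 0 x.
pose w b t x := pexp * z b t x + tau ^+ 4 * q b t x.
have [K1 K10 hK1] : exists2 K, 0 <= K & forall b t x, `|t| <= 2^-1 -> `|x| <= 2^-1 ->
    `|z b t x| <= K.
  have [K K0 hK] := plim2_bounded (gcauchy_zz ((-1) ^+ true)) (norm2_tame (tame_zz _)).
  have [L L0 hL] := plim2_bounded (gcauchy_zz ((-1) ^+ false)) (norm2_tame (tame_zz _)).
  exists (K + L) => [|[] t x th xh]; first exact: addr_ge0.
    by apply: le_trans (hK t x th xh) _; rewrite lerDl.
  by apply: le_trans (hL t x th xh) _; rewrite lerDr.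
have [K2 K20 hK2] : exists2 K, 0 <= K & forall b t x, `|t| <= 2^-1 -> `|x| <= 2^-1 ->
    `|q b t x| <= K.
  have [K K0 hK] := plim2_bounded gcauchy_q2 (norm2_tame (tame_q2 R)).
  have [L L0 hL] := plim2_bounded gcauchy_q1 (norm2_tame (tame_q1 R)).
  exists (K + L) => [|[] t x th xh]; first exact: addr_ge0.
    by apply: le_trans (hK t x th xh) _; rewrite lerDl.
  by apply: le_trans (hL t x th xh) _; rewrite lerDr.
exists (fun b t x => 1 + tau ^+ 6 * t * w b t x), (K1 + (pexp * K1 + K2)).
have p0 := ltW pexp_gt0.
split; first by rewrite !addr_ge0// mulr_ge0.
move=> t x th xh b.
have tk k : `|tau ^+ k| <= 1 by exact: norm_expr01.
have tth y L : `|y| <= L -> `|1 + tau ^+ 6 * t * y - 1| <= L * `|t|.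
  move=> yL; rewrite addrC addKr [`|_ * y|]normrM [`|tau ^+ 6 * t|]normrM (mulrC L); apply: ler_pM => //.
  by rewrite ler_piMl ?tk.
have wK : `|w b t x| <= pexp * K1 + K2.
  rewrite /w; apply: le_trans (ler_normD _ _) _; rewrite [`|pexp * _|]normrM (ger0_norm p0) [`|tau ^+ 4 * _|]normrM.
  apply: lerD; first by rewrite ler_wpM2l// hK1.
  by apply: le_trans (hK2 b t x th xh); rewrite ler_piMl.
rewrite !profile_limE// !add0r alphas_limE//.
split.
- by apply: tth; apply: le_trans (hK1 b t x th xh) _; rewrite lerDl addr_ge0// mulr_ge0.
- by apply: tth; apply: le_trans wK _; rewrite lerDr.
- have := power_limit th xh b; rewrite /w /z /q.
  by case: (b) => ->.
have hode := ode_limit th xh ((-1) ^+ b).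
have hz b' : z b' t x = _ := zz_limE th xh ((-1) ^+ b').
have hb : (-1) ^+ (~~ b) = - (-1) ^+ b :> R.
  by case: (b); rewrite ?expr0 ?expr1 ?opprK.
(* Exchanging the two profiles changes the sign of the antisymmetric part together with the order of
   the two remainders, so both values of [b] lead to the same identity. *)
have hq : ((q b t x, q (~~ b) t x) = (q false t x, q true t x) /\ (-1) ^+ b = 1 :> R) \/
  ((q b t x, q (~~ b) t x) = (q true t x, q false t x) /\ (-1) ^+ b = - 1 :> R).
  by case: (b); [right|left]; rewrite ?expr0 ?expr1.
move: hode; rewrite -/(q false t x) -/(q true t x).
rewrite /w !hz hb -/(z b t x) hz.
set s := plim2 _ t 0 x; set y := plim2 _ t 0 x; set l := plim _ 0 t.
set z1 := plim2 _ t 1 x; set z2 := plim2 _ t 2 x.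
set e : R := (-1) ^+ b in hq *.
have hkp : N%:R = kappa * pexp - kappa by rewrite kappa_pexp addrC addKr.
have hmu : mu R N n = kappa * lambda_n * pexp - kappa by rewrite kappa_lambda addrK.
move=> hode.
have -> : (x ^+ 2 - tau ^+ 2) * (tau ^+ 6 * t * z2) + N%:R * x * (tau ^+ 6 * t * z1) =
   tau ^+ 6 * t * ((x ^+ 2 * z2 + N%:R * (x * z1)) - tau ^+ 2 * z2) by ring.
rewrite hode hmu hkp.
by rewrite eqxx mulr1n; case: hq => -[[-> ->] ->]; field.
Qed.

End iterate_limits.

(** * Jacobi polynomials *)

Section jacobi_poly.
Context (R : realType) (N n : nat).
Hypothesis N3 : (3 <= N)%N.
Let beta : R := (N%:R - 2) / 2.

Lemma beta_gt0 : 0 < beta.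
Proof. by have h := ge3N R N3; rewrite /beta divr_gt0//; lra. Qed.

Lemma gbinomS (a : R) k : gbinom a k.+1 * k.+1%:R = gbinom a k * (a - k%:R).
Proof.
rewrite /gbinom big_ord_recr/= factS natrM.
have k0 : k`!%:R != 0 :> R by rewrite pnatr_eq0 -lt0n fact_gt0.
by field; rewrite k0 ?natr1 ?nat1r pnatr_eq0.
Qed.

Lemma gbinom_gt0 s : (s <= n)%N -> 0 < gbinom (n%:R + beta) s.
Proof.
move=> sn; rewrite /gbinom divr_gt0 ?ltr0n ?fact_gt0// prodr_gt0// => i _.
have : i%:R <= n%:R :> R by rewrite ler_nat (leq_trans (ltnW (ltn_ord i))).
have := beta_gt0; lra.
Qed.

Definition jcoef s : R := gbinom (n%:R + beta) s * gbinom (n%:R + beta) (n - s).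

Lemma jcoef_gt0 s : (s <= n)%N -> 0 < jcoef s.
Proof. by move=> sn; rewrite mulr_gt0// gbinom_gt0// leq_subr. Qed.

Lemma jcoefS s : (s < n)%N -> jcoef s.+1 * s.+1%:R * (s.+1%:R + beta) =
  jcoef s * (n - s)%:R * ((n - s)%:R + beta).
Proof.
move=> sn; rewrite /jcoef.
have h1 := gbinomS (n%:R + beta) s.
have := gbinomS (n%:R + beta) (n - s.+1); rewrite -subSn// subSS => h2.
transitivity ((gbinom (n%:R + beta) s.+1 * s.+1%:R) * gbinom (n%:R + beta) (n - s.+1) *
  (s.+1%:R + beta)); first by ring.
transitivity (gbinom (n%:R + beta) s * (gbinom (n%:R + beta) (n - s) * (n - s)%:R) *
  ((n - s)%:R + beta)); last by ring.
by rewrite h1 h2 (natrB _ sn) (natrB _ (ltnW sn)) -natr1; ring.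
Qed.

Definition jA : {poly R} := 2^-1 *: ('X - 1%:P).
Definition jB : {poly R} := 2^-1 *: ('X + 1%:P).
Definition jT s : {poly R} := jA ^+ (n - s) * jB ^+ s.
Definition jpoly : {poly R} := \sum_(s < n.+1) jcoef s *: jT s.

Lemma jpolyE xi : jpoly.[xi] = jacobi n beta beta xi.
Proof.
rewrite /jpoly horner_sum; apply: eq_bigr => s _.
have A1 : jA.[xi] = (xi - 1) / 2 by rewrite /jA hornerZ hornerXsubC mulrC.
have B1 : jB.[xi] = (xi + 1) / 2.
  by rewrite /jB hornerZ hornerD hornerX hornerC mulrC.
by rewrite hornerZ /jT hornerM !horner_exp A1 B1 /jcoef !mulrA.
Qed.

Lemma deriv_jA : jA^`() = (2^-1)%:P.
Proof. by rewrite derivZ derivB derivX derivC subr0 -mul_polyC mulr1. Qed.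

Lemma deriv_jB : jB^`() = (2^-1)%:P.
Proof. by rewrite derivZ derivD derivX derivC addr0 -mul_polyC mulr1. Qed.

Lemma deriv_half_exp (A : {poly R}) k : A^`() = (2^-1)%:P ->
  [/\ (A ^+ k)^`() = (k%:R / 2)%:P * A ^+ k.-1,
      A * (A ^+ k)^`() = (k%:R / 2)%:P * A ^+ k &
      A * (A ^+ k)^`()^`() = (k%:R * (k%:R - 1) / 4)%:P * A ^+ k.-1].
Proof.
move=> dA.
have d j : (A ^+ j)^`() = (j%:R / 2)%:P * A ^+ j.-1.
  by rewrite deriv_exp dA -[_ *+ j]mulr_natr polyCM polyC_natr; ring.
split=> //.
  by rewrite d mulrCA; case: k => [|k]; rewrite ?mul0r// -exprS.
rewrite d derivM derivC mul0r add0r d mulrCA.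
case: k => [|[|k]]; rewrite ?mul0r//.
  by rewrite !(subrr, mulr0, mul0r).
rewrite /= [A * (_ * _)]mulrCA -exprS mulrA -polyCM; congr (_%:P * _).
by rewrite -(natr1 k.+1); field.
Qed.

(** With X = jA + jB, jB = jA + 1 and X^2 - 1 = 4 jA jB, the Jacobi operator is tridiagonal on the
    [jT s]: the last two terms are multiples of [jT] at s + 1 and s - 1. The truncated predecessors
    at s = n and s = 0 carry the coefficient 0. *)
Lemma jT_ode s : (s <= n)%N ->
  dopl N (jT s) - (jT s)^`()^`() =
  (2 * (n - s)%:R * s%:R + N%:R * n%:R / 2) *: jT s +
  ((n - s)%:R * ((n - s)%:R + beta)) *: (jA ^+ (n - s).-1 * jB ^+ s.+1) +
  (s%:R * (s%:R + beta)) *: (jA ^+ (n - s).+1 * jB ^+ s.-1).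
Proof.
move=> sn; rewrite /jT.
have [A1 A2 A3] := deriv_half_exp (n - s) deriv_jA.
have [B1 B2 B3] := deriv_half_exp s deriv_jB.
have h2 : (2^-1)%:P * 2 = 1 :> {poly R}.
  by rewrite -polyC_natr -polyCM mulVf// pnatr_eq0.
have BA : jB = jA + 1.
  rewrite /jA /jB -!mul_polyC polyC1; set h := (2^-1)%:P in h2 *.
  have -> : h * ('X + 1) = h * ('X - 1) + h * 2 by ring.
  by rewrite h2.
have XE : 'X = jA + jB.
  rewrite /jA /jB -!mul_polyC polyC1; set h := (2^-1)%:P in h2 *.
  have -> : h * ('X - 1) + h * ('X + 1) = 'X * (h * 2) by ring.
  by rewrite h2 mulr1.
have X2 : 'X^2 - 1 = 4 * jA * jB by rewrite XE BA; ring.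
rewrite /dopl; set f := jA ^+ _ * jB ^+ _.
have -> : 'X^2 * f^`()^`() + N%:R *: ('X * f^`()) - f^`()^`() =
  ('X^2 - 1) * f^`()^`() + N%:R%:P * ('X * f^`()) by rewrite -mul_polyC; ring.
rewrite X2 XE.
have f1 : f^`() = (jA ^+ (n - s))^`() * jB ^+ s + jA ^+ (n - s) * (jB ^+ s)^`() by rewrite derivM.
have f2 : f^`()^`() = (jA ^+ (n - s))^`()^`() * jB ^+ s +
  2 * ((jA ^+ (n - s))^`() * (jB ^+ s)^`()) + jA ^+ (n - s) * (jB ^+ s)^`()^`().
  by rewrite f1 derivD !derivM; ring.
have -> : 4 * jA * jB * f^`()^`() = 4 * (jA * (jA ^+ (n - s))^`()^`()) * jB ^+ s.+1 +
  8 * ((jA * (jA ^+ (n - s))^`()) * (jB * (jB ^+ s)^`())) +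
  4 * jA ^+ (n - s).+1 * (jB * (jB ^+ s)^`()^`()).
  by rewrite f2 !exprS; ring.
have -> : (jA + jB) * f^`() = (jA * (jA ^+ (n - s))^`()) * jB ^+ s +
   jA ^+ (n - s).+1 * (jB ^+ s)^`() + (jA ^+ (n - s))^`() * jB ^+ s.+1 +
   jA ^+ (n - s) * (jB * (jB ^+ s)^`()).
  by rewrite f1 !exprS; ring.
rewrite A3 A2 A1 B3 B2 B1 -!mul_polyC /f.
have nE : n%:R = (n - s)%:R + s%:R :> R by rewrite natrB// subrK.
rewrite nE; move: (n - s)%N => k.
set a := jA ^+ k; set b := jB ^+ s; set a1 := jA ^+ k.-1; set b1 := jB ^+ s.-1.
rewrite !exprS -/a -/b.
have cst (x : R) : 4 * x%:P = (4 * x)%:P :> {poly R} by rewrite -[4]polyC_natr -polyCM.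
have cst8 (x : R) : 8 * x%:P = (8 * x)%:P :> {poly R} by rewrite -[8]polyC_natr -polyCM.
have -> : 4 * ((k%:R * (k%:R - 1) / 4)%:P * a1) * (jB * b) +
    8 * ((k%:R / 2)%:P * a * ((s%:R / 2)%:P * b)) +
    4 * (jA * a) * ((s%:R * (s%:R - 1) / 4)%:P * b1) +
    N%:R%:P * ((k%:R / 2)%:P * a * b + jA * a * ((s%:R / 2)%:P * b1) +
      (k%:R / 2)%:P * a1 * (jB * b) + a * ((s%:R / 2)%:P * b)) =
  (8 * (k%:R / 2)%:P * (s%:R / 2)%:P + N%:R%:P * ((k%:R / 2)%:P + (s%:R / 2)%:P)) * (a * b) +
  (4 * (k%:R * (k%:R - 1) / 4)%:P + N%:R%:P * (k%:R / 2)%:P) * (a1 * (jB * b)) +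
  (4 * (s%:R * (s%:R - 1) / 4)%:P + N%:R%:P * (s%:R / 2)%:P) * (jA * a * b1) by ring.
rewrite !cst cst8 -!polyCD -!polyCM -!polyCD.
by congr (_%:P * _ + _%:P * _ + _%:P * _); rewrite /beta; field.
Qed.

(** By [jcoefS] the raising and lowering sums, reindexed, become diagonal. The three diagonal
    coefficients then add up to n^2 + n beta + N n / 2, which is mu n and no longer depends on s. *)
Lemma jpoly_ode : dopl N jpoly - jpoly^`()^`() = mu R N n *: jpoly.
Proof.
have doplS (I : Type) (r : seq I) (F : I -> {poly R}) :
    dopl N (\sum_(i <- r) F i) - (\sum_(i <- r) F i)^`()^`() =
    \sum_(i <- r) (dopl N (F i) - (F i)^`()^`()).
  elim: r => [|i r IH]; first by rewrite !big_nil /dopl !deriv0 !mulr0 scaler0 addr0 subr0.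
  rewrite !big_cons -IH /dopl !derivD !mulrDr scalerDr; ring.
have doplZ c (f : {poly R}) : dopl N (c *: f) - (c *: f)^`()^`() =
    c *: (dopl N f - f^`()^`()).
  rewrite /dopl !derivZ -!mul_polyC; ring.
rewrite /jpoly doplS.
have -> : \sum_(i < n.+1) (dopl N (jcoef i *: jT i) - (jcoef i *: jT i)^`()^`()) =
  \sum_(s < n.+1) (jcoef s * (2 * (n - s)%:R * s%:R + N%:R * n%:R / 2)) *: jT s +
  \sum_(s < n.+1) (jcoef s * (n - s)%:R * ((n - s)%:R + beta)) *:
     (jA ^+ (n - s).-1 * jB ^+ s.+1) +
  \sum_(s < n.+1) (jcoef s * s%:R * (s%:R + beta)) *: (jA ^+ (n - s).+1 * jB ^+ s.-1).
  rewrite -!big_split/=; apply: eq_bigr => s _.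
  rewrite doplZ jT_ode; last by rewrite -ltnS.
  by rewrite !scalerDr !scalerA !mulrA.
have -> : \sum_(s < n.+1) (jcoef s * (n - s)%:R * ((n - s)%:R + beta)) *:
     (jA ^+ (n - s).-1 * jB ^+ s.+1) =
   \sum_(s < n.+1) (jcoef s * s%:R * (s%:R + beta)) *: jT s.
  rewrite big_ord_recr/= subnn mulr0 mul0r scale0r addr0.
  rewrite big_ord_recl/= mulr0 mul0r scale0r add0r; apply: eq_bigr => s _.
  by rewrite /bump/= add1n jcoefS// /jT subnS.
have -> : \sum_(s < n.+1) (jcoef s * s%:R * (s%:R + beta)) *:
     (jA ^+ (n - s).+1 * jB ^+ s.-1) =
   \sum_(s < n.+1) (jcoef s * (n - s)%:R * ((n - s)%:R + beta)) *: jT s.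
  rewrite [RHS]big_ord_recr/= subnn mulr0 mul0r scale0r addr0.
  rewrite big_ord_recl/= mulr0 mul0r scale0r add0r; apply: eq_bigr => s _.
  by rewrite /bump/= add1n jcoefS// /jT -subSn// subSS.
rewrite -!big_split/= scaler_sumr; apply: eq_bigr => s _.
have sn : (s <= n)%N by rewrite -ltnS.
rewrite -!scalerDl scalerA; congr (_ *: _).
by rewrite /mu natrB// /beta; field.
Qed.

Lemma jpoly_rec j : (mu R N j - mu R N n) * jpoly`_j = (j.+2 * j.+1)%:R * jpoly`_j.+2.
Proof.
have /(congr1 (fun p : {poly R} => p`_j)) := jpoly_ode.
rewrite coefB coefZ coef_dopl !coef_deriv => h.
by rewrite mulrBl -h opprB addrCA subrr addr0 -mulrnA mulr_natl.
Qed.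

Lemma refl_jT s : (s <= n)%N -> refl (jT s) = (-1) ^+ n *: jT (n - s).
Proof.
move=> sn.
have rA : refl jA = - jB.
  by rewrite /refl /jA /jB comp_polyZ comp_polyB comp_polyX comp_polyC -opprD scalerN.
have rB : refl jB = - jA.
  rewrite /refl /jA /jB comp_polyZ comp_polyD comp_polyX comp_polyC.
  by rewrite -scalerN opprB addrC.
rewrite /jT /refl rmorphM/= !rmorphXn/= -!/(refl _) rA rB.
rewrite [(- jB) ^+ _]exprNn [(- jA) ^+ _]exprNn subKn//.
have -> : (-1) ^+ (n - s) * jB ^+ (n - s) * ((-1) ^+ s * jA ^+ s) =
  (-1) ^+ (n - s + s) * (jA ^+ s * jB ^+ (n - s)) by rewrite exprD; ring.
rewrite subnK// -signr_odd -[in RHS]signr_odd.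
by case: (odd n); rewrite ?expr0 ?expr1 ?mul1r ?scale1r ?mulN1r ?scaleN1r.
Qed.

Lemma jpoly_sym j : (-1) ^+ j * jpoly`_j = (-1) ^+ n * jpoly`_j.
Proof.
suff H : refl jpoly = (-1) ^+ n *: jpoly by rewrite -coef_refl H coefZ.
rewrite {1}/jpoly /refl rmorph_sum/= /jpoly scaler_sumr.
rewrite [RHS](reindex_inj rev_ord_inj)/=; apply: eq_bigr => s _.
have sn : (s <= n)%N by rewrite -ltnS.
rewrite comp_polyZ -/(refl _) refl_jT// subSS scalerA mulrC -scalerA; congr (_ *: (_ *: _)).
by rewrite /jcoef subKn// mulrC.
Qed.

Lemma size_jT s : (s <= n)%N -> (size (jT s) <= n.+1)%N /\ (jT s)`_n = 2^-1 ^+ n.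
Proof.
move=> sn.
have E : jT s = 2^-1 ^+ n *: (('X - 1%:P) ^+ (n - s) * ('X - (-1)%:P) ^+ s).
  rewrite /jT /jA /jB !exprZn polyCN opprK -scalerAl -scalerAr scalerA -exprD.
  by rewrite subnK.
have m : ('X - 1%:P) ^+ (n - s) * ('X - (-1)%:P) ^+ s \is @monic R.
  by rewrite monicMl ?monic_exp ?monicXsubC.
have sz : size (('X - 1%:P) ^+ (n - s) * ('X - (-1)%:P) ^+ s : {poly R}) = n.+1.
  by rewrite size_monicM ?monic_exp ?monicXsubC ?monic_neq0 ?monic_exp ?monicXsubC//
    !size_exp_XsubC addnS/= addSn subnK.
split; first by rewrite E (leq_trans (size_scale_leq _ _))// sz.
rewrite E coefZ; have := monicP m; rewrite lead_coefE sz/= => ->; by rewrite mulr1.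
Qed.

Lemma jpoly_out j : (n < j)%N -> jpoly`_j = 0.
Proof.
move=> nj; rewrite /jpoly coef_sum big1// => s _; rewrite coefZ nth_default ?mulr0//.
have [h _] := size_jT (ltn_ord s : (s <= n)%N).
exact: leq_trans h nj.
Qed.

(** Every [jT s] has the same coefficient 2^-n in degree n, and the [jcoef s] are positive, so
    nothing cancels. This permits the normalisation [jnorm]. *)
Lemma jpoly_lead_gt0 : 0 < jpoly`_n.
Proof.
rewrite /jpoly coef_sum big_ord_recl/= ltr_pwDl//.
  by rewrite coefZ (size_jT (leq0n _)).2 mulr_gt0 ?jcoef_gt0// exprn_gt0.
apply: sumr_ge0 => s _.
have sn : (bump 0 s <= n)%N by rewrite /bump/= add1n.
by rewrite coefZ (size_jT sn).2 mulr_ge0 ?exprn_ge0// ltW// jcoef_gt0.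
Qed.

(** Only s = n survives at xi = 1. That point is the origin of R^N, where the branch is compared
    with the bubble. *)
Lemma jpoly1_gt0 : 0 < jpoly.[1].
Proof.
rewrite /jpoly horner_sum big_ord_recr/= big1 ?add0r.
  rewrite hornerZ /jT subnn expr0 mul1r horner_exp mulr_gt0 ?jcoef_gt0// exprn_gt0//.
  by rewrite /jB hornerZ hornerD hornerX hornerC; lra.
move=> s _; rewrite hornerZ /jT hornerM horner_exp /jA hornerZ hornerXsubC subrr mulr0.
by rewrite expr0n subn_eq0 leqNgt ltn_ord/= mul0r mulr0.
Qed.

Definition jnorm (j : nat) : R := jpoly`_j / jpoly`_n.

Lemma jnorm_sym j : (-1) ^+ j * jnorm j = (-1) ^+ n * jnorm j.
Proof. by rewrite /jnorm !mulrA jpoly_sym. Qed.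

Lemma jnorm_n : jnorm n = 1.
Proof. by rewrite /jnorm divff// gt_eqF// jpoly_lead_gt0. Qed.

Lemma jnorm_out j : (n < j)%N -> jnorm j = 0.
Proof. by move=> nj; rewrite /jnorm jpoly_out ?mul0r. Qed.

Lemma jnorm_rec j : (mu R N j - mu R N n) * jnorm j = (j.+2 * j.+1)%:R * jnorm j.+2.
Proof. by rewrite /jnorm !mulrA jpoly_rec. Qed.

Lemma evt_Phat_jacobi tau t xi : tau != 0 ->
  (evt t (Phat n jnorm tau)).[tau * xi] = tau ^+ n / jpoly`_n * jacobi n beta beta xi.
Proof.
move=> tau0; rewrite -jpolyE.
have s1 : (size (evt t (Phat n jnorm tau)) <= n.+1)%N.
  by rewrite (leq_trans (size_poly _ _))// size_poly.
have s2 : (size jpoly <= n.+1)%N by apply/leq_sizeP => j; exact: jpoly_out.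
rewrite (horner_coef_wide _ s1) (horner_coef_wide _ s2) mulr_sumr.
apply: eq_bigr => j _; rewrite coef_evt coef_poly ltn_ord hornerC /jnorm exprMn.
have -> : tau ^+ n = tau ^+ (n - j) * tau ^+ j by rewrite -exprD subnK// -ltnS.
by ring.
Qed.

End jacobi_poly.

(** * Integration by parts on R^N *)

Section rV_topology.
Context (R : realType).

Lemma rV_cvg (T : Type) (F : set_system T) {FF : Filter F} n (u : T -> 'rV[R]_n) (l : 'rV[R]_n) :
  (forall i, u t ord0 i @[t --> F] --> l ord0 i) -> u @ F --> l.
Proof.
move=> ul; apply/cvg_ballP => e e0.
have : \forall t \near F, forall i, ball (l ord0 i) e (u t ord0 i).
  by apply: filter_forall => i; move/cvg_ballP: (ul i); exact.
by apply: filterS => t H; split=> // i j; rewrite !ord1.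
Qed.

Lemma cons_rV_continuous2 n (x : R) : continuous (fun y : 'rV[R]_n => cons_rV (x, y)).
Proof.
move=> y; apply: (rV_cvg (F := nbhs y)) => i; case: (unliftP ord0 i) => [j|] ->.
- under eq_fun do rewrite cons_rVS; rewrite cons_rVS; exact: coord_continuous.
- under eq_fun do rewrite cons_rV0; rewrite cons_rV0; exact: cvg_cst.
Qed.

Lemma cons_rV_continuous1 n (y : 'rV[R]_n) : continuous (fun x : R => cons_rV (x, y)).
Proof.
move=> x; apply: (rV_cvg (F := nbhs x)) => i; case: (unliftP ord0 i) => [j|] ->.
- under eq_fun do rewrite cons_rVS; rewrite cons_rVS; exact: cvg_cst.
- by under eq_fun do rewrite cons_rV0; rewrite cons_rV0.
Qed.

Lemma cons_rV_shiftS n (x h : R) (y : 'rV[R]_n) j :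
  cons_rV (x, h *: evec R j + y) = h *: evec R (lift ord0 j) + cons_rV (x, y).
Proof.
apply/rowP => i; rewrite [RHS]mxE; case: (unliftP ord0 i) => [k|] ->.
  by rewrite !cons_rVS /= !mxE (inj_eq lift_inj).
by rewrite !cons_rV0 /= !mxE /= mulr0 add0r.
Qed.

Lemma cons_rV_shift0 n (x h : R) (y : 'rV[R]_n) :
  cons_rV (h + x, y) = h *: evec R ord0 + cons_rV (x, y).
Proof.
apply/rowP => i; rewrite [RHS]mxE; case: (unliftP ord0 i) => [k|] ->.
  by rewrite !cons_rVS /= !mxE /= mulr0 add0r.
by rewrite !cons_rV0 /= !mxE eqxx mulr1.
Qed.

(* f is the pointwise limit of its values at the grid points of mesh 1/(k+1). *)
Lemma continuous_rV_measurable n (f : 'rV[R]_n -> R) :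
  continuous f -> measurable_fun setT f.
Proof.
move=> fc.
pose gr (k : nat) (z : 'rV[int]_n) : 'rV[R]_n := \row_i ((z ord0 i)%:~R / k.+1%:R).
pose fl (k : nat) (X : 'rV[R]_n) : 'rV[int]_n := \row_i Num.floor (k.+1%:R * X ord0 i).
apply: (@measurable_fun_cvg _ _ _ _ (fun k X => f (gr k (fl k X)))) => [k|X _].
  move=> _ Y mY; rewrite setTI.
  have -> : (fun X => f (gr k (fl k X))) @^-1` Y =
    \bigcup_(z in [set: 'rV[int]_n])
      ((if f (gr k z) \in Y then setT else set0) `&` [set X | fl k X = z]).
    apply/seteqP; split=> [X /= YX|X [z _ []]].
      by exists (fl k X) => //; split => //; rewrite mem_set.
    by case: ifPn => // /set_mem Yz _ /= fz; rewrite /= fz.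
  apply: countable_bigcupT_measurable => // z; apply: measurableI; first by case: ifP.
  have -> : [set X | fl k X = z] = \bigcap_(i in [set: 'I_n])
      ((fun X : 'rV[R]_n => X ord0 i) @^-1` [set` `[(z ord0 i)%:~R / k.+1%:R, ((z ord0 i) + 1)%:~R / k.+1%:R[%R]).
    apply/seteqP; split=> [X /= <- i _|X /= H].
      rewrite /= in_itv/= mxE ler_pdivrMr// ltr_pdivlMr// mulrC; exact: floor_itv.
    apply/rowP => i; rewrite mxE; apply: floor_def.
    by have := H i I; rewrite /= in_itv/= ler_pdivrMr// ltr_pdivlMr// mulrC.
  apply: fin_bigcap_measurable => // i _; rewrite -[X in measurable X]setTI.
  by apply: measurable_coord => //; exact: measurable_itv.
have : gr k (fl k X) @[k --> \oo] --> X.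
  apply: rV_cvg => i; apply/cvgrPdist_le => e e0.
  near=> k; rewrite !mxE.
  have /andP[h1 h2] := floor_itv (k.+1%:R * X ord0 i).
  have k0 : 0 < k.+1%:R :> R by [].
  rewrite -(ler_pM2l k0) -{1}(gtr0_norm k0) -normrM mulrBr mulrCA divff ?gt_eqF// mulr1.
  rewrite ger0_norm ?subr_ge0// ltW//; apply: (@lt_le_trans _ _ 1).
    by rewrite ltrBlDr addrC -[1]/(1%:~R) -intrD.
  rewrite mulrC -ler_pdivrMr// div1r.
  by near: k; apply: filterS (near_infty_natSinv_lt (PosNum e0)) => k; move=> /ltW.
move/(cvg_comp _ _); apply; exact: fc.
Unshelve. all: by end_near. Qed.

End rV_topology.

(** * An integrable product weight on R^N *)

Section weight.
Context (R : realType).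
Local Notation leb := (@lebesgue_measure R).

(* Any exponent in ]1, 4/3] would do: its N-fold product must dominate
   (1 + |x|^2) ^ (1 - N) for N >= 3. *)
Definition weight (x : R) : R := (1 + `|x|) `^ (- (4 / 3)).

Lemma weight_gt0 x : 0 < weight x.
Proof. by rewrite powR_gt0// ltr_pwDl. Qed.

Lemma is_derive_powR_shift (e x : R) : 0 <= x ->
  is_derive x 1 (fun x : R => (1 + x) `^ e) (e * (1 + x) `^ (e - 1)).
Proof.
move=> x0; have d1 : is_derive x 1 (fun x : R => 1 + x) 1.
  have h1 : is_derive x (1 : R) (cst (1 : R)) 0 by exact: is_derive_cst.
  have h2 : is_derive x (1 : R) (id : R -> R) 1 by exact: is_derive_id.
  by have := is_deriveD h1 h2; rewrite add0r.
have x1 : 0 < 1 + x by rewrite ltr_pwDl.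
have d2 := @is_derive1_powR R e (1 + x) x1.
have : is_derive x (1 : R) ((fun y : R => y `^ e) \o (fun x : R => 1 + x)) (e * (1 + x) `^ (e - 1) * 1).
  exact: is_derive1_comp.
by rewrite mulr1.
Qed.

Lemma weight_continuous : continuous weight.
Proof.
move=> x; rewrite /weight.
apply: (@continuous_comp _ _ _ (fun x : R => `|x|) (fun y => (1 + y) `^ (- (4 / 3)))).
  exact: norm_continuous.
apply: differentiable_continuous; apply/derivable1_diffP.
by have [] := is_derive_powR_shift (- (4/3)) (normr_ge0 x).
Qed.

Lemma measurable_weight : measurable_fun setT weight.
Proof. by apply: continuous_measurable_fun; exact: weight_continuous. Qed.

Lemma powR_shift_cvg0 (e : R) : 0 < e -> (1 + x) `^ (- e) @[x --> +oo] --> 0.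
Proof.
move=> e0; apply/cvgrPdist_le => eps eps0; near=> x.
have hx : eps^-1 `^ e^-1 <= x by near: x; exact: nbhs_pinfty_ge.
have x0 : 0 <= x by apply: le_trans hx; exact: powR_ge0.
have x1 : 0 < 1 + x by rewrite ltr_pwDl.
rewrite sub0r normrN ger0_norm ?powR_ge0// powRN -[leRHS]invrK.
rewrite lef_pV2 ?posrE ?invr_gt0 ?powR_gt0//.
have -> : eps^-1 = (eps^-1 `^ e^-1) `^ e.
  by rewrite -powRrM mulVf ?gt_eqF// powRr1// invr_ge0 ltW.
apply: ge0_ler_powR; rewrite ?nnegrE ?powR_ge0 ?(ltW e0) ?(ltW x1)//.
by apply: le_trans hx _; rewrite lerDr.
Unshelve. all: by end_near. Qed.

Lemma integral_weight_lty : (\int[leb]_x (weight x)%:E < +oo)%E.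
Proof.
have dF (x : R) : 0 <= x -> is_derive x 1 (fun x : R => - 3 * (1 + x) `^ (- (1 / 3)))
    (- 3 * (- (1 / 3) * (1 + x) `^ (- (1 / 3) - 1))).
  by move=> x0; exact: (is_deriveZ (-3) (is_derive_powR_shift (- (1 / 3)) x0)).
rewrite ge0_symfun_integralT//; last 3 first.
- by move=> x; exact/ltW/weight_gt0.
- exact: weight_continuous.
- by move=> x; rewrite /weight /= normrN.
have -> : [set x : R | (0 <= x)%R] = [set` `[0, +oo[] by rewrite set_itvcy.
rewrite (@ge0_continuous_FTC2y _ weight (fun x => - 3 * (1 + x) `^ (- (1 / 3))) 0 0).
- by rewrite -EFinB -EFinM ltry.
- by move=> x _; exact/ltW/weight_gt0.
- by apply: continuous_subspaceT; exact: weight_continuous.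
- rewrite -[0 in X in _ --> X](mulr0 (- 3)); apply: cvgMr; exact: powR_shift_cvg0.
- by move=> x x0; have [] := dF x (ltW x0).
- apply: cvg_at_right_filter; have [d0 _] := dF 0 (lexx 0).
  exact: (differentiable_continuous ((derivable1_diffP _ _).1 d0)).
- move=> x; rewrite in_itv/= andbT => x0; rewrite derive1E.
  have [_ ->] := dF x (ltW x0); rewrite /weight gtr0_norm//.
  have -> : - (1 / 3) - 1 = - (4 / 3) :> R by field.
  by rewrite mulrA; set p := _ `^ _; field.
Qed.

Definition weight_rV n (X : 'rV[R]_n) : R := \prod_(i < n) weight (X ord0 i).

Lemma weight_rV_gt0 n (X : 'rV[R]_n) : 0 < weight_rV X.
Proof. by apply: prodr_gt0 => i _; exact: weight_gt0. Qed.

Lemma measurable_weight_rV n : measurable_fun setT (@weight_rV n).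
Proof.
rewrite /weight_rV; move: (index_enum _) => s.
elim: s => [|i s IH].
  by under eq_fun do rewrite big_nil; exact: measurable_cst.
under eq_fun do rewrite big_cons.
apply: measurable_funM => //.
exact: (measurableT_comp measurable_weight (measurable_coord i)).
Qed.

Lemma measurable_weight_rVE n :
  measurable_fun setT (fun X : 'rV[R]_n => (weight_rV X)%:E).
Proof. by apply/(measurable_EFinP setT (@weight_rV n)); exact: measurable_weight_rV. Qed.

Lemma weight_rV_cons n x (y : 'rV[R]_n) : weight_rV (cons_rV (x, y)) = weight x * weight_rV y.
Proof.
rewrite /weight_rV big_ord_recl cons_rV0; congr (_ * _).
by apply: eq_bigr => i _; rewrite cons_rVS.
Qed.

Lemma integral_weight_rV_lty n :
  (\int[lebesgue_rV R n]_X (weight_rV X)%:E < +oo)%E.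
Proof.
elim: n => [|n IH].
  rewrite integral_dirac//; first by rewrite diracT mul1e ltry.
  exact: measurable_weight_rVE.
rewrite /= /lebesgue_rV_succ ge0_integral_pushforward//; last 3 first.
- exact: measurable_cons_rV.
- exact: measurable_weight_rVE.
- by move=> X _; rewrite lee_fin ltW// weight_rV_gt0.
rewrite preimage_setT fubini_tonelli1; last 2 first.
- apply: measurableT_comp; last exact: measurable_cons_rV.
  exact: measurable_weight_rVE.
- by move=> X; rewrite lee_fin ltW// weight_rV_gt0.
rewrite /fubini_F.
under eq_integral => x _.
  under eq_integral do rewrite /= weight_rV_cons EFinM.
  rewrite ge0_integralZl//; last 3 first.
  - exact: measurable_weight_rVE.
  - by move=> X _; rewrite lee_fin ltW// weight_rV_gt0.
  - by rewrite lee_fin ltW// weight_gt0.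
  over.
rewrite ge0_integralZr//.
- have w0 : (0 <= \int[leb]_x (weight x)%:E)%E.
    by apply: integral_ge0 => x _; rewrite lee_fin ltW// weight_gt0.
  by apply: lte_mul_pinfty => //; rewrite ge0_fin_numE// integral_weight_lty.
- apply/(measurable_EFinP setT weight); exact: measurable_weight.
- by move=> x _; rewrite lee_fin ltW// weight_gt0.
- by apply: integral_ge0 => x _; rewrite lee_fin ltW// weight_rV_gt0.
Qed.

Lemma weight_rV_integrable n : (lebesgue_rV R n).-integrable setT (EFin \o @weight_rV n).
Proof.
apply/integrableP; split; first exact: measurable_weight_rVE.
under eq_integral do rewrite /= ger0_norm ?(ltW (weight_rV_gt0 _))//.
exact: integral_weight_rV_lty.
Qed.

End weight.

Section integral_of_derivative.
Context (R : realType).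
Local Notation leb := (@lebesgue_measure R).

(** The complement of a cube, not of a ball, so that sections by fixing one coordinate have the same
    form in the induction on the dimension. *)
Definition outside n (r : R) (X : 'rV[R]_n) : Prop := exists j, r < `|X ord0 j|.

Lemma outside_bound n r (f : 'rV[R]_n -> R) : continuous f ->
  (forall X, outside r X -> f X = 0) -> exists2 M, 0 <= M & forall X, `|f X| <= M * weight_rV X.
Proof.
move=> fc f0.
pose B : set 'rV[R]_n := [set X | forall i, [set` `[- r, r]] (X ord0 i)].
have cB : compact B.
  by apply: (@rV_compact R n (fun _ => [set` `[- r, r]])) => _; exact: segment_compact.
have : compact (f @` B) by apply: continuous_compact => //; exact: continuous_subspaceT.
move=> /compact_bounded[M [_ hM]].
(* A lower bound for each factor of the weight on the cube; the absolute value keeps it meaningful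
   for negative r. *)
pose w0 : R := (1 + `|r|) `^ (- (4 / 3)).
have w00 : 0 < w0 by rewrite powR_gt0// ltr_pwDl.
pose K := `|M| + 1.
have K0 : 0 <= K by rewrite addr_ge0.
exists (K / w0 ^+ n) => [|X]; first by rewrite divr_ge0// exprn_ge0// ltW.
have [XB|] := pselect (B X); last first.
  move=> /existsNP[j hj]; rewrite f0 ?normr0.
    by rewrite mulr_ge0 ?(ltW (weight_rV_gt0 _))// divr_ge0// exprn_ge0// ltW.
  by exists j; rewrite ltNge ler_norml; apply/negP => h; apply: hj; rewrite /= in_itv.
have fK : `|f X| <= K.
  apply: hM; last by exists X.
  by rewrite (le_lt_trans (ler_norm M))// ltrDl.
apply: le_trans fK _; rewrite -mulrA ler_peMr// mulrC ler_pdivlMr ?exprn_gt0// mul1r.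
rewrite /weight_rV -[X in w0 ^+ X](card_ord n) -prodr_const; apply: ler_prod => i _.
rewrite ltW//= /w0 /weight !powRN lef_pV2 ?posrE ?powR_gt0 ?ltr_pwDl//.
apply: ge0_ler_powR; rewrite ?nnegrE ?addr_ge0 ?divr_ge0//.
rewrite lerD2l; have := XB i; rewrite /= in_itv/= -ler_norml => /le_trans; apply.
exact: ler_norm.
Qed.

Lemma weight_bound_integrable n (f : 'rV[R]_n -> R) M : measurable_fun setT f ->
  (forall X, `|f X| <= M * weight_rV X) -> (lebesgue_rV R n).-integrable setT (EFin \o f).
Proof.
move=> mf fM; apply: (@le_integrable _ _ _ (lebesgue_rV R n) setT measurableT _
  (EFin \o (fun X => M * weight_rV X))).
- exact/measurable_EFinP.
- by move=> X _; rewrite /= lee_fin (le_trans (fM X))// ler_norm.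
- have -> : EFin \o (fun X => M * weight_rV X) =
     (fun X => M%:E * (EFin \o @weight_rV R n) X)%E by apply/funext => X; rewrite /= EFinM.
  by apply: integrableZl => //; exact: weight_rV_integrable.
Qed.

Lemma outside_integrable n r (f : 'rV[R]_n -> R) : continuous f ->
  (forall X, outside r X -> f X = 0) -> (lebesgue_rV R n).-integrable setT (EFin \o f).
Proof.
move=> fc f0; have [M _ fM] := outside_bound fc f0.
exact: weight_bound_integrable (continuous_rV_measurable fc) fM.
Qed.

Lemma outside_derive n r (f : 'rV[R]_n -> R) X v d : (forall X, outside r X -> f X = 0) ->
  outside r X -> is_derive X v f d -> d = 0.
Proof.
move=> f0 [j Xj] [_ <-].
rewrite (@near_eq_derive _ _ _ f (cst 0)) ?derive_cst//.
have c : {for X, continuous (fun Y : 'rV[R]_n => `|Y ord0 j|)}.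
  by apply: continuous_comp; [exact: coord_continuous|exact: norm_continuous].
have H : \forall Y \near X, r < `|(Y : 'rV[R]_n) ord0 j| by exact: (cvgr_gt _ c).
by apply: filterS H => Y hY; rewrite f0//; exists j.
Qed.

Lemma integral_derive0 (phi dphi : R -> R) (r : R) : continuous dphi ->
  (forall x : R, is_derive x 1 phi (dphi x)) ->
  (forall x, r < `|x| -> phi x = 0) -> (forall x, r < `|x| -> dphi x = 0) ->
  (\int[leb]_x (dphi x)%:E = 0)%E.
Proof.
move=> dc pd p0 d0; pose a : R := `|r| + 1.
have a0 : 0 < a by rewrite ltr_wpDl.
have ra : r < a by rewrite (le_lt_trans (ler_norm _))// ltrDl.
have cphi : continuous phi.
  by move=> x; apply: differentiable_continuous; apply/derivable1_diffP; have [] := pd x.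
have -> : (\int[leb]_x (dphi x)%:E = \int[leb]_(x in [set` `[(- a)%R, a]]) (dphi x)%:E)%E.
  rewrite [RHS]integral_mkcond; apply: eq_integral => x _; rewrite patchE.
  case: ifPn => // /negP xa; rewrite d0//; rewrite ltNge; apply/negP => xr; apply: xa.
  by rewrite inE/= in_itv/= -ler_norml (le_trans xr)// ltW.
rewrite (@continuous_FTC2 _ dphi phi); last first.
- by move=> x _; rewrite derive1E; have [] := pd x.
- split.
  + by move=> x _; have [] := pd x.
  + by apply: cvg_at_right_filter; exact: cphi.
  + by apply: cvg_at_left_filter; exact: cphi.
- exact: continuous_subspaceT.
- by rewrite gtrN.
by rewrite !p0 ?subee// ?normrN gtr0_norm.
Qed.

(** By Fubini the direction i can be integrated first. If i is the first coordinate, the fundamental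
    theorem of calculus applies on each line; otherwise the induction hypothesis applies to each
    section. *)
Lemma integral_partial0 n (i : 'I_n) (G dG : 'rV[R]_n -> R) r :
  continuous G -> continuous dG -> (forall X, is_derive X (evec R i) G (dG X)) ->
  (forall X, outside r X -> G X = 0) -> (\int[lebesgue_rV R n]_X (dG X)%:E = 0)%E.
Proof.
elim: n i G dG => [[]//|n IH] i G dG Gc dGc dE G0.
have dG0 X : outside r X -> dG X = 0 by move=> oX; exact: outside_derive G0 oX (dE X).
have idG := outside_integrable dGc dG0.
have mdG : measurable_fun setT (EFin \o dG).
  by apply/measurable_EFinP; exact: continuous_rV_measurable.
have icons : (leb \x lebesgue_rV R n)%E.-integrable setT ((EFin \o dG) \o @cons_rV R n).
  apply/integrableP; split.
    by apply: measurableT_comp => //; exact: measurable_cons_rV.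
  move/integrableP: idG => [_]; rewrite /= /lebesgue_rV_succ ge0_integral_pushforward//.
  - exact: measurable_cons_rV.
    apply/(measurable_EFinP setT (fun y => `|dG y|)); apply: measurableT_comp => //.
    exact: continuous_rV_measurable.
rewrite /= /lebesgue_rV_succ integral_pushforward//; last exact: measurable_cons_rV.
rewrite preimage_setT.
case: (unliftP ord0 i) dE => [j|] -> dE.
- rewrite -integral12_prod_meas1//; apply: integral0_eq => x _ /=.
  apply: (IH j (fun y => G (cons_rV (x, y))) (fun y => dG (cons_rV (x, y)))).
  + by move=> y; apply: continuous_comp; [exact: cons_rV_continuous2|exact: Gc].
  + by move=> y; apply: continuous_comp; [exact: cons_rV_continuous2|exact: dGc].
  + move=> y; have [d1 d2] := dE (cons_rV (x, y)).
    have E : (fun h : R => h^-1 *: (((fun y => G (cons_rV (x, y))) \o shift y)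
        (h *: evec R j) - G (cons_rV (x, y)))) =
      (fun h : R => h^-1 *: ((G \o shift (cons_rV (x, y))) (h *: evec R (lift ord0 j)) -
        G (cons_rV (x, y)))).
      by apply/funext => h; rewrite /= /shift/= cons_rV_shiftS.
    by split; [rewrite /derivable E|rewrite /derive E].
  + by move=> y [k yk]; apply: G0; exists (lift ord0 k); rewrite cons_rVS.
- rewrite -integral21_prod_meas1//; apply: integral0_eq => y _ /=.
  apply: (@integral_derive0 (fun x => G (cons_rV (x, y))) (fun x => dG (cons_rV (x, y))) r).
  + by move=> x; apply: continuous_comp; [exact: cons_rV_continuous1|exact: dGc].
  + move=> x; have [d1 d2] := dE (cons_rV (x, y)).
    have E : (fun h : R => h^-1 *: (((fun x => G (cons_rV (x, y))) \o shift x)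
        (h *: 1) - G (cons_rV (x, y)))) =
      (fun h : R => h^-1 *: ((G \o shift (cons_rV (x, y))) (h *: evec R ord0) -
        G (cons_rV (x, y)))).
      by apply/funext => h; rewrite /= /shift/= -cons_rV_shift0 [h *: 1]mulr1.
    by split; [rewrite /derivable E|rewrite /derive E].
  + by move=> x xr; apply: G0; exists ord0; rewrite cons_rV0.
  + by move=> x xr; apply: dG0; exists ord0; rewrite cons_rV0.
Qed.

End integral_of_derivative.

(** * Radial functions *)

Section radial_calculus.
Context (R : realType) (N : nat).
Implicit Types (X : 'rV[R]_N) (F : R -> R).

(** Radial functions are written in s = |x|^2 and not in |x|, so that differentiability at the
    origin follows from that of [F] at s = 0. *)
Definition sqn X : R := \sum_(i < N) X ord0 i ^+ 2.

Lemma sqn_ge0 X : 0 <= sqn X.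
Proof. by apply: sumr_ge0 => i _; exact: sqr_ge0. Qed.

Lemma enorm_sqr X : enorm X ^+ 2 = sqn X.
Proof. by rewrite /enorm sqr_sqrtr// sqn_ge0. Qed.

Lemma coord_sqr_le X i : X ord0 i ^+ 2 <= sqn X.
Proof.
by rewrite /sqn (bigD1 i)//= lerDl sumr_ge0// => j _; exact: sqr_ge0.
Qed.

Lemma coord_le_enorm X i : `|X ord0 i| <= enorm X.
Proof. by rewrite -sqrtr_sqr ler_wsqrtr// coord_sqr_le. Qed.

Lemma rV_continuousD (f g : 'rV[R]_N -> R) : continuous f -> continuous g ->
  continuous (fun X => f X + g X).
Proof. by move=> fc gc X; exact: (cvgD (fc X) (gc X)). Qed.

Lemma rV_continuousM (f g : 'rV[R]_N -> R) : continuous f -> continuous g ->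
  continuous (fun X => f X * g X).
Proof. by move=> fc gc X; exact: (cvgM (fc X) (gc X)). Qed.

Lemma rV_continuous_cst (c : R) : continuous (fun X : 'rV[R]_N => c).
Proof. exact: cst_continuous. Qed.

Lemma sqn_continuous : continuous sqn.
Proof.
have -> : sqn = fun X => \sum_(i <- index_enum 'I_N) X ord0 i ^+ 2 by [].
move: (index_enum _) => s; elim: s => [|i s IH].
  have -> : (fun X => \sum_(i <- [::]) X ord0 i ^+ 2) = cst 0.
    by apply/funext => X; rewrite big_nil.
  exact: cst_continuous.
have -> : (fun X => \sum_(j <- i :: s) X ord0 j ^+ 2) =
    (fun X => X ord0 i ^+ 2 + \sum_(j <- s) X ord0 j ^+ 2).
  by apply/funext => X; rewrite big_cons.
have c : continuous (fun X : 'rV[R]_N => X ord0 i ^+ 2).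
  move=> X; apply: (@continuous_comp _ _ _ (fun Y : 'rV[R]_N => Y ord0 i) (fun y : R => y ^+ 2)).
    exact: coord_continuous.
  exact: exprn_continuous.
exact: rV_continuousD c IH.
Qed.

Lemma is_derive_line (f : 'rV[R]_N -> R) X v d :
  is_derive (0 : R) 1 (fun h : R => f (h *: v + X)) d -> is_derive X v f d.
Proof.
move=> [d1 d2].
have E : (fun h : R => h^-1 *: (((fun h : R => f (h *: v + X)) \o shift 0) (h *: 1) -
    f (0 *: v + X))) = (fun h : R => h^-1 *: ((f \o shift X) (h *: v) - f X)).
  by apply/funext => h; rewrite /= /shift/= addr0 scale0r add0r [h *: 1]mulr1.
by split; [rewrite /derivable -E|rewrite /derive -E].
Qed.

Lemma sqn_line X i (h : R) : sqn (h *: evec R i + X) = sqn X + (h * (2 * X ord0 i) + h ^+ 2).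
Proof.
rewrite /sqn (bigD1 i)//= [in RHS](bigD1 i)//= !mxE !eqxx/= mulr1.
rewrite (eq_bigr (fun j => X ord0 j ^+ 2)); first by ring.
by move=> j ji; rewrite !mxE (negbTE ji)/= mulr0 add0r.
Qed.

Lemma is_derive_radial F d X i : is_derive (sqn X) 1 F d ->
  is_derive X (evec R i) (fun Y => F (sqn Y)) (2 * X ord0 i * d).
Proof.
move=> dF; apply: is_derive_line.
pose g (h : R) : R := sqn X + (h * (2 * X ord0 i) + h ^+ 2).
have -> : (fun h : R => F (sqn (h *: evec R i + X))) = F \o g.
  by apply/funext => h; rewrite /= sqn_line.
have g0 : g 0 = sqn X by rewrite /g mul0r expr0n/= !addr0.
have dg : is_derive (0 : R) (1 : R) g (2 * X ord0 i).
  have h1 : is_derive (0 : R) (1 : R) (cst (sqn X)) 0 by exact: is_derive_cst.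
  have h2 : is_derive (0 : R) (1 : R) (id : R -> R) 1 by exact: is_derive_id.
  have h3 := is_deriveD h1 (is_deriveD (is_deriveZ (2 * X ord0 i) h2) (is_deriveX 2 h2)).
  have gE : g = cst (sqn X) + ((2 * X ord0 i) \*: id + id ^+ 2).
    by apply/funext => h; rewrite /g/= mulrC.
  rewrite gE; apply: (is_derive_eq h3).
  by rewrite /GRing.scale/=; ring.
rewrite mulrC; apply: is_derive1_comp => //.
by rewrite g0.
Qed.

Variables F F1 F2 : R -> R.
Hypothesis dF : forall s : R, 0 <= s -> is_derive s 1 F (F1 s).
Hypothesis cF1 : forall s : R, 0 <= s -> {for s, continuous F1}.

Lemma radial_continuous (G : R -> R) : (forall s : R, 0 <= s -> {for s, continuous G}) ->
  continuous (fun X => G (sqn X)).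
Proof.
move=> cG X; apply: (@continuous_comp _ _ _ sqn G); first exact: sqn_continuous.
exact: cG (sqn_ge0 X).
Qed.

Lemma cF (s : R) : 0 <= s -> {for s, continuous F}.
Proof.
move=> s0; have [d _] := dF s0.
exact: (differentiable_continuous ((derivable1_diffP _ _).1 d)).
Qed.

Definition rgrad X : 'rV[R]_N := \row_i (2 * X ord0 i * F1 (sqn X)).

Lemma is_derive_rgrad X i : is_derive X (evec R i) (fun Y => F (sqn Y)) (rgrad X ord0 i).
Proof. by rewrite /rgrad mxE; apply: is_derive_radial; exact: dF (sqn_ge0 X). Qed.

Lemma rgrad_continuous i : continuous (fun X => rgrad X ord0 i).
Proof.
have -> : (fun X => rgrad X ord0 i) = (fun X => 2 * X ord0 i * F1 (sqn X)).
  by apply/funext => Y; rewrite /rgrad mxE.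
apply: rV_continuousM; last exact: (radial_continuous cF1).
by apply: rV_continuousM; [exact: rV_continuous_cst|exact: coord_continuous].
Qed.

Lemma partial_radial i : partial i (fun Y => F (sqn Y)) = (fun X => rgrad X ord0 i).
Proof. by apply/funext => X; rewrite /partial; have [_ ->] := is_derive_rgrad X i. Qed.

Section second_order.
Hypothesis dF1 : forall s : R, 0 <= s -> is_derive s 1 F1 (F2 s).
Hypothesis cF2 : forall s : R, 0 <= s -> {for s, continuous F2}.

Lemma is_derive_rgrad2 X i j : is_derive X (evec R j) (fun X => rgrad X ord0 i)
  (2 * (i == j)%:R * F1 (sqn X) + 4 * X ord0 i * X ord0 j * F2 (sqn X)).
Proof.
have -> : (fun X => rgrad X ord0 i) = (fun X => 2 * X ord0 i) * (fun X => F1 (sqn X)).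
  by apply/funext => Y; rewrite /rgrad mxE.
have d1 := is_derive_radial j (dF1 (sqn_ge0 X)).
have d2 : is_derive X (evec R j) (fun X => 2 * X ord0 i) (2 * (i == j)%:R).
  apply: is_derive_line.
  have h1 : is_derive (0 : R) (1 : R) (cst (2 * X ord0 i)) 0 by exact: is_derive_cst.
  have h2 : is_derive (0 : R) (1 : R) (id : R -> R) 1 by exact: is_derive_id.
  have := is_deriveD h1 (is_deriveZ (2 * (i == j)%:R) h2).
  rewrite add0r [_ *: 1]mulr1.
  have -> // : cst (2 * X ord0 i) + (2 * (i == j)%:R) \*: id =
    (fun h : R => 2 * (h *: evec R j + X) ord0 i).
  apply/funext => h; rewrite !mxE eqxx/=.
  rewrite -[LHS]/(2 * X ord0 i + 2 * (i == j)%:R * h); ring.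
apply: (is_derive_eq (is_deriveM d2 d1)).
by rewrite /GRing.scale/=; ring.
Qed.

Lemma Cn2_radial : Cn 2 (fun X => F (sqn X)).
Proof.
split; first by apply: radial_continuous; exact: cF.
move=> i; split; first by move=> X; have [] := is_derive_rgrad X i.
rewrite partial_radial; split; first exact: rgrad_continuous.
move=> j; split; first by move=> X; have [] := is_derive_rgrad2 X i j.
split=> //.
have -> : partial j (fun X => rgrad X ord0 i) = fun X =>
    2 * (i == j)%:R * F1 (sqn X) + 4 * X ord0 i * X ord0 j * F2 (sqn X).
  by apply/funext => X; rewrite /partial; have [_ ->] := is_derive_rgrad2 X i j.
apply: rV_continuousD.
  by apply: rV_continuousM; [exact: rV_continuous_cst|exact: (radial_continuous cF1)].
apply: rV_continuousM; last exact: (radial_continuous cF2).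
apply: rV_continuousM; last exact: coord_continuous.
by apply: rV_continuousM; [exact: rV_continuous_cst|exact: coord_continuous].
Qed.

Lemma laplacian_radial X : laplacian (fun X => F (sqn X)) X =
  2 * N%:R * F1 (sqn X) + 4 * sqn X * F2 (sqn X).
Proof.
rewrite /laplacian.
under eq_bigr => i _.
  rewrite partial_radial /partial; have [_ ->] := is_derive_rgrad2 X i i.
  rewrite eqxx mulr1; over.
rewrite big_split/= sumr_const card_ord -mulr_natr; congr (_ + _); first by ring.
rewrite {3}/sqn mulr_sumr mulr_suml; apply: eq_bigr => i _; ring.
Qed.

End second_order.

(** The product with a test function vanishes outside a cube, so its i-th derivative has integral 0;
    the product rule gives the two integrals. *)
Lemma weak_gradient_radial : is_weak_gradient (fun X => F (sqn X)) rgrad.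
Proof.
move=> f i [fCn [r fr]].
have [fc /(_ i) [fd [dfc _]]] := fCn 1%N.
have f0 X : outside r X -> f X = 0.
  by move=> [j Xj]; apply: fr; exact: lt_le_trans Xj (coord_le_enorm _ _).
have dfE X : is_derive X (evec R i) f (partial i f X) by exact: derivableP.
have df0 X : outside r X -> partial i f X = 0.
  by move=> oX; exact: outside_derive f0 oX (dfE X).
have uc := radial_continuous cF.
have c1 : continuous (fun X => F (sqn X) * partial i f X).
  exact: rV_continuousM uc dfc.
have c2 : continuous (fun X => rgrad X ord0 i * f X).
  by apply: rV_continuousM; [exact: rgrad_continuous|exact: fc].
have i1 : (lebesgue_rV R N).-integrable setT (EFin \o (fun X => F (sqn X) * partial i f X)).
  by apply: (outside_integrable (r := r) c1) => X oX; rewrite df0 ?mulr0.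
have i2 : (lebesgue_rV R N).-integrable setT (EFin \o (fun X => rgrad X ord0 i * f X)).
  by apply: (outside_integrable (r := r) c2) => X oX; rewrite f0 ?mulr0.
apply/eqP; rewrite -addr_eq0 -RintegralD//; apply/eqP.
suff H : (\int[lebesgue_rV R N]_X
    (F (sqn X) * partial i f X + rgrad X ord0 i * f X)%:E = 0)%E by rewrite /Rintegral H.
apply: (integral_partial0 (i := i) (G := fun X => F (sqn X) * f X) (r := r)).
- exact: rV_continuousM uc fc.
- exact: rV_continuousD c1 c2.
- move=> X; apply: (is_derive_eq (is_deriveM (is_derive_rgrad X i) (dfE X))).
  by rewrite /GRing.scale/= [f X * _]mulrC.
- by move=> X oX; rewrite f0// mulr0.
Qed.

End radial_calculus.

(** * Energy bounds for radial functions *)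

Section radial_D12.
Context (R : realType) (N : nat).
Hypothesis N3 : (3 <= N)%N.
Local Notation lebN := (lebesgue_rV R N).
Implicit Types X : 'rV[R]_N.

Let m : R := (N%:R - 2) / 2.
(** One factor 2^(2/3) per coordinate, from (1 + |x_i|)^2 <= 2 (1 + x_i^2) raised to the power
    2/3. *)
Definition wconst : R := (2 `^ (2 / 3)) ^+ N.
Definition wint : R := fine (\int[lebN]_X (weight_rV X)%:E)%E.

Let N3R : 3 <= N%:R :> R. Proof. by rewrite ler_nat. Qed.

Lemma wconst_gt0 : 0 < wconst.
Proof. by rewrite exprn_gt0// powR_gt0. Qed.

Lemma wint_ge0 : 0 <= wint.
Proof.
by apply: fine_ge0; apply: integral_ge0 => X _; rewrite lee_fin ltW// weight_rV_gt0.
Qed.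

Lemma wintE : (\int[lebN]_X (weight_rV X)%:E = wint%:E)%E.
Proof.
rewrite fineK// ge0_fin_numE ?integral_weight_rV_lty//.
by apply: integral_ge0 => X _; rewrite lee_fin ltW// weight_rV_gt0.
Qed.

Lemma onesqn_ge1 X : 1 <= 1 + sqn X. Proof. by rewrite lerDl sqn_ge0. Qed.

(* As 1 + |x|^2 is at least 1 + x_i^2 for every i, a power of it splits into one factor
   per coordinate. *)
Lemma powR_le_weight (e : R) X : 2 * N%:R / 3 <= e ->
  (1 + sqn X) `^ (- e) <= wconst * weight_rV X.
Proof.
move=> he; have s1 := onesqn_ge1 X.
apply: (@le_trans _ _ ((1 + sqn X) `^ (- (2 * N%:R / 3)))).
  by apply: ler_powR => //; rewrite lerN2.
have -> : - (2 * N%:R / 3) = - (2 / 3) * N%:R :> R by field.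
rewrite powRrM powR_mulrn ?powR_ge0// /wconst /weight_rV.
have -> (y : R) : y ^+ N = \prod_(i < N) y by rewrite prodr_const card_ord.
have -> (y : R) : y ^+ N = \prod_(i < N) y by rewrite prodr_const card_ord.
rewrite -big_split/=; apply: ler_prod => i _; rewrite powR_ge0/=.
have x0 := normr_ge0 (X ord0 i).
have hx : (1 + `|X ord0 i|) ^+ 2 / 2 <= 1 + sqn X.
  have := coord_sqr_le X i; rewrite -real_normK ?num_real// => h.
  by have := sqr_ge0 (1 - `|X ord0 i|); lra.
have p0 : 0 < (1 + `|X ord0 i|) ^+ 2 / 2 by rewrite divr_gt0// exprn_gt0// ltr_pwDl.
have -> : 2 `^ (2 / 3) * weight (X ord0 i) = ((1 + `|X ord0 i|) ^+ 2 / 2) `^ (- (2 / 3)).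
  rewrite /weight powRM ?sqr_ge0 ?invr_ge0// mulrC; congr (_ * _).
    by rewrite -powR_mulrn ?addr_ge0// -powRrM; congr (_ `^ _); field.
  by rewrite -[2^-1]powR_inv1// -powRrM; congr (_ `^ _); field.
rewrite !powRN lef_pV2 ?posrE ?powR_gt0//; last by rewrite (lt_le_trans ltr01).
apply: ge0_ler_powR; rewrite ?nnegrE ?divr_ge0// ?(ltW p0)//.
exact: le_trans ler01 s1.
Qed.

Lemma Lnorm_lty_of_bound (f : 'rV[R]_N -> R) p C : measurable_fun setT f -> 0 <= C -> 0 < p ->
  (forall X, `|f X| `^ p <= C * weight_rV X) ->
  ('N[lebN]_p%:E[EFin \o f] <= ((C * wint) `^ p^-1)%:E)%E.
Proof.
move=> mf C0 p0 fC; rewrite unlock -poweR_EFin.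
apply: gt0_ler_poweR; rewrite ?invr_ge0 ?(ltW p0)//.
- by rewrite in_itv/= leey andbT; apply: integral_ge0 => X _; rewrite lee_fin powR_ge0.
- by rewrite in_itv/= leey andbT lee_fin mulr_ge0// wint_ge0.
rewrite EFinM -wintE -ge0_integralZl//; last 2 first.
- exact: measurable_weight_rVE.
- by move=> X _; rewrite lee_fin ltW// weight_rV_gt0.
apply: ge0_le_integral => //.
- by move=> X _; exact: poweR_ge0.
- apply/(measurable_EFinP setT (fun X => `|f X| `^ p)).
  apply: (measurableT_comp (@measurable_powR R p)).
  exact: measurableT_comp.
- have -> : (fun X => C%:E * (weight_rV X)%:E)%E = (fun X => (C * weight_rV X)%:E).
    by apply/funext => X; rewrite EFinM.
  apply/(measurable_EFinP setT (fun X => C * weight_rV X)).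
  by apply: measurable_funM => //; exact: measurable_weight_rV.
- by move=> X _; rewrite /= -EFinM lee_fin.
Qed.

Lemma Lfun_of_bound (f : 'rV[R]_N -> R) p C : measurable_fun setT f -> 0 <= C -> 0 < p ->
  (forall X, `|f X| `^ p <= C * weight_rV X) -> f \in Lfun lebN p%:E.
Proof.
move=> mf C0 p0 fC; apply/andP; split; first exact/mem_set.
by apply/mem_set; exact: le_lt_trans (Lnorm_lty_of_bound mf C0 p0 fC) (ltry _).
Qed.

Variables F F1 : R -> R.
Hypothesis dF : forall s : R, 0 <= s -> is_derive s 1 F (F1 s).
Hypothesis cF1 : forall s : R, 0 <= s -> {for s, continuous F1}.
Variable K : R.
Hypothesis K0 : 0 <= K.
Hypothesis bF : forall s : R, 0 <= s -> `|F s| <= K * (1 + s) `^ (- m).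
Hypothesis bF1 : forall s : R, 0 <= s -> `|F1 s| <= K * (1 + s) `^ (- (m + 1)).

Lemma radial_Lfun : (fun X => F (sqn X)) \in Lfun lebN (critical_exponent R N)%:E.
Proof.
have N2 : 0 < N%:R - 2 :> R by have := N3R; lra.
have p0 : 0 < critical_exponent R N.
  by rewrite /critical_exponent divr_gt0// mulr_gt0//; have := N3R; lra.
apply: (@Lfun_of_bound _ _ (K `^ critical_exponent R N * wconst)) => //.
- by apply: continuous_rV_measurable; apply: radial_continuous; exact: (cF dF).
- by rewrite mulr_ge0 ?powR_ge0// ltW// wconst_gt0.
move=> X; rewrite -mulrA.
apply: (@le_trans _ _ ((K * (1 + sqn X) `^ (- m)) `^ critical_exponent R N)).
  by apply: ge0_ler_powR; rewrite ?nnegrE ?(ltW p0) ?mulr_ge0 ?powR_ge0// bF// sqn_ge0.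
rewrite powRM ?powR_ge0// ler_wpM2l ?powR_ge0// -powRrM.
have -> : - m * critical_exponent R N = - N%:R.
  by rewrite /m /critical_exponent; field; rewrite gt_eqF.
by apply: powR_le_weight; have := N3R; lra.
Qed.

(** The squared gradient is 4 s F1(s)^2, of order (1 + s)^(1 - N); the condition 2 N / 3 <= N - 1 of
    [powR_le_weight] is N >= 3. *)
Lemma enorm_rgrad_le X : enorm (rgrad F1 X) `^ 2 <= 4 * K ^+ 2 * wconst * weight_rV X.
Proof.
have s1 := onesqn_ge1 X; have s0 := sqn_ge0 X.
have -> : enorm (rgrad F1 X) `^ 2 = 4 * sqn X * F1 (sqn X) ^+ 2.
  rewrite powR_mulrn ?sqrtr_ge0// enorm_sqr {1}/sqn {1}/sqn mulr_sumr mulr_suml.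
  by apply: eq_bigr => i _; rewrite /rgrad mxE; ring.
have h1 : F1 (sqn X) ^+ 2 <= K ^+ 2 * (1 + sqn X) `^ (- (2 * (m + 1))).
  have := bF1 s0; rewrite -real_normK ?num_real// => h.
  have -> : - (2 * (m + 1)) = - (m + 1) * 2 :> R by ring.
  rewrite powRrM powR_mulrn ?powR_ge0// -exprMn.
  by rewrite ler_sqr// nnegrE mulr_ge0// powR_ge0.
have h2 : (1 + sqn X) * (1 + sqn X) `^ (- (2 * (m + 1))) = (1 + sqn X) `^ (- (N%:R - 1)).
  rewrite -{1}[1 + sqn X]powRr1; last by rewrite (le_trans ler01).
  rewrite -powRD; last by rewrite (gt_eqF (lt_le_trans ltr01 s1)) implybT.
  by congr (_ `^ _); rewrite /m; field.
have h3 : (1 + sqn X) `^ (- (N%:R - 1)) <= wconst * weight_rV X.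
  by apply: powR_le_weight; have := N3R; lra.
apply: (@le_trans _ _ (4 * (1 + sqn X) * (K ^+ 2 * (1 + sqn X) `^ (- (2 * (m + 1)))))).
  by apply: ler_pM => //; [rewrite mulr_ge0|exact: sqr_ge0|lra].
have -> : 4 * (1 + sqn X) * (K ^+ 2 * (1 + sqn X) `^ (- (2 * (m + 1)))) =
  4 * K ^+ 2 * ((1 + sqn X) * (1 + sqn X) `^ (- (2 * (m + 1)))) by ring.
by rewrite h2 -!mulrA !ler_wpM2l// ?sqr_ge0.
Qed.

Lemma measurable_rgrad : measurable_fun setT (rgrad F1 : 'rV[R]_N -> 'rV[R]_N).
Proof.
apply: measurable_fun_coordP => i.
by apply: continuous_rV_measurable; exact: (rgrad_continuous cF1).
Qed.

Lemma measurable_enorm_rgrad : measurable_fun setT (fun X => enorm (rgrad F1 X)).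
Proof.
apply: continuous_rV_measurable => X.
have c : continuous (fun X => sqn (rgrad F1 X)).
  have -> : (fun X => sqn (rgrad F1 X)) = (fun X => 4 * sqn X * (F1 (sqn X) * F1 (sqn X))).
    apply/funext => Y; rewrite {1}/sqn {1}/sqn mulr_sumr mulr_suml.
    by apply: eq_bigr => i _; rewrite /rgrad mxE; ring.
  apply: rV_continuousM; first by apply: rV_continuousM; [exact: rV_continuous_cst|exact: sqn_continuous].
  by apply: rV_continuousM; exact: (radial_continuous cF1).
apply: (@continuous_comp _ _ _ (fun X => sqn (rgrad F1 X)) Num.sqrt); first exact: c.
exact: sqrt_continuous.
Qed.

Let C1_ge0 : 0 <= 4 * K ^+ 2 * wconst.
Proof. by rewrite mulr_ge0 ?(ltW wconst_gt0)// mulr_ge0// sqr_ge0. Qed.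

Lemma radial_L2_gradient : is_L2_gradient (fun X => F (sqn X)) (rgrad F1).
Proof.
split; [exact: measurable_rgrad| |exact: weak_gradient_radial].
apply: (Lfun_of_bound measurable_enorm_rgrad C1_ge0) => // X.
by rewrite ger0_norm ?sqrtr_ge0// enorm_rgrad_le.
Qed.

Lemma radial_D12 : D12 (fun X => F (sqn X)).
Proof. by split; [exact: radial_Lfun|exists (rgrad F1); exact: radial_L2_gradient]. Qed.

Lemma radial_sqn : radial (fun X => F (sqn X)).
Proof. by move=> X Y XY; rewrite -!enorm_sqr XY. Qed.

(** The norm is an infimum over weak gradients, so the classical gradient bounds it from above. *)
Lemma radial_D12_norm_le :
  (D12_norm (fun X => F (sqn X)) <= (2 * Num.sqrt (wconst * wint) * K)%:E)%E.
Proof.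
apply: (@le_trans _ _ (Lnorm lebN 2%:E (fun X => (enorm (rgrad F1 X))%:E))).
  by apply: ereal_inf_lbound; exists (rgrad F1) => //; exact: radial_L2_gradient.
apply: le_trans (Lnorm_lty_of_bound measurable_enorm_rgrad C1_ge0 _ _) _ => //.
  by move=> X; rewrite ger0_norm ?sqrtr_ge0// enorm_rgrad_le.
rewrite lee_fin powR12_sqrt ?mulr_ge0 ?wint_ge0 ?(ltW wconst_gt0)// ?sqr_ge0//.
have -> : 4 * K ^+ 2 * wconst * wint = (2 * K) ^+ 2 * (wconst * wint) by ring.
rewrite sqrtrM ?sqr_ge0// sqrtr_sqr ger0_norm ?mulr_ge0//.
by rewrite mulrAC.
Qed.

End radial_D12.

Lemma D12_norm_ge0 (R : realType) (N : nat) (u : 'rV[R]_N -> R) : (0 <= D12_norm u)%E.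
Proof. by apply: le_ereal_inf_tmp => _ [g _ <-]; exact: Lnorm_ge0. Qed.

(** * The conformal lift *)

Section conformal_lift.
Context (R : realType) (N : nat).
Hypothesis N3 : (3 <= N)%N.
Variable tau : R.
Hypothesis tau_bnd : 0 < tau <= 4^-1.
Implicit Types X : 'rV[R]_N.

Let m : R := (N%:R - 2) / 2.
Let N3R : 3 <= N%:R :> R. Proof. by rewrite ler_nat. Qed.
Let m_gt0 : 0 < m. Proof. by rewrite /m divr_gt0//; have := N3R; lra. Qed.

Definition stereo (s : R) : R := tau * ((1 - s) / (1 + s)).

(* Stereographic lift of a function of the height coordinate of the sphere. *)
Definition clift (V : R -> R) X : R :=
  (1 + sqn X) `^ (- m) * V (stereo (sqn X)).

Lemma stereo_half s : 0 <= s -> `|stereo s| < 2^-1.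
Proof.
move=> s0; move/andP: tau_bnd => [t0 t1].
rewrite /stereo normrM gtr0_norm//.
have : `|(1 - s) / (1 + s)| <= 1.
  rewrite normrM normfV (@gtr0_norm _ (1 + s)) ?ltr_pwDl// ler_pdivrMr ?ltr_pwDl//.
  by rewrite mul1r ler_norml; lra.
by nra.
Qed.

Lemma is_derive_inv1 (s : R) : 0 <= s ->
  is_derive s 1 (fun s : R => (1 + s)^-1) (- (1 + s) ^- 2).
Proof.
move=> s0; have s1 : 0 < 1 + s by rewrite ltr_pwDl.
have h := is_derive_powR_shift (-1) s0.
have -> : - (1 + s) ^- 2 = (-1) * (1 + s) `^ (-1 - 1).
  have -> : -1 - 1 = - 2%:R :> R by ring.
  by rewrite powR_invn ?ltW// mulN1r.
(* The power with exponent -1 is used as an inverse only where the base is nonnegative, hence the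
   restriction to a neighbourhood of s. *)
suff : {near s, (fun x : R => (1 + x) `^ (-1)) =1 (fun s => (1 + s)^-1)}.
  by move=> E; case: h => h1 h2; split; [exact: near_eq_derivable E h1|rewrite -(near_eq_derive _ E)].
have : \forall x \near s, -1 < x by apply: lt_nbhsr; lra.
by apply: filterS => x x1; rewrite powR_inv1//; lra.
Qed.

Lemma is_derive_stereo (s : R) : 0 <= s ->
  is_derive s 1 stereo (- 2 * tau * (1 + s) ^- 2).
Proof.
move=> s0; have h1 : is_derive s (1 : R) (cst (- tau)) 0 by exact: is_derive_cst.
have h2 := is_deriveD h1 (is_deriveZ (2 * tau) (is_derive_inv1 s0)).
suff E : {near s, cst (- tau) + (2 * tau) \*: (fun s : R => (1 + s)^-1) =1 stereo}.
  case: h2 => h3 h4; split; first exact: near_eq_derivable E h3.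
  by rewrite -(near_eq_derive _ E) h4 add0r /GRing.scale/=; ring.
have : \forall x \near s, -1 < x by apply: lt_nbhsr; lra.
apply: filterS => x x1; rewrite /stereo -[LHS]/(- tau + (2 * tau) * (1 + x)^-1).
by field; rewrite gt_eqF//; lra.
Qed.

Variables V V1 V2 : R -> R.
Hypothesis dV : forall x : R, `|x| < 2^-1 -> is_derive x 1 V (V1 x).
Hypothesis dV1 : forall x : R, `|x| < 2^-1 -> is_derive x 1 V1 (V2 x).
Hypothesis cV2 : forall x : R, `|x| < 2^-1 -> {for x, continuous V2}.

Definition clift0 (s : R) : R := (1 + s) `^ (- m) * V (stereo s).
(** The power of 1 + s is taken out so that the other factor stays bounded; this is the decay that
    the energy bound asks for. *)
Definition clift1 (s : R) : R :=
  (1 + s) `^ (- (m + 1)) * (- m * V (stereo s) - 2 * tau * V1 (stereo s) * (1 + s)^-1).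
Definition clift2 (s : R) : R :=
  (1 + s) `^ (- (m + 2)) * ((m + 1) * m * V (stereo s) +
    4 * (m + 1) * tau * V1 (stereo s) * (1 + s)^-1 +
    4 * tau ^+ 2 * V2 (stereo s) * (1 + s) ^- 2).

Lemma powR_shiftS (e s : R) : 0 <= s -> (1 + s) `^ e = (1 + s) `^ (e - 1) * (1 + s).
Proof.
move=> s0; have s1 : 0 < 1 + s by rewrite ltr_pwDl.
rewrite -{3}[1 + s]powRr1 ?ltW// -powRD; first by rewrite subrK.
by rewrite (gt_eqF s1) implybT.
Qed.

Lemma is_derive_comp_stereo (G G1 : R -> R) (s : R) : 0 <= s ->
  (forall x : R, `|x| < 2^-1 -> is_derive x 1 G (G1 x)) ->
  is_derive s 1 (fun s => G (stereo s)) (G1 (stereo s) * (- 2 * tau * (1 + s) ^- 2)).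
Proof.
move=> s0 dG; have h1 := dG _ (stereo_half s0); have h2 := is_derive_stereo s0.
exact: is_derive1_comp.
Qed.

Lemma is_derive_clift0 (s : R) : 0 <= s -> is_derive s 1 clift0 (clift1 s).
Proof.
move=> s0; have s1 : 0 < 1 + s by rewrite ltr_pwDl.
have h := is_deriveM (is_derive_powR_shift (- m) s0) (is_derive_comp_stereo s0 dV).
apply: (is_derive_eq h); rewrite /GRing.scale/= /clift1 (powR_shiftS (- m) s0).
have -> : - m - 1 = - (m + 1) by ring.
by field; rewrite gt_eqF.
Qed.

Lemma is_derive_clift1 (s : R) : 0 <= s -> is_derive s 1 clift1 (clift2 s).
Proof.
move=> s0; have s1 : 0 < 1 + s by rewrite ltr_pwDl.
have hV := is_deriveZ (- m) (is_derive_comp_stereo s0 dV).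
have hV1 := is_deriveZ (- (2 * tau))
  (is_deriveM (is_derive_comp_stereo s0 dV1) (is_derive_inv1 s0)).
have h := is_deriveM (is_derive_powR_shift (- (m + 1)) s0) (is_deriveD hV hV1).
have E : clift1 = (fun x : R => (1 + x) `^ (- (m + 1))) *
    ((- m) \*: (fun s => V (stereo s)) + (- (2 * tau)) \*:
      ((fun s => V1 (stereo s)) * (fun s : R => (1 + s)^-1))).
  apply/funext => x; rewrite /clift1.
  rewrite -[RHS]/((1 + x) `^ (- (m + 1)) *
    (- m * V (stereo x) + (- (2 * tau)) * (V1 (stereo x) * (1 + x)^-1))); ring.
rewrite E; apply: (is_derive_eq h); rewrite /GRing.scale/= /clift2.
rewrite -[LHS]/((1 + s) `^ (- (m + 1)) *
    (- m * (V1 (stereo s) * (- 2 * tau * (1 + s) ^- 2)) +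
     - (2 * tau) * (V1 (stereo s) * - (1 + s) ^- 2 +
       (1 + s)^-1 * (V2 (stereo s) * (- 2 * tau * (1 + s) ^- 2)))) +
  (- m * V (stereo s) + - (2 * tau) * (V1 (stereo s) * (1 + s)^-1)) *
    (- (m + 1) * (1 + s) `^ (- (m + 1) - 1))).
rewrite (powR_shiftS (- (m + 1)) s0).
have -> : - (m + 1) - 1 = - (m + 2) by ring.
by field; rewrite gt_eqF.
Qed.

Lemma stereo_continuous (s : R) : 0 <= s -> {for s, continuous stereo}.
Proof.
move=> s0; have [d _] := is_derive_stereo s0.
exact: (differentiable_continuous ((derivable1_diffP _ _).1 d)).
Qed.

Lemma clift1_continuous (s : R) : 0 <= s -> {for s, continuous clift1}.
Proof.
move=> s0; have [d _] := is_derive_clift1 s0.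
exact: (differentiable_continuous ((derivable1_diffP _ _).1 d)).
Qed.

Lemma clift2_continuous (s : R) : 0 <= s -> {for s, continuous clift2}.
Proof.
move=> s0; have sh := stereo_half s0.
have cc (G G1 : R -> R) : (forall x : R, `|x| < 2^-1 -> is_derive x 1 G (G1 x)) ->
    {for s, continuous (fun s => G (stereo s))}.
  move=> dG; have [d _] := is_derive_comp_stereo s0 dG.
  exact: (differentiable_continuous ((derivable1_diffP _ _).1 d)).
have c0 := cc _ _ dV; have c1 := cc _ _ dV1.
have c2 : {for s, continuous (fun s => V2 (stereo s))}.
  by apply: continuous_comp; [exact: stereo_continuous|exact: cV2].
have ci : {for s, continuous (fun s : R => (1 + s)^-1)}.
  have [d _] := is_derive_inv1 s0.
  exact: (differentiable_continuous ((derivable1_diffP _ _).1 d)).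
have cp : {for s, continuous (fun s : R => (1 + s) `^ (- (m + 2)))}.
  have [d _] := is_derive_powR_shift (- (m + 2)) s0.
  exact: (differentiable_continuous ((derivable1_diffP _ _).1 d)).
apply: (cvgM cp); apply: cvgD.
  apply: cvgD; first by apply: cvgMr; exact: c0.
  by apply: cvgM; [apply: cvgMr; exact: c1|exact: ci].
apply: cvgM; first by apply: cvgMr; exact: c2.
have -> : (fun x : R => (1 + x) ^- 2) = (fun x => (1 + x)^-1 * (1 + x)^-1).
  by apply/funext => x; rewrite expr2 invfM.
have -> : (1 + s) ^- 2 = (1 + s)^-1 * (1 + s)^-1 by rewrite expr2 invfM.
exact: (cvgM ci ci).
Qed.

Lemma clift_Cn2 : Cn 2 (clift V).
Proof.
exact: (@Cn2_radial R N clift0 clift1 clift2 is_derive_clift0 clift1_continuous is_derive_clift1 clift2_continuous).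
Qed.

(** Conformal covariance, restricted to functions of the height on the sphere. The exponent m + 2
    equals m (N + 2) / (N - 2), so this weight matches that of the critical power and cancels from
    the system. *)
Lemma clift_laplacian X : let x := stereo (sqn X) in
  - laplacian (clift V) X = 4 * (1 + sqn X) `^ (- (m + 2)) *
    ((x ^+ 2 - tau ^+ 2) * V2 x + N%:R * x * V1 x + N%:R * (N%:R - 2) / 4 * V x).
Proof.
move=> x; rewrite (laplacian_radial is_derive_clift0 is_derive_clift1).
have s0 := sqn_ge0 X; set s := sqn X in x s0 *; have s1 : 0 < 1 + s by rewrite ltr_pwDl.
rewrite /clift1 /clift2 -/x (powR_shiftS (- (m + 1)) s0).
have -> : - (m + 1) - 1 = - (m + 2) by ring.
have -> : x ^+ 2 = (tau * ((1 - s) / (1 + s))) ^+ 2 by [].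
have -> : N%:R * x * V1 x = N%:R * (tau * ((1 - s) / (1 + s))) * V1 x by [].
move: (V x) (V1 x) (V2 x) => v v1 v2; set p := _ `^ _.
by rewrite /m; field; rewrite gt_eqF.
Qed.

Lemma clift_D12 K : 0 <= K -> (forall x : R, `|x| < 2^-1 -> `|V x| <= K) ->
  (forall x : R, `|x| < 2^-1 -> `|V1 x| <= K) ->
  D12_rad (clift V) /\
  (D12_norm (clift V) <= (2 * Num.sqrt (wconst R N * wint R N) * ((m + 1) * K))%:E)%E.
Proof.
move=> K0 bV bV1; move/andP: tau_bnd => [t0 t1].
have m0 := m_gt0.
have mK0 : 0 <= (m + 1) * K by rewrite mulr_ge0// addr_ge0// ltW.
have b0 s : 0 <= s -> `|clift0 s| <= (m + 1) * K * (1 + s) `^ (- m).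
  move=> s0; rewrite /clift0 normrM ger0_norm ?powR_ge0// mulrC ler_wpM2r ?powR_ge0//.
  apply: le_trans (bV _ (stereo_half s0)) _.
  by rewrite ler_peMl//; lra.
have b1 s : 0 <= s -> `|clift1 s| <= (m + 1) * K * (1 + s) `^ (- (m + 1)).
  move=> s0; rewrite /clift1 normrM ger0_norm ?powR_ge0// mulrC ler_wpM2r ?powR_ge0//.
  have sh := stereo_half s0; have v0 := bV _ sh; have v1 := bV1 _ sh.
  have s1 : 0 < 1 + s by rewrite ltr_pwDl.
  apply: le_trans (ler_normB _ _) _; rewrite [leRHS]mulrDl mul1r; apply: lerD.
    rewrite mulNr normrN normrM gtr0_norm//; apply: ler_wpM2l => //; exact: ltW.
  rewrite !normrM normfV (gtr0_norm s1) (gtr0_norm t0) (@gtr0_norm _ 2)//.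
  have i1 : (1 + s)^-1 <= 1 by rewrite invf_le1// lerDl.
  have i0 : 0 <= (1 + s)^-1 by rewrite invr_ge0 ltW.
  rewrite -[K]mulr1; apply: ler_pM => //.
    by rewrite mulr_ge0// mulr_ge0// ltW.
  by have := normr_ge0 (V1 (stereo s)); nra.
split.
  split; first exact: (radial_D12 N3 is_derive_clift0 clift1_continuous mK0 b0 b1).
  exact: (@radial_sqn R N clift0).
exact: (radial_D12_norm_le N3 is_derive_clift0 clift1_continuous mK0 b1).
Qed.

End conformal_lift.

(** * From l^1 estimates to differentiable curves in the energy space *)

Section clift_of_limit.
Context (R : realType) (N : nat).
Hypothesis N3 : (3 <= N)%N.
Variable tau : R.
Hypothesis tau_bnd : 0 < tau <= 4^-1.
Local Notation B := {poly {poly R}}.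

Let n1 := norm1_rnorm R.
Let n2 := norm2_rnorm R.

(** The constant is independent of the sequence, so the bound serves equally for profiles, for
    difference quotients and for increments of the derivative in t. *)
Lemma clift_plim_D12 : exists2 C, 0 <= C & forall (p : nat -> {poly R}) K,
  gcauchy (@norm1 R) p -> (forall k, norm1 (p k) <= K) ->
  D12_rad (clift tau (plim p 0) : 'rV[R]_N -> R) /\
  (D12_norm (clift tau (plim p 0) : 'rV[R]_N -> R) <= (C * K)%:E)%E.
Proof.
have [C0 C00 h0] := plim_bound R 0; have [C1 C10 h1] := plim_bound R 1.
exists (2 * Num.sqrt (wconst R N * wint R N) * (((N%:R - 2) / 2 + 1) * (C0 + C1))).
  have N3' := ge3N R N3.
  by rewrite !mulr_ge0 ?sqrtr_ge0 ?addr_ge0// divr_ge0//; lra.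
move=> p K pc pK; have K0 : 0 <= K by apply: le_trans (pK 0%N); exact: (rnorm_ge0 n1).
have cK : 0 <= (C0 + C1) * K by rewrite mulr_ge0// addr_ge0.
have := @clift_D12 R N N3 tau tau_bnd (plim p 0) (plim p 1) (plim p 2)
  (fun x xh => plim_is_derive 0 pc xh) (fun x xh => plim_is_derive 1 pc xh) _ cK.
rewrite !mulrA; apply.
- move=> x xh; apply: le_trans (h0 p K x pc pK (ltW xh)) _.
  by rewrite ler_wpM2r// lerDl.
- move=> x xh; apply: le_trans (h1 p K x pc pK (ltW xh)) _.
  by rewrite ler_wpM2r// lerDr.
Qed.

Lemma clift_eq (V V' : R -> R) : (forall x, `|x| < 2^-1 -> V x = V' x) ->
  clift tau V = clift tau V' :> ('rV[R]_N -> R).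
Proof.
move=> VV; apply/funext => X; rewrite /clift VV//.
exact: stereo_half tau_bnd _ (sqn_ge0 X).
Qed.

Lemma gcauchy_linear (L : B -> {poly R}) C (u : nat -> B) : {morph L : f g / f - g} -> 0 <= C ->
  (forall f, norm1 (L f) <= C * norm2 f) -> gcauchy (@norm2 R) u ->
  gcauchy (@norm1 R) (fun k => L (u k)).
Proof.
move=> LB C0 LC [D D0 hD]; exists (C * D) => [|k]; first exact: mulr_ge0.
by rewrite -LB -mulrA; apply: le_trans (LC _) _; exact: ler_wpM2l.
Qed.

Definition dt (f : B) : B := map_poly (@deriv R) f.

Lemma coef_dt f i : (dt f)`_i = (f`_i)^`().
Proof. by rewrite coef_map_id0// deriv0. Qed.

Lemma dtB : {morph dt : f g / f - g}.
Proof. by move=> f g; apply/polyP => i; rewrite coefB !coef_dt coefB derivB. Qed.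

Lemma evt_taylor : exists2 C, 0 <= C & forall t h (f : B), `|t| <= 2^-1 -> `|t + h| <= 2^-1 ->
  norm1 (evt (t + h) f - evt t f - h *: evt t (dt f)) <= C * h ^+ 2 * norm2 f.
Proof.
have [C C0 hC] := taylor_bound R 0; exists C => // t h f th thh.
apply: (pnorm_coef_le n1 (normr_rnorm R)) => [|i]; first by rewrite mulr_ge0// sqr_ge0.
rewrite !coefB coefZ !coef_evt coef_dt.
have E : t + h - t = h by rewrite addrC addKr.
by have := hC f`_i t (t + h) th thh; rewrite derivn0 derivn1 E.
Qed.

Lemma evt_dt_bound : exists2 C, 0 <= C & forall t (f : B), `|t| <= 2^-1 ->
  norm1 (evt t (dt f)) <= C * norm2 f.
Proof.
have [C C0 hC] := derivn_bound R 1; exists C => // t f th.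
by apply: (pnorm_coef_le n1 (normr_rnorm R)) => // i; rewrite coef_evt coef_dt -derivn1 hC.
Qed.

Lemma evt_dt_lip : exists2 C, 0 <= C & forall t h (f : B), `|t| <= 2^-1 -> `|t + h| <= 2^-1 ->
  norm1 (evt (t + h) (dt f) - evt t (dt f)) <= C * `|h| * norm2 f.
Proof.
have [C C0 hC] := taylor_bound R 1; have [D D0 hD] := derivn_bound R 2.
exists (C + D) => [|t h f th thh]; first exact: addr_ge0.
apply: (pnorm_coef_le n1 (normr_rnorm R)) => [|i].
  by rewrite mulr_ge0// addr_ge0.
rewrite coefB !coef_evt coef_dt -derivn1.
have := hC f`_i t (t + h) th thh; have := hD f`_i t th.
have -> : t + h - t = h by rewrite addrC addKr.
set d := (f`_i)^`(2).[t]; set e := (f`_i)^`(1).[t + h] - (f`_i)^`(1).[t]; set w := norm1 _ => hd he.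
have -> : e = (e - h * d) + h * d by rewrite subrK.
have w0 : 0 <= w by exact: (rnorm_ge0 n1).
have h1 : `|h| <= 1.
  have -> : h = (t + h) - t by rewrite addrC addKr.
  by apply: le_trans (ler_normB _ _) _; have := lerD thh th; lra.
apply: le_trans (ler_normD _ _) _; rewrite (mulrDl C D) [leRHS]mulrDl; apply: lerD.
  apply: le_trans he _; rewrite ler_wpM2r// ler_wpM2l// -real_normK ?num_real// expr2.
  by rewrite ler_piMr.
by rewrite normrM (mulrC D) -mulrA; exact: ler_wpM2l.
Qed.

Lemma gcauchy_dt t (u : nat -> B) : `|t| <= 2^-1 -> gcauchy (@norm2 R) u ->
  gcauchy (@norm1 R) (fun k => evt t (dt (u k))).
Proof.
have [C C0 hC] := evt_dt_bound => th uc.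
apply: (@gcauchy_linear (fun f => evt t (dt f)) C) => //; last by move=> f; exact: hC.
by move=> f g; rewrite dtB evtB.
Qed.

Lemma plim_lin2 (p q : nat -> {poly R}) (a b x : R) : gcauchy (@norm1 R) p ->
  gcauchy (@norm1 R) q -> `|x| <= 2^-1 ->
  plim (fun k => a *: p k + b *: q k) 0 x = a * plim p 0 x + b * plim q 0 x.
Proof.
move=> pc qc xh.
have H : (fun k => (a *: p k + b *: q k)^`(0).[x]) @ \oo --> a * plim p 0 x + b * plim q 0 x.
  have -> : (fun k => (a *: p k + b *: q k)^`(0).[x]) =
      (fun k => a * (p k)^`(0).[x] + b * (q k)^`(0).[x]).
    by apply/funext => k; rewrite derivn0 hornerD !hornerZ.
  by apply: cvgD; apply: cvgMr; exact: plim_cvg.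
exact: (cvg_lim (@Rhausdorff R) H).
Qed.

Lemma plimZ (p : nat -> {poly R}) (a x : R) : gcauchy (@norm1 R) p -> `|x| <= 2^-1 ->
  plim (fun k => a *: p k) 0 x = a * plim p 0 x.
Proof.
move=> pc xh; have := plim_lin2 a 0 pc pc xh; rewrite mul0r addr0 => <-.
by congr (plim _ 0 x); apply/funext => k; rewrite scale0r addr0.
Qed.

Lemma gcauchyZ (p : nat -> {poly R}) (a : R) : gcauchy (@norm1 R) p ->
  gcauchy (@norm1 R) (fun k => a *: p k).
Proof.
move=> [C C0 hC]; exists (`|a| * C) => [|k]; first exact: mulr_ge0.
rewrite -scalerBr -mulrA; apply: le_trans (norm1Z _ _) _; exact: ler_wpM2l.
Qed.

Lemma gcauchyD (p q : nat -> {poly R}) : gcauchy (@norm1 R) p -> gcauchy (@norm1 R) q ->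
  gcauchy (@norm1 R) (fun k => p k + q k).
Proof.
move=> [C C0 hC] [D D0 hD]; exists (C + D) => [|k]; first exact: addr_ge0.
rewrite opprD addrACA mulrDl; apply: le_trans (rnormD n1 _ _) _; exact: lerD.
Qed.

Lemma ereal_squeeze0 (f : R -> \bar R) (F : set_system R) {FF : Filter F} (M : R) :
  h @[h --> F] --> (0 : R) ->
  (\forall h \near F, 0 <= f h <= (M * `|h|)%:E)%E -> f h @[h --> F] --> 0%E.
Proof.
move=> F0 fM; apply: (@squeeze_cvge _ _ _ _ (fun=> 0%E) _ (fun h => (M * `|h|)%:E)) => //.
  exact: cvg_cst.
apply: cvg_EFin; first by near=> h.
have H : M * `|h| @[h --> F] --> M * `|0 : R| by apply: cvgMr; exact: (cvg_norm F0).
by move: H; rewrite normr0 mulr0.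
Unshelve. all: by end_near. Qed.

Variables (c om e0 : R).
Hypothesis e0_gt0 : 0 < e0.
Hypothesis om_e0 : `|om| * e0 <= 2^-1.

Lemma om_half e : - e0 < e < e0 -> `|om * e| <= 2^-1.
Proof.
rewrite -ltr_norml => he; rewrite normrM; apply: le_trans om_e0.
by rewrite ler_wpM2l// ltW.
Qed.

Lemma near_itv e : - e0 < e < e0 -> \forall h \near (0 : R), - e0 < e + h < e0.
Proof.
move=> /andP[h1 h2].
have r0 : 0 < Num.min (e0 - e) (e + e0) by rewrite lt_min; apply/andP; split; lra.
near=> h; have : `|h| < Num.min (e0 - e) (e + e0).
  by near: h; exact: (@nbhs0_lt R R).
by rewrite lt_min !ltr_norml => /andP[/andP[? ?] /andP[? ?]]; lra.
Unshelve. all: by end_near. Qed.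

Definition curve (u : nat -> B) (e : R) : 'rV[R]_N -> R :=
  clift tau (fun x => c * plim2 u (om * e) 0 x).

(* Difference quotients in the parameter are again lifts of limits of polynomials, with
   norm controlled by the quadratic Taylor estimate. *)
Lemma curve_C1 (u : nat -> B) : gcauchy (@norm2 R) u -> C1_curve_D12_rad e0 (curve u).
Proof.
move=> uc; have [C C0 hC] := clift_plim_D12.
have [K K0 uK] := gcauchy_bounded n2 uc.
have [T T0 hT] := evt_taylor; have [D D0 hD] := evt_dt_bound; have [L L0 hL] := evt_dt_lip.
have g1 t : `|t| <= 2^-1 -> gcauchy (@norm1 R) (fun k => evt t (u k)).
  by move=> th; apply: gcauchy_evt uc; exact: half_le1.
have g2 t : `|t| <= 2^-1 -> gcauchy (@norm1 R) (fun k => evt t (dt (u k))).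
  by move=> th; exact: gcauchy_dt uc.
pose du e : 'rV[R]_N -> R :=
  clift tau (fun x => c * om * plim (fun k => evt (om * e) (dt (u k))) 0 x).
(* The amplitude moves inside the limit, which puts the curve in the form required by
   [clift_plim_D12]; the same is done for the derivative. *)
have uE e : - e0 < e < e0 ->
    curve u e = clift tau (plim (fun k => c *: evt (om * e) (u k)) 0).
  move=> /om_half th; apply: clift_eq => x xh.
  by rewrite plimZ ?(ltW xh)//; exact: g1.
have duE e : - e0 < e < e0 ->
    du e = clift tau (plim (fun k => (c * om) *: evt (om * e) (dt (u k))) 0).
  move=> /om_half th; apply: clift_eq => x xh.
  by rewrite plimZ ?(ltW xh)//; exact: g2.
exists du => e he; have th := om_half he; split.
- rewrite uE//; have [] := hC _ (`|c| * K) (gcauchyZ c (g1 _ th)) => // k.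
  apply: le_trans (norm1Z _ _) _; rewrite ler_wpM2l//.
  by apply: le_trans (uK k); apply: norm1_evt; exact: half_le1.
- rewrite duE//; have [] := hC _ (`|c * om| * (D * K)) (gcauchyZ (c * om) (g2 _ th)) => // k.
  apply: le_trans (norm1Z _ _) _; rewrite ler_wpM2l//.
  by apply: le_trans (hD _ _ th) _; rewrite ler_wpM2l.
- apply: (@ereal_squeeze0 _ 0^' _ (C * (`|c| * (T * om ^+ 2 * K)))).
    by apply: cvg_within_filter; exact: cvg_id.
  have := near_itv he => /nbhs_dnbhs Hn.
  near=> h; rewrite D12_norm_ge0/=.
  have h0 : h != 0 by near: h; exact: nbhs_dnbhs_neq.
  have heh : - e0 < e + h < e0 by near: h.
  have thh := om_half heh.
  (* The difference quotient minus the candidate derivative, before the limit: a Taylor remainder of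
     order h^2 divided by h. *)
  pose p k := (c * h^-1) *: (evt (om * e + om * h) (u k) - evt (om * e) (u k) -
    (om * h) *: evt (om * e) (dt (u k))).
  have thh' : `|om * e + om * h| <= 2^-1 by rewrite -mulrDr.
  have pd : gcauchy (@norm1 R) (fun k => evt (om * e + om * h) (u k) - evt (om * e) (u k) -
      (om * h) *: evt (om * e) (dt (u k))).
    apply: gcauchyD; last first.
      by have := gcauchyZ (- (om * h)) (g2 _ th); under eq_fun do rewrite scaleNr.
    apply: gcauchyD; first exact: g1.
    by have := gcauchyZ (-1) (g1 _ th); under eq_fun do rewrite scaleN1r.
  have pc : gcauchy (@norm1 R) p by exact: gcauchyZ.
  have pK k : norm1 (p k) <= `|c| * (T * om ^+ 2 * K) * `|h|.
    apply: le_trans (norm1Z _ _) _; rewrite normrM normfV.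
    have H := hT _ (om * h) (u k) th thh'.
    apply: (@le_trans _ _ (`|c| * `|h|^-1 * (T * (om * h) ^+ 2 * K))).
      rewrite ler_wpM2l ?mulr_ge0 ?invr_ge0//; apply: le_trans H _.
      by rewrite ler_wpM2l// mulr_ge0// sqr_ge0.
    rewrite exprMn -[h ^+ 2]real_normK ?num_real//.
    have h0' : `|h| != 0 by rewrite normr_eq0.
    by rewrite le_eqVlt; apply/orP; left; apply/eqP; field.
  have [_] := hC p _ pc pK; rewrite [X in (_ <= X%:E)%E]mulrA; congr (D12_norm _ <= _)%E.
  rewrite uE// uE// duE// mulrDr.
  apply/funext => X; rewrite -[RHS]/(h^-1 * (clift tau _ X - clift tau _ X) - clift tau _ X).
  rewrite /clift; set w := _ `^ _.
  have xh := ltW (stereo_half tau_bnd (sqn_ge0 X)); set x := stereo tau (sqn X) in xh *.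
  have G1 := g1 _ th; have G1' := g1 _ thh'; have G2 := g2 _ th.
  rewrite !plimZ//.
  have -> : plim (fun k => evt (om * e + om * h) (u k) - evt (om * e) (u k) -
      (om * h) *: evt (om * e) (dt (u k))) 0 x =
    plim (fun k => evt (om * e + om * h) (u k)) 0 x - plim (fun k => evt (om * e) (u k)) 0 x -
      om * h * plim (fun k => evt (om * e) (dt (u k))) 0 x.
    have := plim_lin2 1 (-1) (g1 _ thh') (g1 _ th) xh; rewrite mul1r mulN1r => <-.
    have gd : gcauchy (@norm1 R) (fun k => 1 *: evt (om * e + om * h) (u k) + -1 *: evt (om * e) (u k)).
      by apply: gcauchyD; apply: gcauchyZ; exact: g1.
    have := plim_lin2 1 (- (om * h)) gd (g2 _ th) xh; rewrite mul1r mulNr => <-.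
    by congr (plim _ 0 x); apply/funext => k; rewrite !scale1r scaleN1r scaleNr.
  by field.
- apply: (@ereal_squeeze0 _ (nbhs (0 : R)) _ (C * (`|c * om| * (L * `|om| * K)))); first exact: cvg_id.
  have Hn := near_itv he.
  near=> h; rewrite D12_norm_ge0/=.
  have heh : - e0 < e + h < e0 by near: h.
  have thh := om_half heh.
  have thh' : `|om * e + om * h| <= 2^-1 by rewrite -mulrDr.
  pose p k := (c * om) *: (evt (om * e + om * h) (dt (u k)) - evt (om * e) (dt (u k))).
  have pd : gcauchy (@norm1 R) (fun k => evt (om * e + om * h) (dt (u k)) - evt (om * e) (dt (u k))).
    apply: gcauchyD; first exact: g2.
    by have := gcauchyZ (-1) (g2 _ th); under eq_fun do rewrite scaleN1r.
  have pc : gcauchy (@norm1 R) p by exact: gcauchyZ.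
  have pK k : norm1 (p k) <= `|c * om| * (L * `|om| * K) * `|h|.
    apply: le_trans (norm1Z _ _) _; rewrite -mulrA ler_wpM2l//.
    apply: le_trans (hL _ (om * h) (u k) th thh') _; rewrite normrM.
    have -> : L * `|om| * K * `|h| = L * (`|om| * `|h|) * K by ring.
    by rewrite ler_wpM2l// !mulr_ge0.
  have [_] := hC p _ pc pK; rewrite [X in (_ <= X%:E)%E]mulrA; congr (D12_norm _ <= _)%E.
  rewrite duE// duE// mulrDr.
  apply/funext => X; rewrite -[RHS]/(clift tau _ X - clift tau _ X).
  rewrite /clift; set w := _ `^ _.
  have xh := ltW (stereo_half tau_bnd (sqn_ge0 X)); set x := stereo tau (sqn X) in xh *.
  have G2 := g2 _ th; have G2' := g2 _ thh'.
  rewrite !plimZ//.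
  have := plim_lin2 1 (-1) (g2 _ thh') (g2 _ th) xh; rewrite mul1r mulN1r.
  under eq_fun do rewrite scale1r scaleN1r.
  by move=> ->; ring.
Unshelve. all: by end_near. Qed.

End clift_of_limit.

(** * The bifurcating branch *)

Section bifurcation.
Context (R : realType) (N n : nat).
Hypothesis N3 : (3 <= N)%N.
Variable tau : R.
Hypothesis tau_bnd : 0 < tau <= 4^-1.
Hypothesis Phi_ball : forall X, normV X <= 1 -> normV (Phi N n (jnorm R N n) tau X) <= 1.
Hypothesis Phi_half : forall X Y, normV X <= 1 -> normV Y <= 1 ->
  normV (Phi N n (jnorm R N n) tau X - Phi N n (jnorm R N n) tau Y) <= 2^-1 * normV (X - Y).

Local Notation a := (jnorm R N n).
Let N3R : 3 <= N%:R :> R. Proof. by rewrite ler_nat. Qed.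
Let tau_gt0 : 0 < tau. Proof. by case/andP: tau_bnd. Qed.
Let tau_half : tau <= 2^-1.
Proof. by case/andP: tau_bnd => _ h; apply: le_trans h _; rewrite lef_pV2 ?posrE// ler_nat. Qed.
Let a_sym j (_ : (j <= n)%N) := jnorm_sym R N n j.
Let an1 := jnorm_n R n N3.
Let a_out := @jnorm_out R N n.
Let a_rec j (_ : (j <= n)%N) := jnorm_rec R N n j.

Let m : R := (N%:R - 2) / 2.
Definition amp : R := (N%:R * (N%:R - 2)) `^ ((N%:R - 2) / 4).
Definition lead : R := (jpoly R N n)`_n.
(** The speed of t in epsilon. The first-order term of the lift is amp tau^6 t times [Phat], and
    [Phat] at tau xi is tau^n / lead times the Jacobi polynomial; with t = omega epsilon the product
    is exactly epsilon W_n. *)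
Definition omega : R := lead / (amp * tau ^+ (n + 6)).

Lemma amp_gt0 : 0 < amp.
Proof. by rewrite powR_gt0// mulr_gt0//; have := N3R; lra. Qed.

(** The normalisation of the bubble: amp^(4/(N-2)) = N (N - 2) = 4 kappa. The factor 4 is the one in
    front of [clift_laplacian]. *)
Lemma amp_power : amp `^ pexp R N = 4 * kappa R N * amp.
Proof.
have N2 : 0 < N%:R - 2 :> R by have := N3R; lra.
have NN : 0 < N%:R * (N%:R - 2) :> R by rewrite mulr_gt0//; have := N3R; lra.
rewrite /amp -powRrM /pexp.
have -> : (N%:R - 2) / 4 * ((N%:R + 2) / (N%:R - 2)) = 1 + (N%:R - 2) / 4 :> R.
  by field; rewrite gt_eqF.
rewrite powRD ?powRr1 ?ltW//; last by rewrite (gt_eqF NN) implybT.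
by congr (_ * _); rewrite /kappa; field.
Qed.

Lemma omega_neq0 : omega != 0.
Proof.
rewrite mulf_neq0 ?invr_neq0 ?gt_eqF ?mulr_gt0 ?amp_gt0 ?exprn_gt0//.
exact: jpoly_lead_gt0.
Qed.

Local Notation prof := (profile N n a tau).
Local Notation cor := (corr N n a tau).
Local Notation als := (alphas N n a tau).

Definition ucurve (b : bool) : R -> 'rV[R]_N -> R := curve tau amp omega (prof b).
Definition acurve (e : R) : R := plim als 0 (omega * e).
Definition phicurve (b : bool) (e r : R) : R :=
  (1 + r ^+ 2) `^ (- m) * (amp * tau ^+ 6 * omega * plim2 (cor b) (omega * e) 0 (stereo tau (r ^+ 2))).

Let gprof b : gcauchy (@norm2 R) (prof b).
Proof. exact: gcauchy_profile. Qed.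

Let gcor b : gcauchy (@norm2 R) (cor b).
Proof. exact: gcauchy_corr. Qed.

Let gals : gcauchy (@norm1 R) als.
Proof. exact: gcauchy_alphas. Qed.

Lemma prof_limit b t x : `|t| <= 2^-1 -> `|x| <= 2^-1 ->
  plim2 (prof b) t 0 x = 1 + tau ^+ 6 * t *
    ((-1) ^+ b * (evt t (Phat n a tau)).[x] + plim2 (cor b) t 0 x).
Proof.
move=> th xh; apply: cvgn_unique (plim2_cvg (a := 0%N) (gprof b) th xh) _.
have -> : (fun k => (evt t (prof b k))^`(0).[x]) = (fun k => 1 + tau ^+ 6 * t *
    ((-1) ^+ b * (evt t (Phat n a tau)).[x] + (evt t (cor b k))^`(0).[x])).
  apply/funext => k; rewrite /profile evtD evt1 evtM evtD evtM /theta evtM !evt_bicst evtC.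
  by rewrite !derivn0 !(hornerD, hornerM, hornerC, hornerX).
apply: cvgD; first exact: cvg_cst.
apply: cvgMr; apply: cvgD; first exact: cvg_cst.
exact: plim2_cvg.
Qed.

Lemma bubbleE (X : 'rV[R]_N) : bubble X = amp * (1 + sqn X) `^ (- m).
Proof. by rewrite /bubble enorm_sqr powRN. Qed.

Lemma ucurve_expand b e (X : 'rV[R]_N) : `|omega * e| <= 2^-1 ->
  ucurve b e X = bubble X + (-1) ^+ b * e * W N n (enorm X) + e * phicurve b e (enorm X).
Proof.
move=> th; have xh := ltW (stereo_half tau_bnd (sqn_ge0 X)).
rewrite /ucurve /curve /clift prof_limit// bubbleE /W /phicurve !enorm_sqr -powRN.
rewrite {1}/stereo evt_Phat_jacobi// ?gt_eqF//.
have c0 := amp_gt0; have l0 : 0 < lead by exact: jpoly_lead_gt0.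
set w := _ `^ _; set j := jacobi _ _ _ _; set p := plim2 _ _ _ _.
rewrite -/lead; have E : amp * (tau ^+ 6 * (omega * e) * ((-1) ^+ b * (tau ^+ n / lead * j))) =
    (-1) ^+ b * e * j.
  rewrite /omega exprD; field.
  by rewrite (gt_eqF c0) (gt_eqF l0) !expf_neq0 ?gt_eqF.
transitivity (w * (amp + amp * (tau ^+ 6 * (omega * e) * ((-1) ^+ b * (tau ^+ n / lead * j))) +
  amp * (tau ^+ 6 * (omega * e) * p))); first by ring.
by rewrite E /m; ring.
Qed.

Lemma ucurve0 b : ucurve b 0 = @bubble R N.
Proof.
apply/funext => X; rewrite ucurve_expand; last by rewrite mulr0 normr0 invr_ge0.
by rewrite mulr0 !mul0r !addr0.
Qed.

Lemma acurve0 : acurve 0 = alpha_bar R N n.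
Proof.
have N2 : 0 < N%:R - 2 :> R by have := N3R; lra.
rewrite /acurve mulr0 /plim.
have -> : (fun k => (als k)^`(0).[0]) = cst ((1 + lambda_n R N n) / 2).
  by apply/funext => k; rewrite derivn0 alphas0.
rewrite lim_cst// /alpha_bar /lambda_n /kappa /pexp /mu.
field; rewrite !gt_eqF//; have := N3R; lra.
Qed.

Lemma phicurve0 b r : phicurve b 0 r = 0.
Proof.
rewrite /phicurve mulr0 /plim2 /plim.
have -> : (fun k => (evt 0 (cor b k))^`(0).[stereo tau (r ^+ 2)]) = cst 0.
  by apply/funext => k; rewrite evt0_corr derivn0 horner0.
by rewrite lim_cst// !mulr0.
Qed.

Lemma acurve_C1 e0 : 0 < e0 -> `|omega| * e0 <= 2^-1 -> C1_curve_R e0 acurve.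
Proof.
move=> e00 he0 e he.
have hlt e' : - e0 < e' < e0 -> `|omega * e'| < 2^-1.
  rewrite -ltr_norml => h; rewrite normrM; apply: lt_le_trans he0.
  by rewrite ltr_pM2l ?normr_gt0 ?omega_neq0.
have dA e' : - e0 < e' < e0 -> is_derive e' 1 acurve (plim als 1 (omega * e') * omega).
  move=> /hlt h; have d1 := plim_is_derive 0 gals h.
  have d2 : is_derive e' (1 : R) (fun x : R => omega * x) omega.
    have := is_deriveZ omega (is_derive_id e' (1 : R)).
    by rewrite [_ *: 1]mulr1.
  exact: is_derive1_comp.
split; first by have [] := dA e he.
have E : {near e, (fun e' => plim als 1 (omega * e') * omega) =1 derive1 acurve}.
  have : \forall e' \near e, e' \in `]- e0, e0[.
    by apply: near_in_itvoo; rewrite in_itv.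
  by apply: filterS => e'; rewrite in_itv/= => /dA[_ h]; rewrite derive1E h.
have c : {for e, continuous (fun e' => plim als 1 (omega * e') * omega)}.
  apply: cvgMl; apply: (@continuous_comp _ _ _ (fun x => omega * x) (plim als 1)).
    by apply: cvgMr; exact: cvg_id.
  exact: plim_continuous gals (hlt _ he).
have Ee : plim als 1 (omega * e) * omega = derive1 acurve e by exact: (nbhs_singleton E).
have c' : (fun e' => plim als 1 (omega * e') * omega) e' @[e' --> e] --> derive1 acurve e.
  by rewrite -Ee; exact: c.
exact: cvg_trans (near_eq_cvg E) c'.
Qed.

Lemma ucurve_C1 b e0 : `|omega| * e0 <= 2^-1 -> C1_curve_D12_rad e0 (ucurve b).
Proof. by move=> h; exact: (curve_C1 N3 tau_bnd amp h (gprof b)). Qed.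

Lemma radial_ucurve b e : radial (ucurve b e).
Proof. by move=> X Y XY; rewrite /ucurve /curve /clift -!enorm_sqr XY. Qed.

Lemma cor_bound : exists2 C, 0 <= C & forall b t k, `|t| <= 2^-1 -> norm1 (evt t (cor b k)) <= C * `|t|.
Proof.
have [C C0 hC] := evt_lip0 R.
have [K1 K10 h1] := gcauchy_bounded (norm2_rnorm R) (gcor true).
have [K2 K20 h2] := gcauchy_bounded (norm2_rnorm R) (gcor false).
exists (C * (K1 + K2)) => [|b t k th]; first by rewrite mulr_ge0// addr_ge0.
apply: le_trans (hC t _ th _) _; first exact: evt0_corr.
rewrite mulrAC ler_wpM2r// ler_wpM2l//; case: b.
  by apply: le_trans (h1 k) _; rewrite lerDl.
by apply: le_trans (h2 k) _; rewrite lerDr.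
Qed.

Lemma phicurve_D12 : exists2 C, 0 <= C & forall b e, `|omega * e| <= 2^-1 ->
  D12 (fun X : 'rV[R]_N => phicurve b e (enorm X)) /\
  (D12_norm (fun X : 'rV[R]_N => phicurve b e (enorm X)) <= (C * `|e|)%:E)%E.
Proof.
have [C C0 hC] := clift_plim_D12 N3 tau_bnd; have [K K0 hK] := cor_bound.
pose c := amp * tau ^+ 6 * omega.
exists (C * (`|c| * (K * `|omega|))) => [|b e th]; first by rewrite !mulr_ge0.
have th1 := half_le1 th.
have g := gcauchy_evt th1 (gcor b).
have E : (fun X : 'rV[R]_N => phicurve b e (enorm X)) =
    clift tau (plim (fun k => c *: evt (omega * e) (cor b k)) 0).
  apply/funext => X; rewrite /phicurve /clift enorm_sqr plimZ//.
  exact: ltW (stereo_half tau_bnd (sqn_ge0 X)).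
have [|[h1 _] h2] := hC _ (`|c| * (K * `|omega * e|)) (gcauchyZ c g).
  move=> k; apply: le_trans (norm1Z _ _) _; rewrite ler_wpM2l//; exact: hK.
rewrite E; split => //; apply: le_trans h2 _; rewrite lee_fin [`|omega * _|]normrM.
by rewrite le_eqVlt; apply/orP; left; apply/eqP; ring.
Qed.

Lemma solution_ucurve : exists2 e0, 0 < e0 & `|omega| * e0 <= 2^-1 /\
  forall e, - e0 < e < e0 -> is_solution (acurve e) (ucurve false e) (ucurve true e).
Proof.
have [f [K [K0 hf]]] := profile_solution N3 a_sym an1 a_out a_rec tau_gt0 Phi_ball Phi_half tau_half.
(* Chosen so that |t| <= 1/2 and K |t| < 1: the limits are then controlled, and the profiles and [f]
   stay positive. *)
pose e0 := (2 * (`|omega| * (K + 1)))^-1.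
have om0 : 0 < `|omega| by rewrite normr_gt0 omega_neq0.
have K1 : 0 < K + 1 by rewrite ltr_wpDl.
have e00 : 0 < e0 by rewrite invr_gt0 !mulr_gt0.
have hom : `|omega| * e0 <= 2^-1.
  rewrite /e0 ler_pdivrMr ?mulr_gt0//; have := ltW om0; nra.
have hKe : K * (`|omega| * e0) < 1.
  rewrite [K * _]mulrA /e0 ltr_pdivrMr ?mulr_gt0//; nra.
exists e0 => //; split => // e he.
have th : `|omega * e| <= 2^-1 by exact: (om_half hom).
have Kt : K * `|omega * e| < 1.
  apply: le_lt_trans hKe; rewrite ler_wpM2l// normrM ler_wpM2l// ltW//.
  by rewrite ltr_norml.
pose v b x := plim2 (prof b) (omega * e) 0 x.
have hv x b : `|x| < 2^-1 -> 0 < v b x /\ f b (omega * e) x = v b x `^ pexp R N.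
  move=> /ltW xh; have [h1 h2 h3 _] := hf (omega * e) x th xh b.
  have pos y : `|y - 1| <= K * `|omega * e| -> 0 < y.
    by move=> h; have := le_lt_trans h Kt; rewrite ltr_norml; lra.
  have v0 := pos _ h1; have f0 := pos _ h2; split => //.
  have N20 : (0 < N - 2)%N by rewrite subn_gt0.
  (* Both bases are positive, so the relation between integer powers determines [f] after a real
     root of order N - 2. *)
  have : (f b (omega * e) x `^ (N - 2)%:R) `^ ((N - 2)%:R)^-1 =
      (plim2 (prof b) (omega * e) 0 x `^ (N + 2)%:R) `^ ((N - 2)%:R)^-1.
    by rewrite !powR_mulrn ?ltW// h3.
  rewrite -!powRrM divff ?pnatr_eq0 -?lt0n// powRr1 ?ltW// => ->.
  by rewrite natrD natrB ?(ltnW N3).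
have amp0 := amp_gt0.
have uE b : ucurve b e = clift tau (plim (fun k => amp *: evt (omega * e) (prof b k)) 0).
  rewrite /ucurve /curve; apply: (clift_eq N tau_bnd) => x xh; rewrite plimZ ?(ltW xh)//.
  by apply: gcauchy_evt (gprof b); exact: half_le1.
have g b : gcauchy (@norm1 R) (fun k => amp *: evt (omega * e) (prof b k)).
  by apply: gcauchyZ; apply: gcauchy_evt (gprof b); exact: half_le1.
have plE b i x : `|x| < 2^-1 -> plim (fun k => amp *: evt (omega * e) (prof b k)) i x =
    amp * plim2 (prof b) (omega * e) i x.
  move=> /ltW xh; apply: cvgn_unique (plim_cvg (a := i) (g b) xh) _.
  under eq_fun do rewrite derivnZ hornerZ.
  by apply: cvgMr; exact: plim2_cvg.
have cn b : Cn 2 (ucurve b e).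
  rewrite uE; exact: (clift_Cn2 N tau_bnd (fun x xh => plim_is_derive 0 (g b) xh)
    (fun x xh => plim_is_derive 1 (g b) xh) (fun x xh => plim_continuous (g b) xh)).
have pw b X : critical_power N (ucurve b e X) =
    (1 + sqn X) `^ (- (m + 2)) * (4 * kappa R N * amp * f b (omega * e) (stereo tau (sqn X))).
  have xh := stereo_half tau_bnd (sqn_ge0 X); have [v0 ->] := hv _ b xh.
  have s1 : 0 <= 1 + sqn X by exact: le_trans ler01 (onesqn_ge1 X).
  rewrite /critical_power -/(pexp R N) /ucurve /curve /clift -/(v b _).
  rewrite powRM ?powR_ge0 ?mulr_ge0 ?(ltW amp0) ?(ltW v0)//.
  rewrite powRM ?(ltW amp0) ?(ltW v0)// amp_power -powRrM; congr (_ `^ _ * _).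
  by rewrite /m /pexp; field; rewrite gt_eqF//; have := N3R; lra.
have lap b X : - laplacian (ucurve b e) X =
    acurve e * critical_power N (ucurve b e X) +
    (1 - acurve e) * critical_power N (ucurve (~~ b) e X).
  have xh := stereo_half tau_bnd (sqn_ge0 X).
  rewrite !pw {1}uE (clift_laplacian tau_bnd (fun x xh => plim_is_derive 0 (g b) xh)
    (fun x xh => plim_is_derive 1 (g b) xh)).
  set x := stereo tau (sqn X) in xh *; rewrite !plE//.
  have [_ _ _] := hf (omega * e) x th (ltW xh) b; rewrite -/(acurve e) => ode.
  set w := _ `^ _.
  transitivity (4 * w * amp * ((x ^+ 2 - tau ^+ 2) * plim2 (prof b) (omega * e) 2 x +
    N%:R * x * plim2 (prof b) (omega * e) 1 x + kappa R N * plim2 (prof b) (omega * e) 0 x)).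
    by rewrite /kappa; ring.
  by rewrite ode; ring.
split.
- by split; exact: cn.
- by move=> X; exact: (lap false).
- by move=> X; rewrite [LHS](lap true) [RHS]addrC.
- have up b X : 0 < ucurve b e X.
    have [v0 _] := hv _ b (stereo_half tau_bnd (sqn_ge0 X)).
    rewrite /ucurve /curve /clift mulr_gt0 ?powR_gt0 ?mulr_gt0//.
    exact: lt_le_trans ltr01 (onesqn_ge1 X).
  by move=> X; split; exact: up.
- have [C C0 hC] := clift_plim_D12 N3 tau_bnd.
  have D b : D12 (ucurve b e).
    have [L _ hL] := gcauchy_bounded (norm1_rnorm R) (g b).
    by rewrite uE; have [[]] := hC _ L (g b) hL.
  by split; exact: D.
Qed.

(** At the origin the difference from the bubble is amp tau^6 omega e (P1 + q), where P1 > 0 is the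
    value of the eigenfunction at xi = 1 and q, the value of the corrector, is of order e. *)
Lemma ucurve_neq_bubble : exists2 e0, 0 < e0 &
  forall e, - e0 < e < e0 -> e != 0 -> ucurve false e <> @bubble R N.
Proof.
have [C C0 hC] := plim_bound R 0; have [K K0 hK] := cor_bound.
pose P1 := tau ^+ n / lead * (jpoly R N n).[1].
have l0 : 0 < lead by exact: jpoly_lead_gt0.
have P10 : 0 < P1 by rewrite mulr_gt0 ?jpoly1_gt0// divr_gt0 ?exprn_gt0.
have om0 : 0 < `|omega| by rewrite normr_gt0 omega_neq0.
have CK0 : 0 <= C * K by rewrite mulr_ge0.
(* The first bound gives |t| <= 1/2, the second makes C K |omega e|, and hence |q|, smaller than
   P1. *)
pose e0 := Num.min (2 * `|omega|)^-1 (P1 / (`|omega| * (C * K + 1))).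
have e00 : 0 < e0 by rewrite lt_min invr_gt0 mulr_gt0//= divr_gt0// mulr_gt0// ltr_wpDl.
exists e0 => // e he e_neq0 /(congr1 (fun u => u 0)).
have : `|e| < e0 by rewrite ltr_norml.
rewrite lt_min => /andP[e1 e2].
have th : `|omega * e| <= 2^-1.
  rewrite normrM; move: (ltW e1); rewrite invfM => h.
  by rewrite -(ler_pdivlMl _ _ om0) mulrC.
have s0 : sqn (0 : 'rV[R]_N) = 0 by rewrite /sqn big1// => i _; rewrite mxE expr0n.
have st : stereo tau 0 = tau by rewrite /stereo subr0 addr0 divff ?mulr1 ?oner_neq0.
have tauh : `|tau| <= 2^-1 by rewrite gtr0_norm.
rewrite bubbleE /ucurve /curve /clift s0 st addr0 powR1 mul1r mulr1 prof_limit//.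
rewrite [X in X * _ + _]expr0 mul1r.
have -> : (evt (omega * e) (Phat n a tau)).[tau] = P1.
  by have := @evt_Phat_jacobi R N n tau (omega * e) 1; rewrite mulr1 -jpolyE gt_eqF// => ->.
set q := plim2 _ _ _ _ => h.
have qC : `|q| <= C * (K * `|omega * e|).
  apply: hC => //; first by apply: gcauchy_evt (gcor false); exact: half_le1.
  by move=> k; exact: hK.
have q1 : `|q| < P1.
  apply: le_lt_trans qC _; rewrite normrM mulrA.
  move: e2; rewrite ltr_pdivlMr ?mulr_gt0 ?ltr_wpDl// => e2.
  by apply: le_lt_trans e2; have := normr_ge0 e; nra.
have nz : amp * (tau ^+ 6 * (omega * e)) != 0.
  apply: mulf_neq0; first by rewrite gt_eqF ?amp_gt0.
  apply: mulf_neq0; first by rewrite expf_neq0 ?gt_eqF.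
  exact: mulf_neq0 omega_neq0 e_neq0.
have Pq : P1 + q = 0.
  apply: (mulfI nz); rewrite mulr0; move: h; rewrite mulrDr mulr1 => /eqP.
  by rewrite -subr_eq0 addrAC subrr add0r mulrA => /eqP.
by move: q1; rewrite ltr_norml; lra.
Qed.

End bifurcation.

(** The clause that excludes the trivial pair for [e != 0] makes the point a genuine bifurcation
    point: with phi merely bounded, epsilon phi could cancel epsilon W_n. The limits of the norms of
    [phi1] and [phi2] likewise make W_n the actual tangent direction. *)
Theorem theorem1p4 (R : realType) (N : nat) (hN : (3 <= N)%N)
    (n : nat) (hn : (2 <= n)%N) :
  exists (e0 : R) (alpha : R -> R) (u1 u2 : R -> 'rV[R]_N -> R)
         (phi1 phi2 : R -> R -> R),
    [/\ 0 < e0,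
        [/\ C1_curve_R e0 alpha, C1_curve_D12_rad e0 u1
          & C1_curve_D12_rad e0 u2],
        [/\ alpha 0 = alpha_bar R N n, u1 0 = @bubble R N
          & u2 0 = @bubble R N],
        (forall e : R, - e0 < e < e0 ->
          [/\ is_solution (alpha e) (u1 e) (u2 e), radial (u1 e)
            & radial (u2 e)]) /\
        (forall e : R, - e0 < e < e0 -> e != 0 ->
          ~ (u1 e = @bubble R N /\ u2 e = @bubble R N))
      & [/\ forall e : R, - e0 < e < e0 -> forall x : 'rV[R]_N,
              u1 e x = bubble x + e * W N n (enorm x) + e * phi1 e (enorm x) /\
              u2 e x = bubble x - e * W N n (enorm x) + e * phi2 e (enorm x),
            exists C : R, forall e : R, - e0 < e < e0 ->
              [/\ D12 (fun x : 'rV[R]_N => phi1 e (enorm x)),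
                  D12 (fun x : 'rV[R]_N => phi2 e (enorm x)),
                  (D12_norm (fun x : 'rV[R]_N => phi1 e (enorm x)) <= C%:E)%E
                & (D12_norm (fun x : 'rV[R]_N => phi2 e (enorm x)) <= C%:E)%E],
            (forall r, phi1 0 r = 0) /\ (forall r, phi2 0 r = 0),
            D12_norm (fun x : 'rV[R]_N => phi1 e (enorm x)) @[e --> 0] --> 0%E
          & D12_norm (fun x : 'rV[R]_N => phi2 e (enorm x)) @[e --> 0] --> 0%E]].
Proof.
have [tau tau_bnd [ball half]] := contraction_exists n hN (jnorm R N n).
have [e1 e10 [om1 sol]] := solution_ucurve hN tau_bnd ball half.
have [e2 e20 nontriv] := ucurve_neq_bubble hN tau_bnd ball half.
have [C C0 hC] := phicurve_D12 hN tau_bnd ball half.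
pose e0 := Num.min e1 e2; have e00 : 0 < e0 by rewrite lt_min e10.
have le1 e : - e0 < e < e0 -> - e1 < e < e1.
  by rewrite -!ltr_norml lt_min => /andP[].
have le2 e : - e0 < e < e0 -> - e2 < e < e2.
  by rewrite -!ltr_norml lt_min => /andP[].
have om0 : `|omega N n tau| * e0 <= 2^-1.
  by apply: le_trans om1; rewrite ler_wpM2l// ge_min lexx.
have hom e : - e0 < e < e0 -> `|omega N n tau * e| <= 2^-1 by exact: om_half.
have cu b : C1_curve_D12_rad e0 (@ucurve R N n tau b) by exact: (ucurve_C1 hN tau_bnd ball half b om0).
have lim0 b : D12_norm (fun x : 'rV[R]_N => phicurve N n tau b e (enorm x)) @[e --> 0] --> 0%E.
  apply: (@ereal_squeeze0 _ _ (nbhs (0 : R)) _ C); first exact: cvg_id.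
  have : \forall e \near (0 : R), - e0 < 0 + e < e0 by apply: near_itv; rewrite oppr_lt0 e00.
  by apply: filterS => e; rewrite add0r => /hom/(hC b)[_ ->]; rewrite D12_norm_ge0.
exists e0, (acurve N n tau), (ucurve n tau false), (ucurve n tau true),
  (phicurve N n tau false), (phicurve N n tau true); split => //.
- by split; [exact: (acurve_C1 hN tau_bnd ball half)|exact: cu|exact: cu].
- by split; [exact: acurve0|exact: (ucurve0 hN tau_bnd ball half)|exact: (ucurve0 hN tau_bnd ball half)].
- split => [e he|e he e_neq0 [h _]]; first by split; [exact/sol/le1|exact: radial_ucurve|exact: radial_ucurve].
  exact: nontriv (le2 _ he) e_neq0 h.
- split => //.
  + move=> e /hom th x; rewrite !(ucurve_expand hN tau_bnd ball half)// expr0 expr1 mul1r mulN1r.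
    by rewrite mulNr.
  + exists (C * e0) => e he; have [d1 l1] := hC false e (hom e he); have [d2 l2] := hC true e (hom e he).
    have le : ((C * `|e|)%:E <= (C * e0)%:E)%E.
      by rewrite lee_fin ler_wpM2l// ltW// ltr_norml.
    split; [exact: d1|exact: d2|exact: le_trans l1 le|exact: le_trans l2 le].
  + by split => r; exact: phicurve0.
Qed.
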